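(* Let $S$ be a closed, densely defined, symmetric operator in a separable Hilbert space $\mathcal H$, let $\{\mathcal G,\Gamma_0,\Gamma_1\}$ be a quasi boundary triple for $\overline T=S^*$ with corresponding $\gamma$-field $\gamma$ and Weyl function $M$, let $A_0=T\upharpoonright\ker\Gamma_0$ and let $E(\cdot)$ be the spectral measure of $A_0$. Let $\Delta\subset\mathbb R$ be an open interval such that $$E(\Delta)\mathcal H=\operatorname{clsp}\{E(\Delta)\gamma(\nu)g:\nu\in\mathbb C\setminus\mathbb R,\ g\in\operatorname{ran}\Gamma_0\},$$ and let $\lambda\in\Delta$. Then: (a) $\lambda$ is an eigenvalue of $A_0$ if and only if $R_\lambda M:=\text{s-}\lim_{\eta\searrow0}i\eta M(\lambda+i\eta)\ne0$. If the multiplicity of the eigenvalue $\lambda$ is finite, then the mapping $\tau:\ker(A_0-\lambda)\to\operatorname{ran}R_\lambda M$, $u\mapsto\Gamma_1u$, is bijective; if the multiplicity of the eigenvalue $\lambda$ is infinite, then the mapping $\tau:\ker(A_0-\lambda)\to\operatorname{cl}_\tau(\operatorname{ran}R_\lambda M)$, $u\mapsto\Gamma_1u$, is bijective, where $\operatorname{cl}_\tau$ denotes the closure in the normed space $\operatorname{ran}\tau=\Gamma_1(\ker(A_0-\lambda))$ (with the norm of $\mathcal G$). (b) $\lambda$ is an isolated eigenvalue of $A_0$ if and only if $\lambda$ is a pole in the strong sense of $M$. In this case $R_\lambda M$ is the residue of $M$ in the strong sense at $\lambda$.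
   Context: Quasi boundary triple: let $S$ be a closed, densely defined, symmetric operator in a separable Hilbert space $\mathcal H$ and let $T\subset S^*$ be an operator with $\overline T=S^*$. A triple $\{\mathcal G,\Gamma_0,\Gamma_1\}$ consisting of a Hilbert space $\mathcal G$ and two linear mappings $\Gamma_0,\Gamma_1:\operatorname{dom}T\to\mathcal G$ is a quasi boundary triple for $S^*$ if (1) the range of $(\Gamma_0,\Gamma_1)^\top:\operatorname{dom}T\to\mathcal G\times\mathcal G$ is dense; (2) $(Tu,v)_{\mathcal H}-(u,Tv)_{\mathcal H}=(\Gamma_1u,\Gamma_0v)_{\mathcal G}-(\Gamma_0u,\Gamma_1v)_{\mathcal G}$ for all $u,v\in\operatorname{dom}T$; (3) $A_0:=T\upharpoonright\ker\Gamma_0$ is selfadjoint in $\mathcal H$. For $\lambda\in\rho(A_0)$ one has $\operatorname{dom}T=\ker\Gamma_0\dotplus\ker(T-\lambda)$; the $\gamma$-field and Weyl function are $\gamma(\lambda)=(\Gamma_0\upharpoonright\ker(T-\lambda))^{-1}$ and $M(\lambda)=\Gamma_1\gamma(\lambda)$, both defined on the dense subspace $\operatorname{ran}\Gamma_0$ of $\mathcal G$. The limit $(R_\lambda M)g=\lim_{\eta\searrow0}i\eta M(\lambda+i\eta)g$ exists for all $\lambda\in\mathbb R$, $g\in\operatorname{ran}\Gamma_0$; s-$\lim$ is the strong limit on $\operatorname{ran}\Gamma_0$. $\operatorname{clsp}$ denotes the closed linear span. $\lambda$ is a pole in the strong sense of $M$ if there is an open neighborhood $\mathcal O$ of $\lambda$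 such that $\zeta\mapsto M(\zeta)g$ is holomorphic on $\mathcal O\setminus\{\lambda\}$ for all $g\in\operatorname{ran}\Gamma_0$ and has a pole at $\lambda$ for some $g\in\operatorname{ran}\Gamma_0$. The residue in the strong sense is $(\operatorname{Res}_\lambda M)g=\frac1{2\pi i}\int_{\mathcal C}M(z)g\,dz$, $g\in\operatorname{ran}\Gamma_0$, where $\mathcal C$ is the boundary of an open ball $B$ around $\lambda$ such that $M$ is strongly holomorphic in a neighborhood of $\overline B$ except the point $\lambda$. An isolated eigenvalue is an eigenvalue that is an isolated point of $\sigma(A_0)$. *)

(* Defs.v *)
From HB Require Import structures.
From mathcomp Require Import all_boot all_order all_algebra.
From mathcomp Require Import all_classical all_reals all_analysis.
From mathcomp Require Import complex.

Set Implicit Arguments.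
Unset Strict Implicit.
Unset Printing Implicit Defensive.
Import Order.TTheory GRing.Theory Num.Theory.
Import numFieldNormedType.Exports.

Local Open Scope classical_set_scope.
Local Open Scope ring_scope.
Local Open Scope complex_scope.

(* A complex Hilbert space is a complete normed module H over R[i] together
   with a positive definite sesquilinear form ip : {dot H for Num.conj} (linear in
   the first argument) that induces the norm. *)
Definition hilbert (R : realType) (H : completeNormedModType R[i])
    (ip : {dot H for @Num.conj R[i]}) : Prop :=
  forall u : H, `|u| ^+ 2 = ip u u.

Definition separable_space (T : topologicalType) : Prop :=
  exists2 D : set T, countable D & dense D.

Section Operators.
Context {R : realType}.
Local Notation C := R[i].

Definition subspace_closed {V : lmodType C} (D : set V) : Prop :=
  D 0 /\ forall (a : C) u v, D u -> D v -> D (a *: u + v).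

Definition linear_on {V W : lmodType C} (D : set V) (f : V -> W) : Prop :=
  forall (a : C) u v, D u -> D v -> f (a *: u + v) = a *: f u + f v.

(* span of an arbitrary subset: finite linear combinations *)
Definition lspan {V : lmodType C} (A : set V) : set V :=
  [set x | exists (n : nat) (c : 'I_n -> C) (v : 'I_n -> V),
     (forall i, A (v i)) /\ x = \sum_(i < n) c i *: v i].

Definition clsp {V : normedModType C} (A : set V) : set V := closure (lspan A).

(* closure of A in the subspace topology of Y, i.e. closure A `&` Y when
   A `<=` Y; points of A outside Y are kept *)
Definition closure_in {T : topologicalType} (Y A : set T) : set T :=
  @closure (subspace Y) A.

Definition finite_dimensional {V : lmodType C} (D : set V) : Prop :=
  exists (n : nat) (e : 'I_n -> V), D = lspan (range e).

(* An operator in H, defined on a subset; the values outside the domain are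
   irrelevant. *)
Record operator (V : Type) := Operator { dom : set V ; app :> V -> V }.

Definition linear_operator {V : lmodType C} (A : operator V) : Prop :=
  subspace_closed (dom A) /\ linear_on (dom A) A.

Definition graph {V : Type} (A : operator V) : set (V * V) :=
  [set p | dom A p.1 /\ p.2 = A p.1].

Definition op_restrict {V : Type} (A : operator V) (D : set V) : operator V :=
  Operator (dom A `&` D) A.

Definition op_eigenspace {V : lmodType C} (A : operator V) (z : C) : set V :=
  [set u | dom A u /\ A u = z *: u].

Definition is_eigenvalue {V : lmodType C} (A : operator V) (z : C) : Prop :=
  exists2 u, op_eigenspace A z u & u != 0.

Definition resolvent_set {V : normedModType C} (A : operator V) : set C :=
  [set z | set_bij (dom A) [set: V] (fun u => A u - z *: u) /\
    exists c : R, forall u, dom A u -> `|u| <= c%:C * `|A u - z *: u| ].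

Definition spectrum {V : normedModType C} (A : operator V) : set C :=
  ~` resolvent_set A.

Definition is_isolated_eigenvalue {V : normedModType C} (A : operator V)
    (z : C) : Prop :=
  is_eigenvalue A z /\ isolated (spectrum A : set C^o) z.

Section Adjoint.
Context {H : completeNormedModType C} (ip : {dot H for @Num.conj C}).

(* graph of the adjoint A^*; it is single-valued when dom A is dense *)
Definition adjoint_graph (A : operator H) : set (H * H) :=
  [set p | forall u, dom A u -> ip (A u) p.1 = ip u p.2].

Definition symmetric_operator (A : operator H) : Prop :=
  forall u v, dom A u -> dom A v -> ip (A u) v = ip u (A v).

Definition selfadjoint (A : operator H) : Prop :=
  dense (dom A) /\ graph A = adjoint_graph A.

(* E is the spectral measure of A: a strongly sigma-additive
   orthogonal-projection-valued measure on the Borel sets of R with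
   A = \int t dE(t).  The integral is expressed through the measures
   B |-> (E(B) u, u); as dom A is a linear subspace, the diagonal values
   (A u, u) determine A by polarization. *)
Definition diag_measure (E : set R -> H -> H) (u : H) : set R -> \bar R :=
  fun B => (complex.Re (ip (E B u) u))%:E.

Record spectral_measure (A : operator H) (E : set R -> H -> H) : Prop := {
  sm_linear : forall B, measurable B -> linear_on [set: H] (E B) ;
  sm_idem : forall B u, measurable B -> E B (E B u) = E B u ;
  sm_sym : forall B u v, measurable B -> ip (E B u) v = ip u (E B v) ;
  sm_total : forall u, E [set: R] u = u ;
  sm_sigma_additive : forall (F : nat -> set R) u,
    (forall n, measurable (F n)) -> trivIset [set: nat] F ->
    (fun n => \sum_(0 <= k < n) E (F k) u) @ \oo --> E (\bigcup_n F n) u ;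
  sm_dom : dom A =
    [set u | (\int[diag_measure E u]_(t in [set: R]) ((t ^+ 2)%:E) < +oo)%E] ;
  sm_integral : forall u, dom A u ->
    ip (A u) u =
    (fine (\int[diag_measure E u]_(t in [set: R]) (t%:E))%E)%:C
}.

End Adjoint.

Section QuasiBoundaryTriple.
Context {H G : completeNormedModType C}.
Context (ipH : {dot H for @Num.conj C}) (ipG : {dot G for @Num.conj C}).

(* T restricted to ker Gamma_0 *)
Definition A_zero (T : operator H) (Gamma0 : H -> G) : operator H :=
  op_restrict T [set u | Gamma0 u = 0].

(* The values of Gamma0 and Gamma1 outside dom T are irrelevant. *)
Record quasi_boundary_triple (S T : operator H) (Gamma0 Gamma1 : H -> G)
    : Prop := {
  qbt_linear : linear_operator T ;
  qbt_sub : graph T `<=` adjoint_graph ipH S ;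
  qbt_closure : closure (graph T) = adjoint_graph ipH S ;
  qbt_linear0 : linear_on (dom T) Gamma0 ;
  qbt_linear1 : linear_on (dom T) Gamma1 ;
  qbt_dense : dense [set (Gamma0 u, Gamma1 u) | u in dom T] ;
  qbt_green : forall u v, dom T u -> dom T v ->
    ipH (T u) v - ipH u (T v) =
    ipG (Gamma1 u) (Gamma0 v) - ipG (Gamma0 u) (Gamma1 v) ;
  qbt_selfadjoint : selfadjoint ipH (A_zero T Gamma0)
}.

Context (T : operator H) (Gamma0 Gamma1 : H -> G).

Definition ran0 : set G := Gamma0 @` dom T.

(* 'pinv_ is a genuine inverse on Gamma0 @` op_eigenspace T z as soon as Gamma0 is
   injective on ker (T - z), which holds for z in the resolvent set of A_0;
   outside that set these total functions carry no meaning. *)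
Definition gamma_field (z : C) : G -> H :=
  'pinv_(fun=> 0) (op_eigenspace T z) Gamma0.

Definition weyl (z : C) (g : G) : G := Gamma1 (gamma_field z g).

Definition RM_net (lam : R) (g : G) (eta : R) : G :=
  (0 +i* eta) *: weyl (lam +i* eta) g.

Definition RM (lam : R) (g : G) : G := lim (RM_net lam g @ 0^'+).

Definition holomorphic_on (U : set C) (f : C -> G) : Prop :=
  forall z, U z -> derivable (f : C^o -> G) z 1.

Definition has_pole (f : C -> G) (z0 : C) : Prop :=
  exists (n : nat) (V : set C^o) (h : C -> G),
    [/\ (0 < n)%N, open_nbhs (z0 : C^o) V, holomorphic_on V h, h z0 != 0 &
        forall z, V z -> z != z0 -> f z = (z - z0) ^- n *: h z].

(* N is the strongly holomorphic function on U given by the Weyl function M.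
   M itself is only defined on the resolvent set of A_0, which contains all
   nonreal numbers and hence is dense in U: N is M, continued analytically to
   the points of U in the spectrum, if there are any. *)
Definition strongly_holomorphic_weyl (U : set C) (N : C -> G -> G) : Prop :=
  (forall z g, U z -> resolvent_set (A_zero T Gamma0) z -> ran0 g ->
     N z g = weyl z g) /\
  (forall g, ran0 g -> holomorphic_on U (N^~ g)).

Definition strong_pole (z0 : C) : Prop :=
  exists (O : set C^o) (N : C -> G -> G),
    [/\ open_nbhs (z0 : C^o) O,
        strongly_holomorphic_weyl (O `\ z0) N &
        exists2 g, ran0 g & has_pole (N^~ g) z0].

(* Riemann integral of a G-valued function over [a, b]; the tags of the
   partition a :: s are t 0, t 1, ... *)
Definition is_riemann_integral (a b : R) (f : R -> G) (I : G) : Prop :=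
  forall eps : R, 0 < eps -> exists2 delta : R, 0 < delta &
    forall (s : seq R) (t : nat -> R), itv_partition a b s ->
      (forall i, (i < size s)%N ->
         [/\ nth b (a :: s) i <= t i, t i <= nth b (a :: s) i.+1 &
             nth b (a :: s) i.+1 - nth b (a :: s) i < delta]) ->
      `| \sum_(i < size s)
           (nth b (a :: s) i.+1 - nth b (a :: s) i)%:C *: f (t i) - I |
      < eps%:C.

(* integral over the positively oriented circle z = z0 + r e^{i theta} *)
Definition is_circle_integral (z0 : C) (r : R) (f : C -> G) (I : G) : Prop :=
  let e theta : C := cos theta +i* sin theta in
  is_riemann_integral 0 (2 * pi)
    (fun theta => ('i%C * r%:C * e theta) *: f (z0 + r%:C * e theta)) I.

(* Q is the strong residue at z0, whichever admissible circle is used *)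
Definition is_strong_residue (z0 : C) (Q : G -> G) : Prop :=
  forall (r : R) (U : set C^o) (N : C -> G -> G), 0 < r -> open U ->
    [set z : C | `|z - z0| <= r%:C] `<=` U ->
    strongly_holomorphic_weyl (U `\ z0) N ->
    forall g, ran0 g -> exists2 I : G,
      is_circle_integral z0 r (N^~ g) I &
      Q g = (2 * pi%:C * 'i%C)^-1 *: I.

End QuasiBoundaryTriple.
End Operators.

(* Main.v *)
(* With x = gamma(i) g, Green's identity gives M(z) g = M(i) g + (z - i) Gamma1 R(z) x,
   where R(z) is the resolvent of A_0 and Gamma1 R(i) is bounded.  Splitting off the
   eigenprojection p = E {lambda} x, von Neumann's ergodic argument on the
   remaining part yields R_lambda M g = (i - lambda) Gamma1 p.  Moreover
   (Gamma1 u, g) = (lambda - conj nu) (u, gamma(nu) g) for u in ker (A_0 - lambda), so the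
   simplicity assumption on Delta implies that Gamma1 is injective on this
   eigenspace and that the vectors p are dense in it; this is part (a).
   For part (b), eta |gamma(s + i eta) g|^2 = Im (M(s + i eta) g, g) tends to 0 wherever
   M(.) g extends continuously across the real axis, and a Stone-type criterion
   turns this into E(I) gamma(nu) g = 0 for intervals I in the domain of holomorphy.
   Conversely, a spectral gap around lambda allows to solve (A_0 - lambda) y_{n+1} = y_n
   starting from y_0 = x - p with geometric bounds on y_n, which gives the Laurent expansion
   of M(.) g at lambda, with residue (i - lambda) Gamma1 p. *)

(* [Gamma0] and [Gamma1] live on [dom T] only and carry no boundedness assumption, so no limit in H
   can be pushed through them directly. Each limit goes through |Gamma1 R(z) f| <= c (|f| + |z - i|
   |R(z) f|), which reduces convergence in G to resolvent estimates in H. The spectral measure is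
   tied to A_0 only by its domain and the diagonal forms (A_0 u, u). No functional calculus is
   built: commutation of E with A_0, localization and the lower bound over a spectral gap are
   extracted from these forms, and solving (A_0 - lambda) y = x - p replaces the reduced resolvent
   at the eigenvalue. A pole of M, or an admissible circle, provides just a continuation N of M
   across the real axis and says nothing directly about the resolvent set. The link is that N makes
   E(I) vanish on the vectors gamma(nu) g; for a pole, simplicity spreads this to all of H and so
   returns resolvent points, while the residue is computed g by g from the vector gamma(i) g. The
   factor i - lambda comes from R(z) p = (lambda - z)^(-1) p, since (z - lambda)(z - i)(lambda -
   z)^(-1) = i - z. *)
Require Import Defs.
From HB Require Import structures.
From mathcomp Require Import all_boot all_order all_algebra.
From mathcomp Require Import all_classical all_reals all_analysis.
From mathcomp Require Import complex measurable_realfun ring lra.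

Set Implicit Arguments.
Unset Strict Implicit.
Unset Printing Implicit Defensive.
Import Order.TTheory GRing.Theory Num.Theory.
Import numFieldNormedType.Exports.
Local Open Scope classical_set_scope.
Local Open Scope ring_scope.
Local Open Scope complex_scope.

(* Square-zero extension of a ring by a module: embedding the module into this
   commutative ring lets the tactic ring prove module identities. *)
Definition sqzext (K : comNzRingType) (V : lmodType K) : Type := (K * V)%type.

Section SquareZero.
Variables (K : comNzRingType) (V : lmodType K).
HB.instance Definition _ := GRing.Zmodule.copy (sqzext V) (K * V)%type.

Let mul (x y : sqzext V) : sqzext V := (x.1 * y.1, x.1 *: y.2 + y.1 *: x.2).
Let one : sqzext V := (1, 0).

Let mulA : associative mul.
Proof.
move=> [a u] [b v] [c w]; congr pair => /=; first by rewrite mulrA.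
by rewrite !scalerDr !scalerA addrA (mulrC c) (mulrC c b).
Qed.

Let mulC : commutative mul.
Proof. by move=> [a u] [b v]; congr pair => /=; [rewrite mulrC | rewrite addrC]. Qed.

Let mul1 : left_id one mul.
Proof.
by move=> [a u]; congr pair => /=; rewrite ?mul1r// scale1r scaler0 addr0.
Qed.

Let mulD : left_distributive mul +%R.
Proof.
move=> [a u] [b v] [c w]; congr pair => /=; first by rewrite mulrDl.
by rewrite scalerDl scalerDr addrACA.
Qed.

HB.instance Definition _ :=
  GRing.Zmodule_isComPzRing.Build (sqzext V) mulA mulC mul1 mulD.

Definition sqz_scal (a : K) : sqzext V := (a, 0).
Definition sqz_vec (v : V) : sqzext V := (0, v).

Let scal_additive : zmod_morphism sqz_scal.
Proof. by move=> a b; congr pair; rewrite /= ?subr0. Qed.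
HB.instance Definition _ := GRing.isZmodMorphism.Build K (sqzext V) sqz_scal scal_additive.
Let scal_monoid : monoid_morphism sqz_scal.
Proof. by split => // a b; congr pair; rewrite /= !scaler0 addr0. Qed.
HB.instance Definition _ := GRing.isMonoidMorphism.Build K (sqzext V) sqz_scal scal_monoid.

Let vec_additive : zmod_morphism sqz_vec.
Proof. by move=> a b; congr pair; rewrite /= ?subr0. Qed.
HB.instance Definition _ := GRing.isZmodMorphism.Build V (sqzext V) sqz_vec vec_additive.

Lemma sqz_inj u v : sqz_vec u = sqz_vec v -> u = v. Proof. by case. Qed.
Lemma sqzZ a u : sqz_vec (a *: u) = sqz_scal a * sqz_vec u.
Proof. by congr pair; rewrite /= ?mulr0 ?scale0r ?addr0. Qed.
Lemma sqzD u v : sqz_vec (u + v) = sqz_vec u + sqz_vec v.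
Proof. exact: raddfD. Qed.
Lemma sqzN u : sqz_vec (- u) = - sqz_vec u.
Proof. exact: raddfN. Qed.
Lemma sqzMn u n : sqz_vec (u *+ n) = sqz_vec u *+ n.
Proof. exact: raddfMn. Qed.
Lemma sqz0 : sqz_vec 0 = 0.
Proof. exact: raddf0. Qed.
End SquareZero.

Ltac lmod_ring := apply: sqz_inj; rewrite ?(sqzD, sqzN, sqzZ, sqzMn, sqz0); ring.

(** * Real-valued norms and limits in epsilon form *)

Section RealNorm.
Context {R : realType}.
Local Notation C := R[i].

(** The library norm of a module over [R[i]] takes values in [R[i]], which is only partially
    ordered; its real part lives in the field [R], where [lra] and [nra] apply. *)
Definition nrm {V : normedZmodType C} (u : V) : R := complex.Re `|u|.

Lemma nrmE {V : normedZmodType C} (u : V) : `|u| = (nrm u)%:C.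
Proof. by rewrite /nrm RRe_real// normr_real. Qed.

Lemma nrm_ge0 {V : normedZmodType C} (u : V) : 0 <= nrm u.
Proof. by rewrite -lecR -nrmE normr_ge0. Qed.

Lemma nrm0 {V : normedZmodType C} : nrm (0 : V) = 0.
Proof. by rewrite /nrm normr0. Qed.

Lemma nrm_eq0 {V : normedZmodType C} (u : V) : (nrm u == 0) = (u == 0).
Proof.
apply/eqP/eqP => [u0|->]; last exact: nrm0.
by apply/normr0_eq0; rewrite nrmE u0.
Qed.

Lemma nrm_gt0 {V : normedZmodType C} (u : V) : (0 < nrm u) = (u != 0).
Proof. by rewrite lt_def nrm_ge0 nrm_eq0 andbT. Qed.

Lemma ler_nrmD {V : normedZmodType C} (u v : V) : nrm (u + v) <= nrm u + nrm v.
Proof. by rewrite -lecR rmorphD/= -!nrmE ler_normD. Qed.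

Lemma nrmN {V : normedZmodType C} (u : V) : nrm (- u) = nrm u.
Proof. by rewrite /nrm normrN. Qed.

Lemma nrm_dist {V : normedZmodType C} (u v : V) : nrm (u - v) = nrm (v - u).
Proof. by rewrite -nrmN opprB. Qed.

Lemma ler_nrmB {V : normedZmodType C} (u v : V) : nrm (u - v) <= nrm u + nrm v.
Proof. by rewrite (le_trans (ler_nrmD _ _))// nrmN. Qed.

Lemma ler_nrm_dist {V : normedZmodType C} (w u v : V) :
  nrm (u - v) <= nrm (u - w) + nrm (w - v).
Proof. by rewrite (le_trans _ (ler_nrmD _ _))// addrA subrK. Qed.

Lemma ler_nrm_sum {V : normedZmodType C} (I : Type) (s : seq I) (P : pred I)
    (F : I -> V) : nrm (\sum_(i <- s | P i) F i) <= \sum_(i <- s | P i) nrm (F i).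
Proof.
elim/big_ind2 : _ => [|a b c d ab cd|//]; first by rewrite nrm0.
by rewrite (le_trans (ler_nrmD _ _))// lerD.
Qed.

Lemma nrmM (a b : C) : nrm (a * b) = nrm a * nrm b.
Proof. by apply: complexI; rewrite rmorphM/= -!nrmE normrM. Qed.

Lemma nrmX (a : C) n : nrm (a ^+ n) = nrm a ^+ n.
Proof. by apply: complexI; rewrite rmorphXn/= -!nrmE normrX. Qed.

Lemma nrmV (a : C) : nrm a^-1 = (nrm a)^-1.
Proof. by apply: complexI; rewrite fmorphV/= -!nrmE normfV. Qed.

Lemma nrm_real (a : R) : nrm (a%:C : C) = `|a|.
Proof. by rewrite /nrm normc_def/= expr0n/= addr0 sqrtr_sqr. Qed.

Lemma nrm_conj (a : C) : nrm a^*%C = nrm a.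
Proof. by rewrite /nrm norm_conjC. Qed.

Lemma nrmZ {V : normedModType C} (a : C) (u : V) : nrm (a *: u) = nrm a * nrm u.
Proof. by apply: complexI; rewrite rmorphM/= -!nrmE normrZ. Qed.

Lemma ler_Re_nrm (a : C) : `|complex.Re a| <= nrm a.
Proof. by rewrite -lecR -nrmE normc_ge_Re. Qed.

Lemma ler_Im_nrm (a : C) : `|complex.Im a| <= nrm a.
Proof.
have -> : nrm a = nrm (a * 'i%C).
  by rewrite nrmM [nrm 'i%C]/nrm normc_def/= expr0n/= expr1n add0r sqrtr1 mulr1.
by rewrite (le_trans _ (ler_Re_nrm _))// ReiNIm normrN.
Qed.

Lemma nrm_sq (a : C) : nrm a ^+ 2 = complex.Re a ^+ 2 + complex.Im a ^+ 2.
Proof. by apply: complexI; rewrite add_Re2_Im2 nrmE rmorphXn. Qed.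

Lemma ler_nrm_ReIm (a : C) : nrm a <= `|complex.Re a| + `|complex.Im a|.
Proof.
rewrite -(@ler_pXn2r _ 2)// ?nnegrE ?nrm_ge0 ?addr_ge0//.
by rewrite nrm_sq sqrrD !real_normK ?num_real// lerD2r lerDl mulrn_wge0// mulr_ge0.
Qed.

Lemma cvg_nrmP {V : completeNormedModType C} {T : Type} (F : set_system T)
    {FF : Filter F} (f : T -> V) (l : V) :
  f @ F --> l <-> forall e : R, 0 < e -> \forall x \near F, nrm (f x - l) < e.
Proof.
split=> [/cvgrPdist_lt h e e0|h].
  have := h e%:C; rewrite ltcR => /(_ e0); apply: filterS => x.
  by rewrite nrmE ltcR nrm_dist.
apply/cvgrPdist_lt => e e0.
have er : e = (complex.Re e)%:C by rewrite RRe_real// gtr0_real.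
have := h (complex.Re e); rewrite -ltcR -er => /(_ e0); apply: filterS => x.
by rewrite -ltcR -er -nrmE distrC.
Qed.

Lemma nbhs_nrmP {V : normedModType C} (x : V) (A : set V) :
  nbhs x A <-> exists2 e : R, 0 < e & forall y, nrm (y - x) < e -> A y.
Proof.
split=> [/nbhs_ballP[e /= e0 eA]|[e e0 eA]].
  have er : e = (complex.Re e)%:C by rewrite RRe_real// gtr0_real.
  exists (complex.Re e); first by rewrite -ltcR -er.
  move=> y; rewrite -ltcR -er -nrmE distrC => ?; apply: eA.
  by rewrite -ball_normE.
apply/nbhs_ballP; exists e%:C; first by rewrite /= ltcR.
by move=> y; rewrite -ball_normE/= distrC nrmE ltcR => /eA.
Qed.

Lemma closure_nrmP {V : completeNormedModType C} (A : set V) (x : V) :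
  closure A x <-> forall e : R, 0 < e -> exists2 y, A y & nrm (y - x) < e.
Proof.
split=> [h e e0|h B /nbhs_nrmP[e e0 eB]].
  have [|y [Ay ye]] := h [set y | nrm (y - x) < e]; last by exists y.
  by apply/nbhs_nrmP; exists e.
by have [y Ay ye] := h e e0; exists y; split => //; exact: eB.
Qed.

Definition ncvg {V : completeNormedModType C} (u : nat -> V) (l : V) :=
  forall e : R, 0 < e -> exists N, forall n, (N <= n)%N -> nrm (u n - l) < e.

Lemma ncvgP {V : completeNormedModType C} (u : nat -> V) (l : V) :
  ncvg u l <-> u @ \oo --> l.
Proof.
rewrite cvg_nrmP; split=> h e e0; have := h e e0.
  by case=> N hN; exists N.
by case=> N _ hN; exists N.
Qed.

Lemma ncvg_unique {V : completeNormedModType C} (u : nat -> V) (l l' : V) :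
  ncvg u l -> ncvg u l' -> l = l'.
Proof.
move=> h h'; apply/eqP; rewrite -subr_eq0 -nrm_eq0 eq_le nrm_ge0 andbT.
apply/ler_addgt0Pl => e e0; rewrite addr0.
have [N hN] := h (e / 2) ltac:(lra); have [N' hN'] := h' (e / 2) ltac:(lra).
have := hN (maxn N N') (leq_maxl _ _); have := hN' (maxn N N') (leq_maxr _ _).
have := ler_nrm_dist (u (maxn N N')) l l'; rewrite (nrm_dist l (u _)).
lra.
Qed.

Lemma cauchy_ncvg {V : completeNormedModType C} (u : nat -> V) :
  (forall e : R, 0 < e -> exists N, forall m n, (N <= m)%N -> (N <= n)%N ->
     nrm (u m - u n) < e) -> exists l, ncvg u l.
Proof.
move=> h; have : cvg (u @ \oo).
  apply: cauchy_cvg; apply/cauchyP => e e0.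
  have er : e = (complex.Re e)%:C by rewrite RRe_real// gtr0_real.
  have [|N hN] := h (complex.Re e); first by rewrite -ltcR -er.
  exists (u N); exists N => // n /= Nn.
  by rewrite -ball_normE/= nrmE er ltcR hN.
by move=> /cvg_ex[l ul]; exists l; apply/ncvgP.
Qed.

Definition invS (n : nat) : R := n.+1%:R^-1.

Lemma invS_gt0 n : 0 < invS n.
Proof. by rewrite invr_gt0 ltr0n. Qed.

Lemma invS_ge0 n : 0 <= invS n.
Proof. exact/ltW/invS_gt0. Qed.

Lemma invS_lt (e : R) : 0 < e -> exists N, forall n, (N <= n)%N -> invS n < e.
Proof.
move=> e0; exists (Num.truncn e^-1) => n hn.
rewrite invf_plt ?posrE ?ltr0n//; apply: lt_le_trans (truncnS_gt _) _.
by rewrite ler_nat ltnS.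
Qed.

End RealNorm.

(** * Hilbert spaces *)

Section Hilbert.
Context {R : realType}.
Local Notation C := R[i].
Context {H : completeNormedModType C} (ip : {dot H for @Num.conj C}).
Hypothesis hil : hilbert ip.
Implicit Types u v w x y : H.

Lemma ipDl u v w : ip (u + v) w = ip u w + ip v w.
Proof. by rewrite linearDl. Qed.
Lemma ipDr u v w : ip w (u + v) = ip w u + ip w v.
Proof. by rewrite linearD. Qed.
Lemma ipZl a u v : ip (a *: u) v = a * ip u v.
Proof. by rewrite linearZl_LR. Qed.
Lemma ipZr a u v : ip u (a *: v) = a^*%C * ip u v.
Proof. by rewrite linearZr_LR. Qed.
Lemma ipNl u v : ip (- u) v = - ip u v.
Proof. by rewrite linearNl. Qed.
Lemma ipNr u v : ip u (- v) = - ip u v.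
Proof. by rewrite linearN. Qed.
Lemma ipBl u v w : ip (u - v) w = ip u w - ip v w.
Proof. by rewrite ipDl ipNl. Qed.
Lemma ipBr u v w : ip w (u - v) = ip w u - ip w v.
Proof. by rewrite ipDr ipNr. Qed.
Lemma ip0l v : ip 0 v = 0.
Proof. by rewrite linear0l. Qed.
Lemma ip0r v : ip v 0 = 0.
Proof. by rewrite linear0. Qed.
Lemma ipC u v : ip u v = (ip v u)^*%C.
Proof. by rewrite hermC expr0 mul1r. Qed.
Lemma ip_eq0C u v : ip u v = 0 -> ip v u = 0.
Proof. by move=> uv; rewrite ipC uv conjc0. Qed.

Lemma ip_nrm u : ip u u = ((nrm u) ^+ 2)%:C.
Proof. by rewrite -hil nrmE rmorphXn. Qed.

Lemma ip_eq0 u : ip u u = 0 -> u = 0.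
Proof.
rewrite ip_nrm => /complexI/eqP; rewrite sqrf_eq0 nrm_eq0.
by move/eqP.
Qed.

Definition rip u v : R := complex.Re (ip u v).

Lemma ReD (a b : C) : complex.Re (a + b) = complex.Re a + complex.Re b.
Proof. by case: a b => [? ?] [? ?]. Qed.
Lemma ImD (a b : C) : complex.Im (a + b) = complex.Im a + complex.Im b.
Proof. by case: a b => [? ?] [? ?]. Qed.
Lemma ReN (a : C) : complex.Re (- a) = - complex.Re a.
Proof. by case: a => [? ?]. Qed.
Lemma ImN (a : C) : complex.Im (- a) = - complex.Im a.
Proof. by case: a => [? ?]. Qed.
Lemma ReM (a b : C) : complex.Re (a * b) =
  complex.Re a * complex.Re b - complex.Im a * complex.Im b.
Proof. by case: a b => [? ?] [? ?]. Qed.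
Lemma ImM (a b : C) : complex.Im (a * b) =
  complex.Re a * complex.Im b + complex.Im a * complex.Re b.
Proof. by case: a b => [? ?] [? ?]. Qed.
Lemma ReJ (a : C) : complex.Re a^*%C = complex.Re a.
Proof. by case: a => [? ?]. Qed.
Lemma ImJ (a : C) : complex.Im a^*%C = - complex.Im a.
Proof. by case: a => [? ?]. Qed.

Lemma conjM_nrm (a : C) : a^*%C * a = (nrm a ^+ 2)%:C.
Proof. by rewrite mulrC -normCK nrmE rmorphXn. Qed.

Lemma conj_real (s : R) : (s%:C : C)^*%C = s%:C.
Proof. by rewrite /= oppr0. Qed.

Lemma conj_realM (s : R) (a : C) : (s%:C * a)^*%C = s%:C * a^*%C.
Proof. by case: a => a b; apply/eqP; rewrite eq_complex/=; apply/andP; split; apply/eqP; ring. Qed.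

Lemma nrmD_sq u v : nrm (u + v) ^+ 2 = nrm u ^+ 2 + nrm v ^+ 2 + rip u v *+ 2.
Proof.
apply: complexI; rewrite -ip_nrm ipDl !ipDr !ip_nrm (ipC v u).
by apply/eqP; rewrite eq_complex /rip !(ReD, ImD, ReJ, ImJ)/= mulr2n;
  apply/andP; split; apply/eqP; ring.
Qed.

Lemma nrmB_sq u v : nrm (u - v) ^+ 2 = nrm u ^+ 2 + nrm v ^+ 2 - rip u v *+ 2.
Proof. by rewrite nrmD_sq nrmN /rip ipNr ReN mulNrn. Qed.

Lemma pythagoras u v : ip u v = 0 -> nrm (u + v) ^+ 2 = nrm u ^+ 2 + nrm v ^+ 2.
Proof. by move=> uv; rewrite nrmD_sq /rip uv mul0rn addr0. Qed.

Lemma parallelogram u v :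
  nrm (u + v) ^+ 2 + nrm (u - v) ^+ 2 = 2 * (nrm u ^+ 2 + nrm v ^+ 2).
Proof. by rewrite nrmD_sq nrmB_sq !mulr2n; ring. Qed.

Lemma cauchy_schwarz u v : nrm (ip u v) <= nrm u * nrm v.
Proof.
have [->|v0] := eqVneq v 0; first by rewrite ip0r !nrm0 mulr0.
rewrite -(@ler_pXn2r _ 2)// ?nnegrE ?mulr_ge0 ?nrm_ge0//.
have vv : 0 < nrm v ^+ 2 by rewrite exprn_gt0// nrm_gt0.
(* This vector is |v|^2 times the component of u orthogonal to v, which avoids a division. *)
have : 0 <= nrm ((nrm v ^+ 2)%:C *: u - ip u v *: v) ^+ 2.
  by rewrite exprn_ge0 ?nrm_ge0.
rewrite nrmB_sq /rip ipZr ipZl mulrCA conjM_nrm -rmorphM/= !nrmZ nrm_real.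
rewrite ger0_norm ?(ltW vv)// !exprMn mulr2n => h.
rewrite -(ler_pM2l vv) -subr_ge0; apply: le_trans h _.
by rewrite le_eqVlt; apply/orP; left; apply/eqP; ring.
Qed.

Lemma closure_orth (A : set H) w x : (forall v, A v -> ip w v = 0) ->
  closure A x -> ip w x = 0.
Proof.
move=> wA /closure_nrmP Ax; apply/eqP; rewrite -nrm_eq0 eq_le nrm_ge0 andbT.
apply/ler_addgt0Pl => e e0; rewrite addr0.
have [|y Ay yx] := Ax (e / (nrm w + 1)).
  by rewrite divr_gt0// ltr_wpDl// nrm_ge0.
have -> : ip w x = ip w (x - y) by rewrite ipBr (wA _ Ay) subr0.
rewrite (le_trans (cauchy_schwarz _ _))//.
move: yx; rewrite ltr_pdivlMr ?ltr_wpDl ?nrm_ge0// nrm_dist => /ltW; apply: le_trans.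
by rewrite mulrC ler_wpM2l ?nrm_ge0// lerDl.
Qed.

Lemma dense_orth0 (A : set H) w : dense A -> (forall v, A v -> ip w v = 0) -> w = 0.
Proof.
move=> dA wA; apply: ip_eq0; apply: closure_orth wA _.
by move=> B /nbhs_interior Bw; have [|y [/interior_subset By Ay]] := dA B^° _ (open_interior _);
  [exists w; exact: nbhs_singleton | exists y].
Qed.

Lemma subspaceD (V : set H) u v : subspace_closed V -> V u -> V v -> V (u + v).
Proof. by move=> [_ h] Vu Vv; rewrite -[u]scale1r; exact: h. Qed.

Lemma subspaceZ (V : set H) a u : subspace_closed V -> V u -> V (a *: u).
Proof. by move=> [V0 h] Vu; rewrite -[_ *: u]addr0; exact: h. Qed.

Lemma subspaceB (V : set H) u v : subspace_closed V -> V u -> V v -> V (u - v).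
Proof. by move=> hV Vu Vv; apply: subspaceD => //; rewrite -scaleN1r; exact: subspaceZ. Qed.

(** Minimality is tested with t = s a, where a = (w, v) and s = 1 / (|v|^2 + 1). It gives s |a|^2 (2
    - s |v|^2) <= 0, and s |v|^2 < 1, so a = 0. The summand 1 in s covers v = 0. *)
Lemma orth_of_min v w : (forall t : C, nrm w <= nrm (w - t *: v)) -> ip w v = 0.
Proof.
move=> h; set a := ip w v; apply/eqP; rewrite -nrm_eq0 -sqrf_eq0.
pose s := (nrm v ^+ 2 + 1)^-1 : R.
have s0 : 0 < s by rewrite invr_gt0 ltr_wpDl// exprn_ge0 ?nrm_ge0.
have := h (s%:C * a); rewrite -(@ler_pXn2r _ 2)// ?nnegrE ?nrm_ge0//.
rewrite nrmB_sq /rip ipZr nrmZ -/a nrmM nrm_real ger0_norm ?(ltW s0)//.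
have -> : (s%:C * a)^*%C * a = (s * nrm a ^+ 2)%:C.
  by rewrite conj_realM -mulrA conjM_nrm -rmorphM.
rewrite /= !exprMn; have vs : s * nrm v ^+ 2 < 1.
  by rewrite /s mulrC ltr_pdivrMr ?mul1r ?ltrDl// ltr_wpDl// exprn_ge0 ?nrm_ge0.
move=> k; rewrite eq_le sqr_ge0 andbT.
have k2 : s * nrm a ^+ 2 * (2 - s * nrm v ^+ 2) <= 0.
  by move: k; rewrite mulr2n; set X := nrm w ^+ 2; set A := nrm a; set B := nrm v; nra.
move: k2; rewrite pmulr_lle0; last by lra.
by rewrite pmulr_rle0.
Qed.

(** By the parallelogram law a sequence in V minimizing the distance to x is Cauchy. V is not
    assumed closed (ranges of A - z will be projected on), hence the limit is only placed in
    [closure V]. *)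
Lemma orthogonal_projection (V : set H) x : subspace_closed V ->
  exists2 p, closure V p & forall v, V v -> ip (x - p) v = 0.
Proof.
move=> hV; have V0 := hV.1.
pose A := [set nrm (x - v) | v in V]; pose d := inf A.
have lbA : lbound A 0 by move=> _ [v _ <-]; exact: nrm_ge0.
have A0 : A !=set0 by exists (nrm (x - 0)), 0.
have hA : has_inf A by split => //; exists 0.
have dle v : V v -> d <= nrm (x - v) by move=> Vv; apply: ge_inf; [exists 0|exists v].
have d0 : 0 <= d by apply: lb_le_inf.
have /choice[v hv] : forall n : nat, exists v, V v /\ nrm (x - v) < d + invS n.
  move=> n; have [|_ [v Vv <-] h] := @inf_adherent _ _ (invS n) _ hA; first exact: invS_gt0.
  by exists v.
have vcau m n : nrm (v m - v n) ^+ 2 <=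
    ((d + invS m) ^+ 2 + (d + invS n) ^+ 2) *+ 2 - 4 * d ^+ 2.
  have P := parallelogram (x - v m) (x - v n).
  have -> : nrm (v m - v n) = nrm (x - v m - (x - v n)).
    by rewrite nrm_dist; congr nrm; lmod_ring.
  have Q : 2 * d <= nrm (x - v m + (x - v n)).
    have -> : x - v m + (x - v n) = (2 : R)%:C *: (x - (2^-1 : R)%:C *: (v m + v n)).
      rewrite scalerBr scalerA -rmorphM/= mulfV ?pnatr_eq0// scale1r.
      by rewrite (_ : (2 : R)%:C = 2) ?rmorph_nat// scaler_nat mulr2n opprD addrACA.
    rewrite nrmZ nrm_real ger0_norm// ler_wpM2l//; apply: dle.
    by apply: subspaceZ => //; apply: subspaceD => //; exact: (hv _).1.
  have h1 : nrm (x - v m) ^+ 2 <= (d + invS m) ^+ 2.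
    by rewrite ler_pXn2r ?nnegrE ?nrm_ge0 ?addr_ge0 ?invS_ge0// ltW ?(hv _).2.
  have h2 : nrm (x - v n) ^+ 2 <= (d + invS n) ^+ 2.
    by rewrite ler_pXn2r ?nnegrE ?nrm_ge0 ?addr_ge0 ?invS_ge0// ltW ?(hv _).2.
  have h3 : 4 * d ^+ 2 <= nrm (x - v m + (x - v n)) ^+ 2.
    have -> : 4 * d ^+ 2 = (2 * d) ^+ 2 by ring.
    by rewrite ler_pXn2r ?nnegrE ?nrm_ge0 ?mulr_ge0.
  move: P h1 h2 h3; move: (nrm (x - v m + _)) (nrm (x - v m - _)) (nrm (x - v m)).
  move: (nrm (x - v n)) (invS m) (invS n) => X a b Y Z W.
  rewrite mulr2n; move: (d ^+ 2) (X ^+ 2) (Y ^+ 2) (Z ^+ 2) (W ^+ 2) ((d + a) ^+ 2) ((d + b) ^+ 2).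
  by move=> *; lra.
have [p vp] : exists p, ncvg v p.
  apply: cauchy_ncvg => e e0.
  (* For a, b <= 1 the bound [vcau] is at most (4 d + 2)(a + b), which is below e^2 for a and b
     below this threshold. *)
  have [|N hN] := @invS_lt _ (Num.min 1 (e ^+ 2 / (8 * (d + 1)))).
    by rewrite lt_min ltr01 divr_gt0 ?exprn_gt0// mulr_gt0//; lra.
  exists N => m n /hN m1 /hN n1.
  rewrite -(@ltr_pXn2r _ 2)// ?nnegrE ?nrm_ge0 ?ltW//; apply: le_lt_trans (vcau m n) _.
  move: m1 n1; rewrite !lt_min !ltr_pdivlMr ?mulr_gt0//; [|lra..].
  have : 0 < invS m :> R by exact: invS_gt0.
  have : 0 < invS n :> R by exact: invS_gt0.
  set a := invS m; set b := invS n => b0 a0 /andP[a1 ae] /andP[b1 be].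
  by rewrite mulr2n; nra.
have pd : nrm (x - p) <= d.
  apply/ler_addgt0Pl => e e0.
  have [N hN] := vp (e / 2) ltac:(lra).
  have [M hM] := @invS_lt _ (e / 2) ltac:(lra).
  have := hN _ (leq_maxl N M); have := hM _ (leq_maxr N M); have [_] := hv (maxn N M).
  by have := ler_nrm_dist (v (maxn N M)) x p; lra.
exists p.
  apply/closure_nrmP => e /vp[N /(_ N (leqnn _)) h]; exists (v N) => //; exact: (hv _).1.
move=> w Vw; apply: orth_of_min => t; apply: le_trans pd _.
apply/ler_addgt0Pl => e /vp[N /(_ N (leqnn _)) h].
have := dle (v N + t *: w) (subspaceD hV (hv N).1 (subspaceZ t hV Vw)).
have -> : x - (v N + t *: w) = (x - p - t *: w) - (v N - p) by lmod_ring.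
by have := ler_nrmB (x - p - t *: w) (v N - p); lra.
Qed.

(** Banach-Steinhaus for the functionals (., s), by nested balls: if S were unbounded, one could
    shrink balls so that on the n-th one some functional is at least n in modulus; the common point
    of all balls contradicts pointwise boundedness. *)
Lemma uniform_boundedness (S : set H) :
  (forall f, exists c : R, forall s, S s -> nrm (ip f s) <= c) ->
  exists c : R, forall s, S s -> nrm s <= c.
Proof.
move=> Sf; apply: contrapT => unb.
have big (c : R) : exists2 s, S s & c < nrm s.
  apply: contrapT => h; apply: unb; exists c => s Ss; rewrite leNgt; apply/negP => cs.
  by apply: h; exists s.
have step (n : nat) (xr : H * R) : exists yr : H * R, 0 < xr.2 ->
    [/\ 0 < yr.2, yr.2 <= xr.2 / 2, nrm (yr.1 - xr.1) + yr.2 <= xr.2 &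
      exists2 s, S s & forall z, nrm (z - yr.1) <= yr.2 -> n%:R <= nrm (ip z s)].
  case: xr => x r /=; have [r0|r0] := ltP 0 r; last by exists (x, r); rewrite ltNge r0.
  (* The threshold makes (r / 4) |s| >= n, which is what survives on the ball of radius r / 4 around
     the new centre. *)
  have [s Ss ns] := big (4 * n%:R / r).
  have s0 : 0 < nrm s by apply: le_lt_trans ns; rewrite divr_ge0 ?mulr_ge0// ltW.
  pose xi := (r / 2 / nrm s)%:C *: s.
  have nxi : nrm xi = r / 2.
    by rewrite nrmZ nrm_real ger0_norm ?divrK ?unitf_gt0// !divr_ge0// ltW.
  have ixi : ip xi s = (r / 2 * nrm s)%:C.
    by rewrite ipZl ip_nrm -rmorphM/=; congr (_%:C); field; rewrite gt_eqF.
  (* Nothing is known of (x, s), but the values at x + xi and x - xi differ by 2 (xi, s) = r |s|, so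
     one of them has modulus at least r |s| / 2. *)
  have [y yx ys] : exists2 y, nrm (y - x) = r / 2 & r / 2 * nrm s <= nrm (ip y s).
    have : (r / 2 * nrm s) *+ 2 <= nrm (ip (x + xi) s) + nrm (ip (x - xi) s).
      have -> : (r / 2 * nrm s) *+ 2 = nrm (ip (x + xi) s - ip (x - xi) s).
        rewrite -ipBl (_ : x + xi - (x - xi) = xi + xi); last by lmod_ring.
        rewrite ipDl ixi -rmorphD/= nrm_real ger0_norm ?mulr2n//.
        by rewrite addr_ge0// mulr_ge0 ?nrm_ge0// divr_ge0// ltW.
      exact: ler_nrmB.
    rewrite mulr2n; have [h _|h h'] := leP (r / 2 * nrm s) (nrm (ip (x + xi) s)).
      by exists (x + xi); rewrite // addrC addKr.
    exists (x - xi); last by move: h h'; lra.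
    by rewrite (_ : x - xi - x = - xi) ?nrmN//; lmod_ring.
  exists (y, r / 4) => _ /=; split => //; [by lra|by lra|by rewrite yx; lra|].
  exists s => // z zy.
  have -> : ip z s = ip y s - ip (y - z) s by rewrite -ipBl; congr (ip _ s); lmod_ring.
  have := ler_nrm_dist (ip (y - z) s) (ip y s) 0; rewrite !subr0.
  have := cauchy_schwarz (y - z) s; rewrite (nrm_dist y).
  have h1 : nrm (z - y) * nrm s <= r / 4 * nrm s by rewrite ler_wpM2r ?nrm_ge0.
  have h2 : n%:R <= r / 4 * nrm s.
    by move: ns; rewrite ltr_pdivrMr// => ns; lra.
  by lra.
have /choice[F hF] : forall nxr : nat * (H * R), exists yr : H * R, _ := fun nxr => step nxr.1 nxr.2.
pose fix xr n := if n is m.+1 then F (m, xr m) else (0 : H, 1 : R).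
have r0 n : 0 < (xr n).2.
  by elim: n => [|n ih] /=; [exact: ltr01|have [] := hF (n, xr n) ih].
have rle n : (xr n).2 <= invS n.
  elim: n => [|n ih]; first by rewrite /= /invS invr1.
  have [_ + _ _] := hF (n, xr n) (r0 n) => /= h; apply: le_trans h _.
  rewrite ler_pdivrMr// -[leLHS]mulr1 (le_trans (ler_wpM2r _ ih))//.
  rewrite mulr1 [leRHS]mulrC /invS ler_pdivlMr ?ltr0n// mulrC ler_pdivrMr ?ltr0n//.
  by rewrite -natrM ler_nat mul2n doubleS !ltnS -addnn leq_addr.
have near m n : (m <= n)%N -> nrm ((xr n).1 - (xr m).1) + (xr n).2 <= (xr m).2.
  move=> /subnK<-; elim: (n - m)%N => [|k ih]; first by rewrite add0n subrr nrm0 add0r.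
  have [_ _ + _] := hF ((k + m)%N, xr (k + m)%N) (r0 _); rewrite addSn /=.
  by have := ler_nrm_dist (xr (k + m)%N).1 (F ((k + m)%N, xr (k + m)%N)).1 (xr m).1; lra.
have [x hx] : exists x, ncvg (fun n => (xr n).1) x.
  apply: cauchy_ncvg => e e0; have [N hN] := invS_lt (e := e / 2) ltac:(lra).
  exists N => m n /near h1 /near h2.
  have := ler_nrm_dist (xr N).1 (xr m).1 (xr n).1; rewrite (nrm_dist (xr N).1).
  by have := rle N; have := hN N (leqnn _); have := r0 m; have := r0 n; lra.
have xn n : nrm (x - (xr n).1) <= (xr n).2.
  apply/ler_addgt0Pl => e /hx[N /(_ (maxn N n) (leq_maxl _ _)) h].
  have := near _ _ (leq_maxr N n); have := r0 (maxn N n).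
  have := ler_nrm_dist (xr (maxn N n)).1 x (xr n).1.
  by move: h; rewrite (nrm_dist _ x); lra.
have [c hc] := Sf x.
(* [F (m, xr m)] is the ball of index m + 1, and m is chosen above c. *)
have [_ _ _ [s Ss /(_ x (xn _.+1))]] := hF ((Num.truncn c).+1, xr (Num.truncn c).+1) (r0 _).
by have := hc s Ss; have := truncnS_gt c => /=; lra.
Qed.

End Hilbert.

(** * Selfadjoint operators and their resolvents *)

Section SelfAdjoint.
Context {R : realType}.
Local Notation C := R[i].
Context {H : completeNormedModType C} (ip : {dot H for @Num.conj C}).
Hypothesis hil : hilbert ip.
Implicit Types u v w x y f : H.
Context (A : operator H) (linA : linear_operator A) (saA : selfadjoint ip A).

Lemma sa_sym u v : dom A u -> dom A v -> ip (A u) v = ip u (A v).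
Proof.
move=> Au Av; have : graph A (v, A v) by [].
by rewrite saA.2 => /(_ u Au).
Qed.

Lemma sa_adj w f : (forall u, dom A u -> ip (A u) w = ip u f) -> dom A w /\ A w = f.
Proof.
move=> h; have : adjoint_graph ip A (w, f) by [].
by rewrite -saA.2 => -[/= ? ->].
Qed.

Lemma domD u v : dom A u -> dom A v -> dom A (u + v).
Proof. exact: (subspaceD linA.1). Qed.
Lemma domZ (a : C) u : dom A u -> dom A (a *: u).
Proof. exact: (subspaceZ a linA.1). Qed.
Lemma domB u v : dom A u -> dom A v -> dom A (u - v).
Proof. exact: (subspaceB linA.1). Qed.
Lemma dom0 : dom A 0. Proof. exact: linA.1.1. Qed.

Lemma opD u v : dom A u -> dom A v -> A (u + v) = A u + A v.
Proof. by move=> Au Av; have := linA.2 1 _ _ Au Av; rewrite !scale1r. Qed.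
Lemma op0 : A 0 = 0.
Proof. by apply: (@addrI _ (A 0)); rewrite -opD ?addr0//; exact: dom0. Qed.
Lemma opZ (a : C) u : dom A u -> A (a *: u) = a *: A u.
Proof. by move=> Au; have := linA.2 a _ _ Au dom0; rewrite op0 !addr0. Qed.
Lemma opB u v : dom A u -> dom A v -> A (u - v) = A u - A v.
Proof.
by move=> Au Av; have := opD Au (domZ (-1) Av); rewrite opZ// !scaleN1r.
Qed.

Definition opshift (z : C) u : H := A u - z *: u.

Lemma shiftD z u v : dom A u -> dom A v -> opshift z (u + v) = opshift z u + opshift z v.
Proof. by move=> Au Av; rewrite /opshift opD//; lmod_ring. Qed.
Lemma shiftB z u v : dom A u -> dom A v -> opshift z (u - v) = opshift z u - opshift z v.
Proof. by move=> Au Av; rewrite /opshift opB//; lmod_ring. Qed.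
Lemma shiftZ z a u : dom A u -> opshift z (a *: u) = a *: opshift z u.
Proof. by move=> Au; rewrite /opshift opZ//; lmod_ring. Qed.
Lemma shift_shift (z w : C) u : opshift z u = opshift w u + (w - z) *: u.
Proof. by rewrite /opshift; lmod_ring. Qed.

(** A is its own adjoint, and adjoints are closed: (A x, v) = (x, A v) passes to the limit in v for
    each fixed x of the domain. *)
Lemma sa_closed u f : (forall e : R, 0 < e -> exists2 v, dom A v &
  nrm (v - u) < e /\ nrm (A v - f) < e) -> dom A u /\ A u = f.
Proof.
move=> h; apply: sa_adj => x Ax; apply/eqP; rewrite -subr_eq0 -nrm_eq0.
rewrite eq_le nrm_ge0 andbT; apply/ler_addgt0Pl => e e0; rewrite addr0.
have p0 : 0 < nrm (A x) + nrm x + 1 by rewrite ltr_wpDl// addr_ge0 ?nrm_ge0.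
have [|v Av [vu vf]] := h (e / (nrm (A x) + nrm x + 1)); first by rewrite divr_gt0.
have -> : ip (A x) u - ip x f = ip x (A v - f) - ip (A x) (v - u).
  by rewrite !ipBr (sa_sym Ax Av); ring.
have := ler_nrmB (ip x (A v - f)) (ip (A x) (v - u)).
have := cauchy_schwarz hil x (A v - f); have := cauchy_schwarz hil (A x) (v - u).
move: vu vf; set q := e / _ => vu vf.
have qe : q * (nrm (A x) + nrm x + 1) = e by rewrite /q divfK ?gt_eqF.
have q0 : 0 < q by rewrite divr_gt0.
by have := nrm_ge0 (A x); have := nrm_ge0 x; nra.
Qed.

(** The lower bound turns a convergent sequence of images into a Cauchy sequence of preimages, and A
    is closed. The subspace [D] is a parameter because the bound holds on all of [dom A] for nonreal
    z, but only on the kernel of E(I) when z is the centre of a spectral gap I. *)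
Lemma closed_range (D : set H) (c : R) (z : C) f : 0 < c -> subspace_closed D ->
  D `<=` dom A -> (forall u, D u -> c * nrm u <= nrm (opshift z u)) ->
  closure [set opshift z u | u in D] f ->
  exists u, [/\ dom A u, closure D u & opshift z u = f].
Proof.
move=> c0 hD DA hc /closure_nrmP cf.
have /choice[u hu] : forall n : nat, exists u, D u /\ nrm (opshift z u - f) < invS n.
  by move=> n; have [_ [u Du <-] h] := cf _ (invS_gt0 n); exists u.
have [l ul] : exists l, ncvg u l.
  apply: cauchy_ncvg => e e0; have [|N hN] := @invS_lt _ (c * e / 2).
    by rewrite divr_gt0// mulr_gt0.
  exists N => m n /hN h1 /hN h2.
  have [Dm hm] := hu m; have [Dn hn] := hu n.
  have := hc _ (subspaceB hD Dm Dn); rewrite shiftB; [|exact: DA..].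
  have := ler_nrm_dist f (opshift z (u m)) (opshift z (u n)); rewrite (nrm_dist f).
  by rewrite -(ltr_pM2l c0); lra.
have [Al lf] : dom A l /\ A l = f + z *: l.
  apply: sa_closed => e e0.
  have z1 : 0 < nrm z + 1 by rewrite ltr_wpDl// nrm_ge0.
  have [|N hN] := ul (e / 2 / (nrm z + 1)); first by rewrite !divr_gt0.
  have [M hM] := @invS_lt _ (e / 2) ltac:(lra).
  have hl := hN _ (leq_maxl N M); have hm := hM _ (leq_maxr N M).
  have [Du hd] := hu (maxn N M); exists (u (maxn N M)); first exact: DA.
  move: hl; rewrite ltr_pdivlMr// => hl; split.
    by have := nrm_ge0 (u (maxn N M) - l); have := nrm_ge0 z; nra.
  have -> : A (u (maxn N M)) - (f + z *: l) =
      (opshift z (u (maxn N M)) - f) + z *: (u (maxn N M) - l).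
    by rewrite /opshift; lmod_ring.
  apply: le_lt_trans (ler_nrmD _ _) _; rewrite nrmZ.
  by have := nrm_ge0 (u (maxn N M) - l); have := nrm_ge0 z; nra.
exists l; split => //; last by rewrite /opshift lf addrK.
by apply/closure_nrmP => e /ul[N /(_ N (leqnn _)) h]; exists (u N) => //; exact: (hu N).1.
Qed.

Lemma op_form_real u : dom A u -> complex.Im (ip (A u) u) = 0.
Proof.
move=> Au; have := ipC ip (A u) u; rewrite (sa_sym Au Au).
by case: (ip u (A u)) => a b [/eqP]; rewrite -subr_eq0 opprK -mulr2n mulrn_eq0/= => /eqP.
Qed.

Lemma shift_form_Im z u : dom A u -> complex.Im (ip (opshift z u) u) = - complex.Im z * nrm u ^+ 2.
Proof.
move=> Au; rewrite /opshift ipBl ipZl (ip_nrm hil) ImD ImN ImM /= op_form_real// mulr0 !add0r.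
by rewrite mulNr.
Qed.

Lemma shift_lower z u : dom A u -> `|complex.Im z| * nrm u <= nrm (opshift z u).
Proof.
move=> Au; have [->|u0] := eqVneq u 0; first by rewrite nrm0 mulr0 nrm_ge0.
have n0 : 0 < nrm u by rewrite nrm_gt0.
rewrite -(ler_pM2r n0); apply: le_trans (cauchy_schwarz hil _ _).
apply: le_trans (ler_Im_nrm _); rewrite shift_form_Im// normrM normrN.
by rewrite ger0_norm ?exprn_ge0 ?nrm_ge0// -mulrA.
Qed.

Lemma range_orth z w : (forall u, dom A u -> ip w (opshift z u) = 0) ->
  dom A w /\ A w = z^*%C *: w.
Proof.
move=> h; apply: sa_adj => u Au; have /ip_eq0C := h _ Au.
by rewrite /opshift ipBl ipZl ipZr conjcK => /eqP; rewrite subr_eq0 => /eqP.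
Qed.

Lemma subspace_range z : subspace_closed [set opshift z u | u in dom A].
Proof.
split; first by exists 0; [exact: dom0|rewrite /opshift op0 scaler0 subr0].
move=> a _ _ [u Au <-] [v Av <-]; exists (a *: u + v); first exact: linA.1.2.
by rewrite shiftD ?shiftZ//; exact: domZ.
Qed.

(** The lower bound [shift_lower] gives injectivity, a bounded inverse and a closed range. A vector
    orthogonal to the range is an eigenvector for conj z, which the same bound excludes. *)
Lemma nonreal_resolvent z : complex.Im z != 0 -> resolvent_set A z.
Proof.
move=> z0; have i0 : 0 < `|complex.Im z| by rewrite normr_gt0.
split; last first.
  exists `|complex.Im z|^-1 => u Au; rewrite !nrmE -rmorphM/= lecR.
  by rewrite mulrC ler_pdivlMr// mulrC shift_lower.
split => // [u v|f _].
  rewrite !inE => Au Av uv; apply/eqP; rewrite -subr_eq0 -nrm_eq0.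
  have := shift_lower z (domB Au Av); rewrite shiftB//.
  rewrite /opshift uv subrr nrm0 pmulr_rle0// => h.
  by rewrite eq_le h nrm_ge0.
have [p pcl ph] := orthogonal_projection hil f (subspace_range z).
have q0 : f - p = 0.
  have [|Aq qz] := @range_orth z (f - p); first by move=> u Au; apply: ph; exists u.
  apply/eqP; rewrite -nrm_eq0; have := shift_lower z^*%C Aq.
  rewrite /opshift qz subrr nrm0 ImJ normrN pmulr_rle0// => h.
  by rewrite eq_le h nrm_ge0.
have fp : f = p by apply/eqP; rewrite -subr_eq0 q0.
have [u [Au _ uf]] := closed_range i0 linA.1 (@subset_refl _ _) (shift_lower z) pcl.
by exists u => //; rewrite fp.
Qed.

Definition res (z : C) : H -> H := 'pinv_(fun=> 0) (dom A) (opshift z).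

Lemma res_spec z f : resolvent_set A z -> dom A (res z f) /\ opshift z (res z f) = f.
Proof.
move=> [[_ _ sj] _]; split; last by have := surjpK (fun=> 0) sj; apply; rewrite inE.
by apply: (surjpinv_image_sub sj); exists f.
Qed.

Lemma res_dom z f : resolvent_set A z -> dom A (res z f).
Proof. by move=> /(res_spec f)[]. Qed.

Lemma shift_res z f : resolvent_set A z -> opshift z (res z f) = f.
Proof. by move=> /(res_spec f)[]. Qed.

Lemma shift_inj z u v : resolvent_set A z -> dom A u -> dom A v ->
  opshift z u = opshift z v -> u = v.
Proof. by move=> [[_ ij _] _] Au Av; apply: ij; rewrite inE. Qed.

Lemma res_shift z u : resolvent_set A z -> dom A u -> res z (opshift z u) = u.
Proof.
move=> rz Au; apply: (shift_inj rz) => //; first exact: res_dom.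
exact: shift_res.
Qed.

Lemma res_eq z u f : resolvent_set A z -> dom A u -> opshift z u = f -> res z f = u.
Proof. by move=> rz Au <-; exact: res_shift. Qed.

Lemma resD z f g : resolvent_set A z -> res z (f + g) = res z f + res z g.
Proof.
move=> rz; apply: res_eq => //; first by apply: domD; exact: res_dom.
by rewrite shiftD ?shift_res//; exact: res_dom.
Qed.

Lemma resZ z a f : resolvent_set A z -> res z (a *: f) = a *: res z f.
Proof.
move=> rz; apply: res_eq => //; first by apply: domZ; exact: res_dom.
by rewrite shiftZ ?shift_res//; exact: res_dom.
Qed.

Lemma resolvent_identity (z w : C) f : resolvent_set A z -> resolvent_set A w ->
  res z f = res w f + (z - w) *: res z (res w f).
Proof.
move=> rz rw; have ww := res_dom f rw; have zw := res_dom (res w f) rz.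
apply: res_eq => //; first by apply: domD => //; exact: domZ.
rewrite shiftD ?shiftZ ?shift_res//; last exact: domZ.
by rewrite (shift_shift z w) shift_res//; lmod_ring.
Qed.

(** Substitute for the resolvent identity when z0 itself may lie in the spectrum: a solution u of (A
    - z0) u = f is enough. Iterating it produces the Laurent expansion. *)
Lemma res_chain (z z0 : C) u f : resolvent_set A z -> dom A u -> opshift z0 u = f ->
  res z f = u + (z - z0) *: res z u.
Proof.
move=> rz Au <-; have ru := res_dom u rz.
apply: res_eq => //; first by apply: domD => //; exact: domZ.
by rewrite shiftD ?shiftZ ?shift_res//; [rewrite (shift_shift z z0); lmod_ring|exact: domZ].
Qed.

Lemma nrm_res_nonreal z f : complex.Im z != 0 -> `|complex.Im z| * nrm (res z f) <= nrm f.
Proof.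
move=> z0; have rz := nonreal_resolvent z0.
by have := shift_lower z (res_dom f rz); rewrite shift_res.
Qed.

Lemma nrm_res z f (d : R) : resolvent_set A z ->
  (forall u, dom A u -> d * nrm u <= nrm (opshift z u)) -> d * nrm (res z f) <= nrm f.
Proof. by move=> rz h; have := h _ (res_dom f rz); rewrite shift_res. Qed.

(** Half of the lower bound 1 / (|c| + 1) at z0 absorbs the perturbation (z - z0) u. The form |c| +
    1 is there because the sign of c is not prescribed. The bound does not ask that z be in the
    resolvent set. *)
Lemma resolvent_lower z0 : resolvent_set A z0 ->
  exists2 d : R, 0 < d & forall z u, nrm (z - z0) < d -> dom A u ->
    d * nrm u <= nrm (opshift z u).
Proof.
move=> [_ [c hc]]; have c1 : 0 < `|c| + 1 by rewrite ltr_wpDl.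
exists ((`|c| + 1)^-1 / 2); first by rewrite divr_gt0// invr_gt0.
move=> z u zz Au; have : nrm u <= (`|c| + 1) * nrm (opshift z0 u).
  have := hc u Au; rewrite !nrmE -rmorphM/= lecR => /le_trans; apply.
  by rewrite ler_wpM2r ?nrm_ge0// (le_trans (ler_norm c))// lerDl.
rewrite -ler_pdivrMl// => h; rewrite (shift_shift z0 z) in h.
have := ler_nrmD (opshift z u) ((z - z0) *: u); rewrite nrmZ.
have : nrm (z - z0) * nrm u <= (`|c| + 1)^-1 / 2 * nrm u.
  by rewrite ler_wpM2r ?nrm_ge0// ltW.
by move: h; move: (_ ^-1) => k; lra.
Qed.

(** The ergodic argument: q is the component of x in the kernel of A - l and p lies in the closure
    of its range. The operators eta R(l + i eta) are contractions, and on a vector (A - l) v they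
    give eta (v + i eta R v), of norm at most 2 eta |v|; hence they tend to 0 on p. *)
Lemma ergodic_splitting (l : R) x : exists p q, [/\ x = p + q, op_eigenspace A l%:C q,
  closure [set opshift l%:C u | u in dom A] p &
  forall e : R, 0 < e -> exists2 d : R, 0 < d & forall eta : R, 0 < eta < d ->
    eta * nrm (res (l +i* eta) p) < e].
Proof.
have [p pcl ph] := orthogonal_projection hil x (subspace_range l%:C).
exists p, (x - p); split => //; first by rewrite addrC subrK.
  have [|Aq qz] := @range_orth l%:C (x - p); first by move=> u Au; apply: ph; exists u.
  by split; rewrite // qz conj_real.
move=> e e0; have /closure_nrmP/(_ (e / 2)) := pcl.
case; [by lra|move=> _ [v Av <-] vp].
have v0 : 0 < 4 * (nrm v + 1) by rewrite mulr_gt0// ltr_wpDl// nrm_ge0.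
(* Approximating p costs e / 2, and this choice makes 2 eta |v| < e / 2. *)
exists (e / (4 * (nrm v + 1))); first by rewrite divr_gt0.
move=> eta /andP[eta0]; rewrite ltr_pdivlMr// => hd.
set z := l +i* eta; have z0 : complex.Im z != 0 by rewrite gt_eqF.
have rz := nonreal_resolvent z0.
have etaE f : eta * nrm (res z f) <= nrm f.
  by have := nrm_res_nonreal f z0; rewrite /= gtr0_norm.
have -> : res z p = res z (p - opshift l%:C v) + (v + (z - l%:C) *: res z v).
  by rewrite -(res_chain rz Av erefl) -resD//; congr (res z _); lmod_ring.
have -> : z - l%:C = 0 +i* eta.
  by apply/eqP; rewrite eq_complex/= subrr subr0 !eqxx.
have i0 : nrm (0 +i* eta : C) = eta.
  by rewrite /nrm normc_def/= expr0n/= add0r sqrtr_sqr gtr0_norm.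
have h1 := ler_nrmD (res z (p - opshift l%:C v)) (v + (0 +i* eta) *: res z v).
have h2 := ler_nrmD v ((0 +i* eta) *: res z v).
rewrite nrmZ i0 in h2.
have h3 := etaE (p - opshift l%:C v); have h4 := etaE v; rewrite (nrm_dist p) in h3.
have vv := nrm_ge0 v.
move: h1 h2 h3 h4 hd vp vv; move: (nrm (_ + (_ + _))) (nrm (v + _)) (nrm (res z v)).
move: (nrm (res z _)) (nrm (_ - p)) (nrm v) => a b c d1 d2 d3 h1 h2 h3 h4 hd vp vv.
by nra.
Qed.

End SelfAdjoint.

(** * The gamma-field and the Weyl function *)

Section BoundaryTriple.
Context {R : realType}.
Local Notation C := R[i].
Context {H G : completeNormedModType C}.
Context (ipH : {dot H for @Num.conj C}) (ipG : {dot G for @Num.conj C}).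
Hypothesis (hilH : hilbert ipH) (hilG : hilbert ipG).
Context (S T : operator H) (Gamma0 Gamma1 : H -> G).
Hypothesis qbt : quasi_boundary_triple ipH ipG S T Gamma0 Gamma1.
Implicit Types (u v w x y f : H) (g h : G).

Local Notation A0 := (A_zero T Gamma0).
Local Notation gam := (gamma_field T Gamma0).
Local Notation M := (weyl T Gamma0 Gamma1).
Local Notation D := (ran0 T Gamma0).

Lemma G0D u v : dom T u -> dom T v -> Gamma0 (u + v) = Gamma0 u + Gamma0 v.
Proof. by move=> Tu Tv; have := qbt_linear0 qbt 1 Tu Tv; rewrite !scale1r. Qed.
Lemma G1D u v : dom T u -> dom T v -> Gamma1 (u + v) = Gamma1 u + Gamma1 v.
Proof. by move=> Tu Tv; have := qbt_linear1 qbt 1 Tu Tv; rewrite !scale1r. Qed.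
Lemma dT0 : dom T 0. Proof. exact: (qbt_linear qbt).1.1. Qed.
Lemma dTD u v : dom T u -> dom T v -> dom T (u + v).
Proof. exact: (subspaceD (qbt_linear qbt).1). Qed.
Lemma dTZ (a : C) u : dom T u -> dom T (a *: u).
Proof. exact: (subspaceZ a (qbt_linear qbt).1). Qed.
Lemma dTB u v : dom T u -> dom T v -> dom T (u - v).
Proof. exact: (subspaceB (qbt_linear qbt).1). Qed.
Lemma G00 : Gamma0 0 = 0.
Proof. by apply: (@addrI _ (Gamma0 0)); rewrite -G0D ?addr0//; exact: dT0. Qed.
Lemma G10 : Gamma1 0 = 0.
Proof. by apply: (@addrI _ (Gamma1 0)); rewrite -G1D ?addr0//; exact: dT0. Qed.
Lemma G0Z (a : C) u : dom T u -> Gamma0 (a *: u) = a *: Gamma0 u.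
Proof. by move=> Tu; have := qbt_linear0 qbt a Tu dT0; rewrite G00 !addr0. Qed.
Lemma G1Z (a : C) u : dom T u -> Gamma1 (a *: u) = a *: Gamma1 u.
Proof. by move=> Tu; have := qbt_linear1 qbt a Tu dT0; rewrite G10 !addr0. Qed.
Lemma G0B u v : dom T u -> dom T v -> Gamma0 (u - v) = Gamma0 u - Gamma0 v.
Proof.
by move=> Tu Tv; have := G0D Tu (dTZ (-1) Tv); rewrite G0Z// !scaleN1r.
Qed.
Lemma G1B u v : dom T u -> dom T v -> Gamma1 (u - v) = Gamma1 u - Gamma1 v.
Proof.
by move=> Tu Tv; have := G1D Tu (dTZ (-1) Tv); rewrite G1Z// !scaleN1r.
Qed.

Lemma linA0 : linear_operator A0.
Proof.
split=> [|a u v [Tu _] [Tv _]]; last exact: (qbt_linear qbt).2.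
split=> [|a u v [Tu u0] [Tv v0]]; first by split; [exact: dT0|exact: G00].
split; first exact: (qbt_linear qbt).1.2.
by rewrite /= G0D ?G0Z//; [rewrite u0 v0 scaler0 addr0|exact: dTZ].
Qed.

Lemma saA0 : selfadjoint ipH A0. Proof. exact: (qbt_selfadjoint qbt). Qed.

Let rho_nonreal z : complex.Im z != 0 -> resolvent_set A0 z.
Proof. exact: (nonreal_resolvent hilH linA0 saA0). Qed.

(** The decomposition of [dom T]: if Gamma0 u = g, subtracting R(z) (T - z) u from u lands in ker (T
    - z) without changing Gamma0 u. *)
Lemma gamma_spec z g : resolvent_set A0 z -> D g ->
  [/\ dom T (gam z g), T (gam z g) = z *: gam z g & Gamma0 (gam z g) = g].
Proof.
move=> rz [u Tu ug].
have [[Tv v0] vf] := res_spec (T u - z *: u) rz; set v := res A0 z _ in Tv v0 vf.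
have Eg : (Gamma0 @` op_eigenspace T z) g.
  exists (u - v); last by rewrite G0B// v0 subr0.
  split; first exact: dTB.
  have := vf; rewrite /opshift /= => vf'.
  have -> : T (u - v) = T u - T v.
    have := (qbt_linear qbt).2 (-1) v u Tv Tu.
    by rewrite !scaleN1r ![- _ + _]addrC.
  by rewrite -[T v](subrK (z *: v)) vf'; lmod_ring.
have sj : set_surj (op_eigenspace T z) [set g] Gamma0 by move=> _ ->.
have [? ?] : op_eigenspace T z (gam z g) by apply: (surjpinv_image_sub sj); exists g.
by split => //; rewrite /gamma_field (surjpK _ sj)// inE.
Qed.

Lemma dT_gam z g : resolvent_set A0 z -> D g -> dom T (gam z g).
Proof. by move=> rz Dg; have [] := gamma_spec rz Dg. Qed.

(** Gamma0 is injective on ker (T - z), because the difference of two vectors with the same boundary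
    value lies in ker (A_0 - z) = 0. *)
Lemma gamma_eq z u : resolvent_set A0 z -> dom T u -> T u = z *: u ->
  gam z (Gamma0 u) = u.
Proof.
move=> rz Tu uz; have [|Tv vz v0] := @gamma_spec z (Gamma0 u) rz; first by exists u.
have dv : dom A0 (gam z (Gamma0 u) - u).
  by split; [exact: dTB|rewrite /= G0B// v0 subrr].
apply/eqP; rewrite -subr_eq0; apply/eqP.
apply: (shift_inj rz dv (dom0 linA0)).
rewrite /opshift (op0 linA0) /= scaler0 subr0.
have := (qbt_linear qbt).2 (-1) u _ Tu Tv; rewrite !scaleN1r addrC => ->.
by rewrite vz uz; lmod_ring.
Qed.

Lemma gamma_res (z w : C) g : resolvent_set A0 z -> resolvent_set A0 w -> D g ->
  gam z g = gam w g + (z - w) *: res A0 z (gam w g).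
Proof.
move=> rz rw Dg; have [Tu uw ug] := gamma_spec rw Dg; set u := gam w g in Tu uw ug *.
have [[Tv v0] vf] := res_spec u rz; set v := res A0 z u in Tv v0 vf *.
have Tx : dom T (u + (z - w) *: v) by apply: dTD => //; exact: dTZ.
have <- : Gamma0 (u + (z - w) *: v) = g by rewrite G0D ?G0Z// ?v0 ?scaler0 ?addr0//; exact: dTZ.
apply: gamma_eq => //.
rewrite addrC (qbt_linear qbt).2// uw.
have -> : T v = u + z *: v by rewrite -{1}vf /opshift /= subrK.
by lmod_ring.
Qed.

Lemma ran0D (a : C) g h : D g -> D h -> D (a *: g + h).
Proof.
move=> [u Tu <-] [v Tv <-]; exists (a *: u + v); first exact: (qbt_linear qbt).1.2.
by rewrite G0D ?G0Z//; exact: dTZ.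
Qed.

Lemma ran00 : D 0. Proof. by exists 0; [exact: dT0|exact: G00]. Qed.

Lemma gamma_linear z (a : C) g h : resolvent_set A0 z -> D g -> D h ->
  gam z (a *: g + h) = a *: gam z g + gam z h.
Proof.
move=> rz Dg Dh; have [Tu uz ug] := gamma_spec rz Dg; have [Tv vz vh] := gamma_spec rz Dh.
have {1}-> : a *: g + h = Gamma0 (a *: gam z g + gam z h).
  by rewrite G0D ?G0Z ?ug ?vh//; exact: dTZ.
apply: gamma_eq => //; first exact: (qbt_linear qbt).1.2.
by rewrite (qbt_linear qbt).2// uz vz; lmod_ring.
Qed.

(** Green's identity with Gamma0 u = 0. Read on u = R(conj z) f, it says that Gamma1 R(conj z) is
    the adjoint of gamma(z). *)
Lemma gamma_adjoint u (z : C) g : dom A0 u -> resolvent_set A0 z -> D g ->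
  ipH (opshift A0 z^*%C u) (gam z g) = ipG (Gamma1 u) g.
Proof.
move=> [Tu u0] rz Dg; have [Tv vz vg] := gamma_spec rz Dg.
have := qbt_green qbt Tu Tv; rewrite u0 ip0l subr0 vg => <-.
by rewrite vz /opshift ipBl ipZl ipZr.
Qed.

Lemma dense_ran0 g (e : R) : 0 < e -> exists2 h, D h & nrm (h - g) < e.
Proof.
move=> e0; pose O : set (G * G) := [set p | nrm (p.1 - g) < e].
have nO (p : G) : nrm (p - g) < e -> nbhs p [set q | nrm (q - g) < e].
  move=> pg; apply/nbhs_nrmP; exists (e - nrm (p - g)); first by rewrite subr_gt0.
  by move=> y yp; rewrite /=; have := ler_nrm_dist p y g; lra.
have oO : open O.
  rewrite openE => -[p q] /= pg; exists ([set r | nrm (r - g) < e], setT) => /=.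
    by split; [exact: nO|exact: filterT].
  by move=> [r s] [].
have [|p [pO [u Tu up]]] := qbt_dense qbt _ oO.
  by exists (g, 0); rewrite /O /= subrr nrm0.
by exists (Gamma0 u); [exists u|move: pO; rewrite -up].
Qed.

Lemma ran0_orth g : (forall h, D h -> ipG g h = 0) -> g = 0.
Proof.
move=> gD; apply: (ip_eq0 hilG); apply: (closure_orth hilG) gD _.
by apply/closure_nrmP => e /(@dense_ran0 g)[h Dh hg]; exists h.
Qed.

(** By [gamma_adjoint], (f, gamma(conj w) h) = (Gamma1 R(w) f, h), so the vectors gamma(conj w) h
    with |h| <= 1 are weakly bounded, hence bounded. The bound on gamma(conj w) returns to Gamma1
    R(w) by duality, as ran Gamma0 is dense. *)
Lemma Gamma1_res_bounded (w : C) : complex.Im w != 0 ->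
  exists2 c : R, 0 <= c & forall f, nrm (Gamma1 (res A0 w f)) <= c * nrm f.
Proof.
move=> w0; have rw := rho_nonreal w0.
have rw' : resolvent_set A0 w^*%C by apply: rho_nonreal; rewrite ImJ oppr_eq0.
have adj f h : D h -> ipH f (gam w^*%C h) = ipG (Gamma1 (res A0 w f)) h.
  move=> Dh; rewrite -(gamma_adjoint (res_dom f rw) rw' Dh) conjcK.
  by rewrite shift_res.
have [|c hc] := uniform_boundedness hilH
    (S := [set gam w^*%C h | h in [set h | D h /\ nrm h <= 1]]).
  move=> f; exists (nrm (Gamma1 (res A0 w f))) => _ [h [Dh h1] <-].
  rewrite adj// (le_trans (cauchy_schwarz hilG _ _))//.
  by rewrite ler_piMr ?nrm_ge0.
exists `|c| => // f; set y := Gamma1 _.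
have hb h : D h -> nrm (ipG y h) <= `|c| * nrm f * nrm h.
  move=> Dh; have [->|h0] := eqVneq h 0; first by rewrite ip0r !nrm0 mulr0.
  have n0 : 0 < nrm h by rewrite nrm_gt0.
  have Dh' : D ((nrm h)^-1%:C *: h) by rewrite -[_ *: _]addr0; exact: ran0D ran00.
  move: Dh'; set k := _ *: h => Dk.
  have nk : nrm k = 1.
    by rewrite nrmZ nrm_real ger0_norm ?invr_ge0 ?nrm_ge0// mulVf// gt_eqF.
  have hk : h = (nrm h)%:C *: k.
    by rewrite /k scalerA -rmorphM/= mulfV ?gt_eqF// scale1r.
  have hg : nrm (gam w^*%C k) <= c by apply: hc; exists k => //; rewrite /= nk.
  have -> : nrm (ipG y h) = nrm h * nrm (ipH f (gam w^*%C k)).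
    rewrite {1}hk ipZr -adj// nrmM nrm_conj nrm_real.
    by rewrite (ger0_norm (nrm_ge0 h)).
  rewrite mulrC ler_wpM2r ?nrm_ge0//.
  rewrite (le_trans (cauchy_schwarz hilH _ _))// mulrC ler_wpM2r ?nrm_ge0//.
  exact: le_trans hg (ler_norm c).
have [->|y0] := eqVneq y 0; first by rewrite nrm0 mulr_ge0 ?nrm_ge0.
have n0 : 0 < nrm y by rewrite nrm_gt0.
rewrite -(ler_pM2r n0) -expr2; apply/ler_addgt0Pl => e e0.
have k0 : 0 < `|c| * nrm f + nrm y + 1 by rewrite ltr_wpDl ?addr_ge0 ?mulr_ge0 ?nrm_ge0.
(* The vector y need not belong to ran Gamma0, so it is tested against a nearby h. With k = |c| |f|
   and distance q the two errors are k q and |y| q, together at most e. *)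
have [h Dh hy] := @dense_ran0 y (e / (`|c| * nrm f + nrm y + 1)) (divr_gt0 e0 k0).
move: hy; set q := e / _ => hy.
have qe : q * (`|c| * nrm f + nrm y + 1) = e by rewrite /q divfK ?gt_eqF.
have -> : nrm y ^+ 2 = nrm (ipG y y).
  by rewrite (ip_nrm hilG) nrm_real ger0_norm ?exprn_ge0 ?nrm_ge0.
have -> : ipG y y = ipG y h - ipG y (h - y) by rewrite ipBr; ring.
have := ler_nrmB (ipG y h) (ipG y (h - y)); have := hb h Dh.
have := cauchy_schwarz hilG y (h - y).
have hyy : nrm h <= nrm y + q by have := ler_nrmD (h - y) y; rewrite subrK; lra.
have cf0 : 0 <= `|c| * nrm f by rewrite mulr_ge0 ?nrm_ge0.
have q0 : 0 < q by rewrite divr_gt0.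
move: cf0 qe; move: (`|c| * nrm f) => k cf0 qe.
have h1 : k * nrm h <= k * (nrm y + q) by rewrite ler_wpM2l.
have h2 : nrm y * nrm (h - y) <= nrm y * q by rewrite ler_wpM2l ?nrm_ge0// ltW.
by nra.
Qed.

(** Since R(z) f = R(i) (f + (z - i) R(z) f), the bound at i serves all z. Keeping |R(z) f| explicit
    makes it usable where R(z) blows up in norm but not on the given f. *)
Lemma Gamma1_res (c : R) : 0 <= c -> (forall f, nrm (Gamma1 (res A0 'i%C f)) <= c * nrm f) ->
  forall z f, resolvent_set A0 z ->
  nrm (Gamma1 (res A0 z f)) <= c * (nrm f + nrm (z - 'i%C) * nrm (res A0 z f)).
Proof.
move=> c0 hc z f rz.
have ri : resolvent_set A0 'i%C by apply: rho_nonreal; rewrite /= oner_eq0.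
have E : res A0 z f = res A0 'i%C (f + (z - 'i%C) *: res A0 z f).
  rewrite (resD linA0)// (resZ linA0)// (resolvent_identity linA0 f ri rz).
  by lmod_ring.
rewrite {1}E; apply: le_trans (hc _) _.
by rewrite ler_wpM2l// (le_trans (ler_nrmD _ _))// nrmZ.
Qed.

Lemma weyl_res (z w : C) g : resolvent_set A0 z -> resolvent_set A0 w -> D g ->
  M z g = M w g + (z - w) *: Gamma1 (res A0 z (gam w g)).
Proof.
move=> rz rw Dg; rewrite /weyl (gamma_res rz rw Dg).
have [Tv _] := res_dom (gam w g) rz; have Tu := dT_gam rw Dg.
by rewrite G1D ?G1Z//; exact: dTZ.
Qed.

Lemma weyl_Im z g : resolvent_set A0 z -> D g ->
  complex.Im (ipG (M z g) g) = complex.Im z * nrm (gam z g) ^+ 2.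
Proof.
move=> rz Dg; have [Tu uz ug] := gamma_spec rz Dg.
have := qbt_green qbt Tu Tu; rewrite uz ug ipZl ipZr (ip_nrm hilH) -/(M z g).
rewrite (ipC ipG g) => /(congr1 (@complex.Im _)).
rewrite !(ImD, ImN, ImM, ImJ, ReJ)/=; lra.
Qed.

Lemma res_eigen z (l : C) q : resolvent_set A0 z -> op_eigenspace A0 l q -> z != l ->
  res A0 z q = (l - z)^-1 *: q.
Proof.
move=> rz [Aq ql] zl; apply: res_eq => //; first exact: (domZ linA0).
rewrite (shiftZ linA0)// /opshift ql -scalerBl scalerA mulVf ?scale1r//.
by rewrite subr_eq0 eq_sym.
Qed.

Lemma RM_net_cvg (l : R) (mu : C) g : complex.Im mu != 0 -> D g ->
  exists p q, [/\ gam mu g = p + q, op_eigenspace A0 l%:C q,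
    closure [set opshift A0 l%:C u | u in dom A0] p &
    RM_net T Gamma0 Gamma1 l g @ 0^'+ --> (mu - l%:C) *: Gamma1 q].
Proof.
move=> mu0 Dg; have rmu := rho_nonreal mu0.
have [p [q [xpq qe pcl hp]]] := ergodic_splitting hilH linA0 saA0 l (gam mu g).
exists p, q; split => //; apply/cvg_nrmP => e e0.
have [|c c0 hc] := @Gamma1_res_bounded 'i%C; first by rewrite /= oner_eq0.
pose K := nrm (l%:C - mu) + 1; pose K' := nrm (l%:C - 'i%C) + 1.
have K0 : 0 < K by rewrite ltr_wpDl ?nrm_ge0.
have K'0 : 0 < K' by rewrite ltr_wpDl ?nrm_ge0.
(* [a] collects the terms that stay bounded as eta tends to 0, while K c K' is the factor of |R(z)
   p|, whose product with eta tends to 0. For eta < 1, K and K' bound |z - mu| and |z - i|. *)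
pose a := nrm (M mu g) + nrm (Gamma1 q) + K * c * nrm p + 1.
have a0 : 0 < a by rewrite ltr_wpDl ?addr_ge0 ?mulr_ge0 ?nrm_ge0// ltW.
have k0 : 0 < K * c * K' + 1 by rewrite ltr_wpDl// !mulr_ge0// ltW.
have [|d d0 hd] := hp (e / 2 / (K * c * K' + 1)); first by rewrite !divr_gt0.
near=> eta.
have eta0 : 0 < eta by near: eta; exact: nbhs_right_gt.
have eta1 : eta < 1 by near: eta; exact: nbhs_right_lt.
have etad : eta < d by near: eta; exact: nbhs_right_lt.
have etaa : eta < e / 2 / a by near: eta; apply: nbhs_right_lt; rewrite !divr_gt0.
have := hd eta; rewrite eta0 etad => /(_ isT).
set z := l +i* eta; have z0 : complex.Im z != 0 by rewrite gt_eqF.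
have rz := rho_nonreal z0.
set j := 0 +i* eta : C.
have zl : z - l%:C = j by apply/eqP; rewrite eq_complex/= subrr subr0 !eqxx.
have j0 : j != 0 by rewrite eq_complex/= negb_and (gt_eqF eta0) orbT.
have nj : nrm j = eta by rewrite /nrm normc_def/= expr0n/= add0r sqrtr_sqr gtr0_norm.
move=> hR.
have [Tq _] := qe.1; have [Tp _] := res_dom p rz.
(* The eigenvector contributes j (z - mu) (l - z)^(-1) Gamma1 q with j = z - l, which is (mu - l)
   Gamma1 q - j Gamma1 q: the limit plus a small term. *)
have -> : RM_net T Gamma0 Gamma1 l g eta - (mu - l%:C) *: Gamma1 q =
    j *: (M mu g + (z - mu) *: Gamma1 (res A0 z p) - Gamma1 q).
  rewrite /RM_net (weyl_res rz rmu Dg) xpq (resD linA0)// (res_eigen rz qe); last first.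
    by rewrite -subr_eq0 zl.
  have -> : (l%:C - z)^-1 = - j^-1 by rewrite -opprB zl invrN.
  rewrite G1D// ?G1Z//; last exact: dTZ.
  have -> : z - mu = j - (mu - l%:C) by rewrite -zl; ring.
  rewrite -[X in _ = j *: (_ - X)](scale1r (Gamma1 q)) -(mulfV j0).
  apply: sqz_inj; rewrite ?(sqzD, sqzN, sqzZ, sqz0).
  have e1 : sqz_scal G j * sqz_scal G j^-1 = 1 by rewrite -rmorphM/= mulfV// rmorph1.
  rewrite [sqz_scal G (j * j^-1)]rmorphM/= e1.
  ring: e1.
rewrite nrmZ nj.
have h1 := ler_nrmB (M mu g + (z - mu) *: Gamma1 (res A0 z p)) (Gamma1 q).
have h2 := ler_nrmD (M mu g) ((z - mu) *: Gamma1 (res A0 z p)); rewrite nrmZ in h2.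
have h3 := Gamma1_res c0 hc p rz.
have h4 : nrm (z - mu) <= K.
  have -> : z - mu = j + (l%:C - mu) by rewrite -zl; ring.
  by have := ler_nrmD j (l%:C - mu); rewrite nj /K; lra.
have h5 : nrm (z - 'i%C) <= K'.
  have -> : z - 'i%C = j + (l%:C - 'i%C) by rewrite -zl; ring.
  by have := ler_nrmD j (l%:C - 'i%C); rewrite nj /K'; lra.
have h6 : nrm (z - mu) * nrm (Gamma1 (res A0 z p)) <=
    K * (c * (nrm p + K' * nrm (res A0 z p))).
  rewrite ler_pM ?nrm_ge0// (le_trans h3)// ler_wpM2l// lerD2l.
  by rewrite ler_wpM2r ?nrm_ge0.
have h7 : eta * a < e / 2 by rewrite -ltr_pdivlMr.
have h8 : (eta * nrm (res A0 z p)) * (K * c * K' + 1) < e / 2 by rewrite -ltr_pdivlMr.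
have h9 : 0 <= eta * nrm (res A0 z p) by rewrite mulr_ge0 ?nrm_ge0// ltW.
have : nrm (M mu g + (z - mu) *: Gamma1 (res A0 z p) - Gamma1 q) <=
   a - 1 + K * c * K' * nrm (res A0 z p).
  by move: h1 h2 h6; rewrite /a; lra.
rewrite -(ler_pM2l eta0) => /le_lt_trans; apply.
by move: h7 h8 h9; lra.
Unshelve. all: by end_near.
Qed.

End BoundaryTriple.

(** * Integration against set functions and vanishing derivatives *)

Import HBNNSimple.

(** The integral sees a set function only through level sets of simple functions, which are
    measurable. Bare set functions are allowed because [diag_measure] is not declared as a
    measure. *)
Lemma eq_measure_integral_mset d (T : measurableType d) (R : realType)
    (m1 m2 : set T -> \bar R) (D : set T) (f : T -> \bar R) :
  (forall B, measurable B -> m1 B = m2 B) ->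
  (\int[m1]_(t in D) f t = \int[m2]_(t in D) f t)%E.
Proof.
move=> m12.
have E (h : {nnsfun T >-> R}) : sintegral m1 h = sintegral m2 h.
  by apply: eq_fsbigr => x _; rewrite m12//; exact: measurable_funPTI.
rewrite /integral; congr (ereal_sup _ - ereal_sup _)%E;
  by apply/seteqP; split => _ [h hf <-]; exists h.
Qed.

Lemma is_derive_0 (R : realType) (m : R -> R) (s : R) :
  (forall e : R, 0 < e -> exists2 d : R, 0 < d &
    forall t, `|t - s| < d -> `|m t - m s| <= e * `|t - s|) ->
  is_derive s 1 m 0.
Proof.
move=> hm; have h : (fun h => h^-1 *: (m (h *: 1 + s) - m s)) @ 0^' --> (0 : R).
  apply/cvgrPdist_lt => e e0; have [|d d0 hd] := hm (e / 2); first by lra.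
  near=> h; have h0 : h != 0 by near: h; exact: nbhs_dnbhs_neq.
  have hs : `|h| < d by near: h; exact: dnbhs0_lt.
  rewrite sub0r normrN normrZ normfV mulrC ltr_pdivrMr ?normr_gt0//.
  have := hd (h *: 1 + s); rewrite addrK scaler1 => /(_ hs) /le_lt_trans; apply.
  by rewrite ltr_pM2r ?normr_gt0//; lra.
by apply: DeriveDef; [apply/cvg_ex; exists 0|exact: cvg_lim].
Unshelve. all: by end_near.
Qed.

(** * Spectral measures *)

Section SpectralMeasure.
Context {R : realType}.
Local Notation C := R[i].
Context {H : completeNormedModType C} (ip : {dot H for @Num.conj C}).
Hypothesis hil : hilbert ip.
Context (A : operator H) (E : set R -> H -> H).
Hypothesis (linA : linear_operator A) (saA : selfadjoint ip A).
Hypothesis spE : spectral_measure ip A E.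
Implicit Types (u v w x y : H) (B : set R).

Lemma spD B u v : measurable B -> E B (u + v) = E B u + E B v.
Proof. by move=> mB; have := sm_linear spE mB 1 (u:=u) (v:=v) I I; rewrite !scale1r. Qed.
Lemma sp0 B : measurable B -> E B 0 = 0.
Proof. by move=> mB; apply: (@addrI _ (E B 0)); rewrite -spD ?addr0. Qed.
Lemma spZ B (a : C) u : measurable B -> E B (a *: u) = a *: E B u.
Proof. by move=> mB; have := sm_linear spE mB a (u:=u) (v:=0) I I; rewrite sp0// !addr0. Qed.
Lemma spB B u v : measurable B -> E B (u - v) = E B u - E B v.
Proof. by move=> mB; rewrite -(scaleN1r v) spD// spZ// scaleN1r. Qed.

Lemma sp_nrm B u : measurable B -> ip (E B u) u = (nrm (E B u) ^+ 2)%:C.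
Proof.
by move=> mB; rewrite -(ip_nrm hil) [in RHS](sm_sym spE)// (sm_idem spE)// (sm_sym spE).
Qed.

Lemma sp_contract B u : measurable B -> nrm (E B u) <= nrm u.
Proof.
move=> mB; have [->|u0] := eqVneq (E B u) 0; first by rewrite nrm0 nrm_ge0.
have n0 : 0 < nrm (E B u) by rewrite nrm_gt0.
rewrite -(ler_pM2l n0) -expr2 -[leLHS]ger0_norm ?exprn_ge0 ?nrm_ge0//.
by rewrite -nrm_real -sp_nrm// cauchy_schwarz.
Qed.

(** The series with constant term [E set0 u] converges by sigma-additivity, so its term is 0; finite
    additivity depends on this. *)
Lemma sp_set0 u : E set0 u = 0.
Proof.
have := @sm_sigma_additive _ _ _ _ _ spE (fun=> set0) u (fun=> measurable0).
rewrite bigcup0// => /(_ (@trivIset_set0 _ _ _)) /ncvgP h.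
have h' : ncvg (fun n => \sum_(0 <= k < n.+1) E set0 u) (E set0 u).
  by move=> e /h[N hN]; exists N => n Nn; exact/hN/leqW.
apply/eqP; rewrite -nrm_eq0 eq_le nrm_ge0 andbT; apply/ler_addgt0Pl => e e0.
have [N hN] := h (e / 2) ltac:(lra); have := hN N (leqnn _); have := hN N.+1 (leqnSn _).
rewrite big_nat_recr//= addrK addr0; move: (\sum_(_ <= k < _) _) => s h1 h2.
have := ler_nrmB s (s - E set0 u); rewrite opprB addrC subrK.
by lra.
Qed.

Lemma sp_additive B B' u : measurable B -> measurable B' -> B `&` B' = set0 ->
  E (B `|` B') u = E B u + E B' u.
Proof.
move=> mB mB' BB'.
have := @sm_sigma_additive _ _ _ _ _ spE (bigcup2 B B') u.
rewrite bigcup2E => h; apply: (@ncvg_unique _ _ (fun n => \sum_(0 <= k < n) E (bigcup2 B B' k) u)).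
  apply/ncvgP/h; last by rewrite -trivIset_bigcup2.
  by case=> [|[|n]] /=; [exact: mB|exact: mB'|exact: measurable0].
move=> e e0; exists 2 => -[|[|n]]// _.
rewrite !big_nat_recl// big1_seq ?addr0 ?subrr ?nrm0// => i _.
by rewrite /= sp_set0.
Qed.

(** Multiplicativity of E is not part of [spectral_measure]. For v = E(B') u, additivity gives E(B
    [|] B') v = E(B) v + v, of squared norm 3 |E(B) v|^2 + |v|^2, while the projection property
    bounds it by |v|^2. *)
Lemma sp_disjoint B B' u : measurable B -> measurable B' -> B `&` B' = set0 ->
  E B (E B' u) = 0.
Proof.
move=> mB mB' BB'; set v := E B' u.
have := sp_contract v (measurableU _ _ mB mB'); rewrite sp_additive// [E B' v](sm_idem spE)//.
rewrite -(@ler_pXn2r _ 2)// ?nnegrE ?nrm_ge0// (nrmD_sq hil) -/v /rip sp_nrm//=.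
rewrite mulr2n => h; apply/eqP; rewrite -nrm_eq0 -sqrf_eq0 eq_le sqr_ge0 andbT.
by have := sqr_ge0 (nrm (E B v)); lra.
Qed.

Lemma sp_setI B B' u : measurable B -> measurable B' -> E B (E B' u) = E (B `&` B') u.
Proof.
move=> mB mB'; have mI := measurableI _ _ mB mB'.
have {1}-> : B' = (B `&` B') `|` (B' `\` B) by rewrite setIC setUIDK.
rewrite sp_additive//; [|exact: measurableD|by apply/seteqP; split => x //= -[[? ?] [? ?]]].
have mD := measurableD mB' mB.
rewrite spD// [E B (E (B' `\` B) u)]sp_disjoint ?setDIK// addr0.
have {1}-> : B = (B `&` B') `|` (B `\` B') by rewrite setUIDK.
rewrite sp_additive//; [|exact: measurableD|by apply/seteqP; split => x //= -[[? ?] [? ?]]].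
rewrite (sm_idem spE)// sp_disjoint ?addr0//; first exact: measurableD.
by apply/seteqP; split => x //= -[[? ?] [? ?]].
Qed.

Lemma sp_setC B u : measurable B -> u = E B u + E (~` B) u.
Proof.
move=> mB; rewrite -sp_additive ?setUv ?setICr// ?(sm_total spE)//.
exact: measurableC.
Qed.

Lemma sp_sub B B' u : measurable B -> measurable B' -> B `<=` B' ->
  E B' u = 0 -> E B u = 0.
Proof.
by move=> mB mB' BB' h; rewrite -(setIidl BB') -sp_setI// h sp0.
Qed.

Lemma sp_sub_id B B' u : measurable B -> measurable B' -> B `<=` B' ->
  E B u = u -> E B' u = u.
Proof. by move=> mB mB' BB' h; rewrite -{1}h sp_setI// (setIidr BB'). Qed.

Lemma sp_bigcup0 (F : nat -> set R) u : (forall n, measurable (F n)) ->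
  (forall n, E (F n) u = 0) -> E (\bigcup_n F n) u = 0.
Proof.
move=> mF F0; rewrite seqDU_bigcup_eq.
have mD n : measurable (seqDU F n) by exact: seqDU_measurable.
have := @sm_sigma_additive _ _ _ _ _ spE (seqDU F) u mD (@trivIset_seqDU _ F).
move=> /ncvgP h; apply: ncvg_unique h _ => e e0; exists 0%N => n _.
rewrite big1 ?subr0 ?nrm0// => i _; apply: sp_sub (F0 i) => //.
exact: subset_seqDU.
Qed.

(** The measure (E(B) u, u), cut off to 0 on nonmeasurable sets, where nothing is known of E; on
    Borel sets it agrees with [diag_measure]. *)
Definition spm u (B : set R) : \bar R :=
  if `[< measurable B >] then (nrm (E B u) ^+ 2)%:E else 0%E.

Lemma spmE u B : measurable B -> spm u B = (nrm (E B u) ^+ 2)%:E.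
Proof. by move=> mB; rewrite /spm asboolT. Qed.

Let spm0 u : spm u set0 = 0%E.
Proof. by rewrite spmE// sp_set0 nrm0 expr0n. Qed.
Let spm_ge0 u B : (0 <= spm u B)%E.
Proof. by rewrite /spm; case: ifP => // _; rewrite lee_fin sqr_ge0. Qed.
Let spm_sigma u : semi_sigma_additive (spm u).
Proof.
move=> F mF tF mU; rewrite spmE//.
have -> : (fun n => \sum_(0 <= i < n) spm u (F i))%E =
    EFin \o (fun n => rip ip (\sum_(0 <= i < n) E (F i) u) u).
  apply/funext => n /=; rewrite /rip; elim: n => [|n ih]; first by rewrite !big_nil ip0l.
  by rewrite !big_nat_recr//= ih ipDl ReD EFinD spmE// sp_nrm.
have -> : nrm (E (\bigcup_n F n) u) ^+ 2 = rip ip (E (\bigcup_n F n) u) u.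
  by rewrite /rip sp_nrm.
apply: cvg_EFin; first exact: nearW.
have h := @sm_sigma_additive _ _ _ _ _ spE F u mF tF.
apply/cvgrPdist_lt => e e0.
have u1 : 0 < nrm u + 1 by rewrite ltr_wpDl// nrm_ge0.
move/cvg_nrmP : h => /(_ _ (divr_gt0 e0 u1)); apply: filterS => n /= h.
rewrite /rip -ReN -ReD -ipBl (le_lt_trans (ler_Re_nrm _))//.
rewrite (le_lt_trans (cauchy_schwarz hil _ _))// nrm_dist.
rewrite (le_lt_trans (y:=nrm (\sum_(0 <= i < n) E (F i) u - E (\bigcup_n F n) u) * (nrm u + 1)))//.
  by rewrite ler_wpM2l ?nrm_ge0// lerDl.
by rewrite -ltr_pdivlMr.
Qed.
HB.instance Definition _ u := isMeasure.Build _ R R (spm u) (spm0 u) (spm_ge0 u) (@spm_sigma u).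

Lemma integral_diag u (f : R -> \bar R) :
  (\int[diag_measure ip E u]_(t in [set: R]) f t = \int[spm u]_(t in [set: R]) f t)%E.
Proof.
apply: eq_measure_integral_mset => B mB; rewrite spmE// /diag_measure.
by rewrite sp_nrm.
Qed.

Let mT : measurable [set: R]. Proof. exact: measurableT. Qed.
Let m_id D : measurable_fun D (EFin : R -> \bar R).
Proof. exact/measurable_EFinP/measurable_id. Qed.
Let m_sq D : measurable_fun D (fun t : R => (t ^+ 2)%:E).
Proof. exact/measurable_EFinP/measurable_funX/measurable_id. Qed.

Lemma spm_setT u : spm u [set: R] = (nrm u ^+ 2)%:E.
Proof. by rewrite spmE// (sm_total spE). Qed.

Lemma sp_domP u : dom A u <-> (\int[spm u]_(t in [set: R]) ((t ^+ 2)%:E) < +oo)%E.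
Proof. by rewrite -integral_diag (sm_dom spE). Qed.

Lemma sp_integrable u : dom A u -> (spm u).-integrable [set: R] (EFin : R -> \bar R).
Proof.
move=> /sp_domP h; apply/integrableP; split; first exact: m_id.
apply: (@le_lt_trans _ _ (\int[spm u]_(t in [set: R]) (1%:E + (t ^+ 2)%:E))%E).
  apply: ge0_le_integral => //.
  - by apply: measurableT_comp => //; exact: m_id.
  - by apply: emeasurable_funD => //; exact: m_sq.
  - move=> t _; rewrite abse_EFin -EFinD lee_fin.
    by have := sqr_ge0 (`|t| - 1); rewrite sqrrB1 real_normK ?num_real//; have := normr_ge0 t; lra.
rewrite ge0_integralD//; last by move=> t _; rewrite lee_fin sqr_ge0.
apply: lte_add_pinfty => //; rewrite integral_cst// mul1e.
by rewrite [X in (X < _)%E]spm_setT ltry.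
Qed.

Lemma sp_form u : dom A u -> rip ip (A u) u = fine (\int[spm u]_(t in [set: R]) t%:E)%E.
Proof. by move=> Au; rewrite /rip (sm_integral spE Au) integral_diag. Qed.

Lemma spm_add B u v : measurable B -> E B u = u -> E B v = 0 ->
  forall B', measurable B' -> spm (u + v) B' = measure_add (spm u) (spm v) B'.
Proof.
move=> mB Bu Bv B' mB'; have -> : measure_add (spm u) (spm v) B' = (spm u B' + spm v B')%E by exact: measure_addE.
rewrite !spmE// -EFinD spD//; congr (_%:E).
apply: (pythagoras hil); rewrite (sm_sym spE)// (sp_setI _ mB' mB') setIid -Bu.
by rewrite (sm_sym spE)// sp_setI// setIC -sp_setI// Bv sp0// ip0r.
Qed.

(** E(B') u and E(B') v are orthogonal for every Borel set B', so the diagonal measures add. The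
    mixed terms (A u, v) will be controlled through this identity. *)
Lemma sp_form_add B u v : measurable B -> E B u = u -> E B v = 0 ->
  dom A u -> dom A v -> rip ip (A (u + v)) (u + v) = rip ip (A u) u + rip ip (A v) v.
Proof.
move=> mB Bu Bv Au Av; have Auv := domD linA Au Av; rewrite !sp_form//.
rewrite (eq_measure_integral_mset _ _ (spm_add mB Bu Bv)).
have iu := sp_integrable Au; have iv := sp_integrable Av.
rewrite (integral_measure_add mT iu iv) fineD//.
  exact: integrable_fin_num iu.
exact: integrable_fin_num iv.
Qed.

Lemma sp_dom B u : measurable B -> dom A u -> dom A (E B u).
Proof.
move=> mB /sp_domP; rewrite {1}(sp_setC u mB) => h; apply/sp_domP; apply: le_lt_trans h.
have hB : E B (E (~` B) u) = 0.
  by apply: sp_disjoint => //; [exact: measurableC|rewrite setICr].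
rewrite (eq_measure_integral_mset _ _ (spm_add mB (sm_idem spE _ mB) hB)).
rewrite ge0_integral_measure_add//; last by move=> t _; rewrite lee_fin sqr_ge0.
by rewrite leeDl// integral_ge0// => t _; rewrite lee_fin sqr_ge0.
Qed.

Let spm_C B u : measurable B -> E B u = u -> spm u (~` B) = 0%E.
Proof.
move=> mB Bu; rewrite spmE; last exact: measurableC.
rewrite -Bu sp_disjoint ?nrm0 ?expr0n//; first exact: measurableC.
by rewrite setICl.
Qed.

Let spm_B B u : measurable B -> E B u = u -> spm u B = (nrm u ^+ 2)%:E.
Proof. by move=> mB Bu; rewrite spmE// Bu. Qed.

Lemma sp_dom_bounded B (K : R) u : measurable B -> (forall t, B t -> `|t| <= K) ->
  dom A (E B u).
Proof.
move=> mB BK; apply/sp_domP; set v := E B u.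
have Bv : E B v = v by exact: (sm_idem spE).
have mC := measurableC mB.
rewrite (ge0_negligible_integral mC)//; last 2 first.
- by move=> t _; rewrite lee_fin sqr_ge0.
- exact: spm_C.
rewrite setTD setCK; apply: (@le_lt_trans _ _ (\int[spm v]_(t in B) (K ^+ 2)%:E)%E).
  apply: ge0_le_integral => //.
  - by move=> t _; rewrite lee_fin sqr_ge0.
  - move=> t /BK tK; rewrite lee_fin -(real_normK (num_real t)).
    by rewrite ler_pXn2r// nnegrE// (le_trans (normr_ge0 t)).
by rewrite integral_cst// [X in (_ * X)%E](spm_B mB Bv) -EFinM ltry.
Qed.

Let spm_cst B u (a : R) : measurable B -> (spm u).-integrable B (cst a%:E).
Proof.
move=> mB; apply/integrableP; split; first exact: measurable_cst.
rewrite integral_cst//= lte_mul_pinfty// ?lee_fin// spmE//.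
by rewrite ltry.
Qed.

Lemma sp_form_ge B (a : R) u : measurable B -> (forall t, B t -> a <= t) ->
  E B u = u -> dom A u -> a * nrm u ^+ 2 <= rip ip (A u) u.
Proof.
move=> mB Ba Bu Au; have mC := measurableC mB; have iu := sp_integrable Au.
have iB : (spm u).-integrable B (EFin : R -> \bar R) by apply: integrableS iu.
have fB := integrable_fin_num mB iB.
rewrite sp_form// (negligible_integral mC)//; last exact: spm_C.
rewrite setTD setCK -lee_fin fineK// EFinM -(spm_B mB Bu) -integral_cst//.
apply: le_integral => //; last by move=> t; rewrite inE => /Ba; rewrite lee_fin.
exact: spm_cst.
Qed.

Lemma sp_form_le B (a : R) u : measurable B -> (forall t, B t -> t <= a) ->
  E B u = u -> dom A u -> rip ip (A u) u <= a * nrm u ^+ 2.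
Proof.
move=> mB Ba Bu Au; have mC := measurableC mB; have iu := sp_integrable Au.
have iB : (spm u).-integrable B (EFin : R -> \bar R) by apply: integrableS iu.
have fB := integrable_fin_num mB iB.
rewrite sp_form// (negligible_integral mC)//; last exact: spm_C.
rewrite setTD setCK -lee_fin fineK// EFinM -(spm_B mB Bu) -integral_cst//.
apply: le_integral => //; last by move=> t; rewrite inE => /Ba; rewrite lee_fin.
exact: spm_cst.
Qed.

(** Expanding the form at x + y and comparing with [sp_form_add] leaves 2 Re (A x, y) = 0, by
    symmetry of A. The same with i x in place of x treats the imaginary part. *)
Lemma sp_form_cross B x y : measurable B -> E B x = x -> E B y = 0 ->
  dom A x -> dom A y -> ip (A x) y = 0.
Proof.
move=> mB Bx By.
have re v : E B v = v -> dom A v -> dom A y -> rip ip (A v) y = 0.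
  move=> Bv Av Ay; have := sp_form_add mB Bv By Av Ay.
  rewrite (opD linA)// /rip !(ipDl, ipDr) !ReD.
  have -> : complex.Re (ip (A y) v) = complex.Re (ip (A v) y).
    by rewrite ipC (sa_sym saA Av Ay) ReJ.
  by lra.
move=> Ax Ay; apply/eqP; rewrite eq_complex; apply/andP; split; apply/eqP.
  exact: re.
have := re ('i%C *: x); rewrite spZ// Bx (opZ linA)// /rip ipZl mulrC ReiNIm => h.
by apply/eqP; rewrite -oppr_eq0 h//; exact: domZ.
Qed.

(** Tested on the dense domain of A, [sp_form_cross] shows that A E(B) u has no component in the
    range of E(~B), and A E(~B) u none in the range of E(B). *)
Lemma sp_commute B u : measurable B -> dom A u -> A (E B u) = E B (A u).
Proof.
move=> mB Au; have mC := measurableC mB.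
have Ax := sp_dom mB Au; have Ay := sp_dom mC Au.
have CB v : E (~` B) (E B v) = 0 by apply: sp_disjoint => //; rewrite setICl.
have BC v : E B (E (~` B) v) = 0 by apply: sp_disjoint => //; rewrite setICr.
have h1 : E (~` B) (A (E B u)) = 0.
  apply: (dense_orth0 hil saA.1) => v Av; rewrite (sm_sym spE)//.
  by apply: (@sp_form_cross B) => //; [exact: (sm_idem spE)|exact: sp_dom].
have h2 : E B (A (E (~` B) u)) = 0.
  apply: (dense_orth0 hil saA.1) => v Av; rewrite (sm_sym spE)//.
  rewrite (sa_sym saA)//; last exact: sp_dom.
  apply: ip_eq0C; apply: (@sp_form_cross B) => //; [exact: (sm_idem spE)|exact: sp_dom].
rewrite [in RHS](sp_setC u mB) (opD linA)// spD// h2 addr0.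
by rewrite [LHS](sp_setC _ mB) h1 addr0.
Qed.

Lemma sp_shift B z u : measurable B -> dom A u -> opshift A z (E B u) = E B (opshift A z u).
Proof. by move=> mB Au; rewrite /opshift sp_commute// spB// spZ. Qed.

Lemma sp_res B z u : measurable B -> resolvent_set A z -> res A z (E B u) = E B (res A z u).
Proof.
move=> mB rz; have Av := res_dom u rz; apply: res_eq => //; first exact: sp_dom.
by rewrite sp_shift// shift_res.
Qed.

Lemma sp_local B (s e : R) x : measurable B -> 0 < e ->
  (forall t, B t -> s - e <= t <= s + e) -> E B x = x ->
  dom A x /\ nrm (opshift A s%:C x) <= e * nrm x.
Proof.
move=> mB e0 Bse Bx.
have Bd w : E B w = w -> dom A w.
  move=> <-; apply: (@sp_dom_bounded B (`|s| + e)) => // t /Bse /andP[h1 h2].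
  have := ler_norm s; have := ler_norm (- s); rewrite normrN => h3 h4.
  by rewrite ler_norml; apply/andP; split; lra.
have Ax := Bd x Bx; split => //; set y := opshift A s%:C x.
have By : E B y = y by rewrite -sp_shift// Bx.
have F w : E B w = w -> `|rip ip (opshift A s%:C w) w| <= e * nrm w ^+ 2.
  move=> Bw; have Aw := Bd w Bw.
  have h1 := sp_form_ge (a := s - e) mB (fun t Bt => (andP (Bse t Bt)).1) Bw Aw.
  have h2 := sp_form_le (a := s + e) mB (fun t Bt => (andP (Bse t Bt)).2) Bw Aw.
  have -> : rip ip (opshift A s%:C w) w = rip ip (A w) w - s * nrm w ^+ 2.
    by rewrite /rip /opshift ipBl ipZl (ip_nrm hil) -rmorphM/= ReD ReN.
  by rewrite ler_norml; apply/andP; split; lra.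
(* Polarization: the bound F on the quadratic form, applied to x + y / e and x - y / e,
   gives the bound on the operator. *)
pose y' := e^-1%:C *: y.
have By' : E B y' = y' by rewrite spZ// By.
have Ay' := Bd y' By'.
have sym : rip ip (opshift A s%:C y') x = e^-1 * nrm y ^+ 2.
  rewrite /rip; have -> : ip (opshift A s%:C y') x = ip y' y.
    rewrite /opshift ipBl ipZl (sa_sym saA)// /y /opshift ipBr ipZr.
    by rewrite conj_real.
  by rewrite /y' ipZl (ip_nrm hil) -rmorphM.
have sym2 : rip ip y y' = e^-1 * nrm y ^+ 2.
  by rewrite /rip ipC ReJ /y' ipZl (ip_nrm hil) -rmorphM.
have := F (x + y'); rewrite spD// Bx By' => /(_ erefl).
have := F (x - y'); rewrite spB// Bx By' => /(_ erefl).
rewrite (shiftB linA)// (shiftD linA)// -/y !ler_norml => /andP[g1 _] /andP[_ g2].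
(* By the parallelogram law the right side is 2 e |x|^2 + 2 |y|^2 / e; the weight 1 / e in y' lets
   half of the left side absorb the second term, leaving |y|^2 / e <= e |x|^2. *)
have {g1 g2} : 4 * (e^-1 * nrm y ^+ 2) <= e * (nrm (x + y') ^+ 2 + nrm (x - y') ^+ 2).
  have E1 : rip ip (y - opshift A s%:C y') (x - y') = rip ip y x - rip ip y y'
      - rip ip (opshift A s%:C y') x + rip ip (opshift A s%:C y') y'.
    by rewrite /rip !(ipBl, ipBr) !(ReD, ReN); ring.
  have E2 : rip ip (y + opshift A s%:C y') (x + y') = rip ip y x + rip ip y y'
      + rip ip (opshift A s%:C y') x + rip ip (opshift A s%:C y') y'.
    by rewrite /rip !(ipDl, ipDr) !ReD; ring.
  by move: g1 g2; rewrite E1 E2 sym sym2; move: (e^-1) => e'; lra.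
have e'0 : 0 < e^-1 by rewrite invr_gt0.
have ny' : nrm y' ^+ 2 = e^-1 ^+ 2 * nrm y ^+ 2.
  by rewrite nrmZ nrm_real gtr0_norm// exprMn.
rewrite (parallelogram hil) ny'.
rewrite -(@ler_pXn2r _ 2 isT (nrm y))// ?nnegrE ?mulr_ge0 ?nrm_ge0 ?(ltW e0)//.
have : e * e^-1 = 1 by rewrite mulfV// gt_eqF.
move: (e^-1) (nrm y) (nrm x) => e' n m ee'.
have -> : e * (2 * (m ^+ 2 + e' ^+ 2 * n ^+ 2)) = 2 * e * m ^+ 2 + 2 * e' * n ^+ 2 by ring: ee'.
move=> h; have : e' * n ^+ 2 <= e * m ^+ 2 by lra.
move=> h2; have := ler_wpM2l (ltW e0) h2; rewrite mulrA ee' mul1r => /le_trans; apply.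
by rewrite exprMn mulrA -expr2.
Qed.

(** Split y = p + m into its parts above and below the gap and test (A - c) y against p - m: both
    parts then contribute positively, the cross terms vanish, and |p - m| = |y|. *)
Lemma sp_gap (c r : R) y : 0 < r -> dom A y -> E `]c - r, c + r[%classic y = 0 ->
  r * nrm y <= nrm (opshift A c%:C y).
Proof.
move=> r0 Ay Iy.
have mp : measurable `[c + r, +oo[%classic by exact: measurable_itv.
have mm : measurable `]-oo, c - r]%classic by exact: measurable_itv.
have mi : measurable `]c - r, c + r[%classic by exact: measurable_itv.
set p := E `[c + r, +oo[%classic y; set m := E `]-oo, c - r]%classic y.
have pm0 : `[c + r, +oo[%classic `&` `]-oo, c - r]%classic = set0.
  by apply/seteqP; split => t //=; rewrite !in_itv/= andbT => -[h1 h2]; lra.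
have ypm : y = p + m.
  rewrite {1}(sp_setC y mi) Iy add0r /p /m -sp_additive//; congr (E _ y).
  apply/seteqP; split => t /=; rewrite !in_itv/= andbT.
    by move/negP; rewrite negb_and -!leNgt => /orP[?|?]; [right|left].
  by case=> h; apply/negP; rewrite negb_and -!leNgt h ?orbT.
have pp : E `[c + r, +oo[%classic p = p by exact: (sm_idem spE).
have mm' : E `]-oo, c - r]%classic m = m by exact: (sm_idem spE).
have Ap : dom A p by exact: sp_dom.
have Am : dom A m by exact: sp_dom.
have pm : E `[c + r, +oo[%classic m = 0 by exact: sp_disjoint.
have c1 : ip p m = 0 by rewrite -pp (sm_sym spE)// pm ip0r.
have c2 : ip (opshift A c%:C p) m = 0.
  by rewrite -pp sp_shift// (sm_sym spE)// pm ip0r.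
have c3 : ip (opshift A c%:C m) p = 0.
  apply: ip_eq0C; rewrite -pp (sm_sym spE)// -sp_shift// pm.
  by rewrite /opshift (op0 linA) scaler0 subr0 ip0r.
have F w : rip ip (opshift A c%:C w) w = rip ip (A w) w - c * nrm w ^+ 2.
  by rewrite /rip /opshift ipBl ipZl (ip_nrm hil) -rmorphM/= ReD ReN.
have hp : r * nrm p ^+ 2 <= rip ip (opshift A c%:C p) p.
  have := sp_form_ge (a := c + r) mp _ pp Ap; rewrite F => h.
  by have := h (fun t => _); rewrite /= => /(_ ltac:(by move=> t; rewrite in_itv/= andbT)); lra.
have hm : r * nrm m ^+ 2 <= - rip ip (opshift A c%:C m) m.
  have := sp_form_le (a := c - r) mm _ mm' Am; rewrite F => h.
  by have := h (fun t => _); rewrite /= => /(_ ltac:(by move=> t; rewrite in_itv)); lra.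
have ny : nrm y ^+ 2 = nrm p ^+ 2 + nrm m ^+ 2 by rewrite ypm (pythagoras hil).
have nd : nrm (p - m) = nrm y.
  apply/eqP; rewrite -(@eqrXn2 _ 2)// ?nrm_ge0// ny (nrmB_sq hil) /rip c1 mul0rn subr0.
  by [].
have [->|y0] := eqVneq y 0; first by rewrite nrm0 mulr0 nrm_ge0.
have n0 : 0 < nrm y by rewrite nrm_gt0.
rewrite -(ler_pM2r n0) -mulrA -expr2 -{2}nd.
apply: le_trans (cauchy_schwarz hil _ _); apply: le_trans (ler_Re_nrm _).
apply: le_trans (ler_norm _); rewrite ny mulrDr [in leRHS]ypm (shiftD linA)//.
rewrite ipDl !ipBr c2 c3 subr0 sub0r ReD ReN.
exact: lerD.
Qed.

Lemma sp_eigen_itv (l r : R) u : 0 < r -> op_eigenspace A l%:C u ->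
  E `]l - r, l + r[%classic u = u.
Proof.
move=> r0 [Au ul]; set I := `]l - r, l + r[%classic; have mI : measurable I by exact: measurable_itv.
set y := u - E I u; have Ay : dom A y by apply: domB => //; exact: sp_dom.
have Iy : E I y = 0 by rewrite spB// (sm_idem spE)// subrr.
have := sp_gap r0 Ay Iy; rewrite (shiftB linA)//; last exact: sp_dom.
rewrite sp_shift// /opshift ul subrr sp0// subrr nrm0 pmulr_rle0// => h.
by apply/esym/eqP; rewrite -subr_eq0 -nrm_eq0 eq_le h nrm_ge0.
Qed.

(** An eigenvector is fixed by E of every interval around l, hence killed by the complements, which
    exhaust the complement of {l}. Conversely [sp_local] on {l} holds with every e > 0 and forces (A
    - l) u = 0. *)
Lemma sp_eigenP (l : R) u : op_eigenspace A l%:C u <-> E [set l] u = u.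
Proof.
split=> [ue|lu].
  have mF n : measurable (~` `]l - invS n, l + invS n[%classic).
    by apply: measurableC; exact: measurable_itv.
  rewrite [in RHS](sp_setC u (measurable_set1 l)).
  suff -> : E (~` [set l]) u = 0 by rewrite addr0.
  have -> : ~` [set l] = \bigcup_n ~` `]l - invS n, l + invS n[%classic.
    apply/seteqP; split => t /=.
      move=> tl; have tl0 : 0 < `|t - l| by rewrite normr_gt0 subr_eq0; exact/eqP.
      have [N hN] := invS_lt tl0; exists N => //=; rewrite in_itv/=.
      rewrite -ltr_distl => h; have := lt_trans h (hN _ (leqnn N)).
      by rewrite ltxx.
    move=> [n _] /= + tl; apply; rewrite tl in_itv/=; have := @invS_gt0 R n.
    by move=> h; apply/andP; split; lra.
  apply: sp_bigcup0 => // n; have := sp_setC u (measurable_itv `]l - invS n, l + invS n[).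
  rewrite (sp_eigen_itv (invS_gt0 n) ue) => /eqP.
  by rewrite -subr_eq0 opprD addNKr oppr_eq0 => /eqP.
have h e : 0 < e -> dom A u /\ nrm (opshift A l%:C u) <= e * nrm u.
  move=> e0; apply: (@sp_local [set l]) => //.
  by move=> t ->; apply/andP; split; lra.
have [Au _] := h 1 ltr01; split => //; apply/eqP; rewrite -subr_eq0 -nrm_eq0.
rewrite eq_le nrm_ge0 andbT; apply/ler_addgt0Pl => e e0; rewrite addr0.
have n1 : 0 < nrm u + 1 by rewrite ltr_wpDl ?nrm_ge0.
have [_ /le_trans] := h _ (divr_gt0 e0 n1); apply.
by rewrite mulrAC ler_pdivrMr// ler_wpM2l ?(ltW e0)// lerDl.
Qed.

Lemma sp_eigen_sub (l : R) B u : measurable B -> B l -> op_eigenspace A l%:C u -> E B u = u.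
Proof. by move=> mB Bl /sp_eigenP; apply: sp_sub_id => // _ ->. Qed.

(** With v = R(z) x one has E(B) x = (A - s) E(B) v + (s - z) E(B) v, and each term has norm at most
    eta |v|. *)
Lemma sp_res_bound B (s eta : R) x : measurable B -> 0 < eta ->
  (forall t, B t -> s - eta <= t <= s + eta) ->
  nrm (E B x) <= 2 * eta * nrm (res A (s +i* eta) x).
Proof.
move=> mB e0 Bse; set z := s +i* eta; have z0 : complex.Im z != 0 by rewrite gt_eqF.
have rz := nonreal_resolvent hil linA saA z0.
have [Av vx] := res_spec x rz; set v := res A z x in Av vx *.
have [Aw hw] := sp_local mB e0 Bse (sm_idem spE v mB).
rewrite -vx -sp_shift// (shift_shift A z s%:C).
rewrite (le_trans (ler_nrmD _ _))// nrmZ.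
have -> : nrm (s%:C - z) = eta.
  have -> : s%:C - z = - (0 +i* eta) :> C.
    by apply/eqP; rewrite eq_complex/= subrr oppr0 sub0r !eqxx.
  by rewrite nrmN /nrm normc_def/= expr0n/= add0r sqrtr_sqr gtr0_norm.
have h := sp_contract v mB; have : eta * nrm (E B v) <= eta * nrm v by rewrite ler_wpM2l// ltW.
by move: hw; lra.
Qed.

(* Stone-type criterion: the squared norm of E ]-oo, t] x has derivative 0
   wherever the imaginary part of (R(t + i eta) x, x) tends to 0. *)
Lemma sp_null_itv (a b : R) x :
  (forall s, a < s < b -> forall e : R, 0 < e -> exists2 d : R, 0 < d &
     forall eta, 0 < eta < d -> eta * nrm (res A (s +i* eta) x) ^+ 2 < e) ->
  E `]a, b[%classic x = 0.
Proof.
move=> hx; pose m t := nrm (E `]-oo, t]%classic x) ^+ 2.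
have mE s t : s <= t -> m t - m s = nrm (E `]s, t]%classic x) ^+ 2.
  move=> st; rewrite /m; have -> : `]-oo, t]%classic = `]-oo, s]%classic `|` `]s, t]%classic.
    apply/seteqP; split => y /=; rewrite !in_itv/=.
      by move=> yt; have [ys|sy] := leP y s; [left|right].
    by case=> [/le_trans|/andP[]]//; exact.
  have dj : `]-oo, s]%classic `&` `]s, t]%classic = set0.
    by apply/seteqP; split => y //=; rewrite !in_itv/= => -[h /andP[h' _]]; lra.
  rewrite sp_additive// (pythagoras hil); first by rewrite addrAC subrr add0r.
  by rewrite (sm_sym spE)// sp_disjoint// ip0r.
have dm s : a < s < b -> forall e : R, 0 < e -> exists2 d : R, 0 < d &
    forall t, `|t - s| < d -> `|m t - m s| <= e * `|t - s|.
  (* Below, eta is taken to be |t - s|, so that the interval between s and t lies within eta of s.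
     The 4 compensates the square of the factor 2 in [sp_res_bound]. *)
  move=> sab e e0; have [|d d0 hd] := hx s sab (e / 4); first by lra.
  exists d => // t td; have [->|ts] := eqVneq t s; first by rewrite !subrr normr0 mulr0.
  have eta0 : 0 < `|t - s| by rewrite normr_gt0 subr_eq0.
  have := hd `|t - s|; rewrite eta0 td => /(_ isT) h.
  have bound B : measurable B -> (forall y : R, B y -> s - `|t - s| <= y <= s + `|t - s|) ->
      nrm (E B x) ^+ 2 <= e * `|t - s|.
    move=> mB hB; have := sp_res_bound x mB eta0 hB.
    rewrite -(@ler_pXn2r _ 2)// ?nnegrE ?mulr_ge0 ?nrm_ge0// => /le_trans; apply.
    move: h; move: (nrm (res _ _ _)) => n; move: (`|t - s|) eta0 => eta eta0 h.
    rewrite (_ : _ ^+ 2 = eta * (4 * (eta * n ^+ 2))); last by ring.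
    by rewrite mulrC ler_wpM2r ?(ltW eta0)//; lra.
  have [st|ts'] := leP s t.
    rewrite mE// ger0_norm ?sqr_ge0//; apply: bound => // y /=.
    by rewrite in_itv/= ger0_norm ?subr_ge0// => /andP[h1 h2]; apply/andP; split; lra.
  rewrite distrC mE ?(ltW ts')// ger0_norm ?sqr_ge0//; apply: bound => // y /=.
  by rewrite in_itv/= ltr0_norm ?subr_lt0// => /andP[h1 h2]; apply/andP; split; lra.
have null c d : a < c -> d < b -> E `]c, d]%classic x = 0.
  move=> ac db; have [dc|cd] := leP d c.
    by rewrite set_itv_ge ?sp_set0// bnd_simp -leNgt.
  have der s : a < s < b -> is_derive s 1 m 0 by move=> /dm; exact: is_derive_0.
  have [s||s0 _] := @MVT R m (cst 0) c d cd.
  - by rewrite in_itv/= => /andP[cs sd]; apply: der; apply/andP; split; lra.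
  - apply: derivable_within_continuous => s; rewrite in_itv/= => /andP[cs sd].
    by have [] := der s ltac:(apply/andP; split; lra).
  rewrite mul0r mE ?(ltW cd)// => /eqP; rewrite sqrf_eq0 nrm_eq0.
  by move/eqP.
have -> : `]a, b[%classic = \bigcup_n `]a + invS n, b - invS n]%classic.
  apply/seteqP; split => t /=; rewrite in_itv/=.
    move=> /andP[at_ tb]; have [|N hN] := @invS_lt R (Num.min (t - a) (b - t)).
      by rewrite lt_min !subr_gt0 at_.
    exists N => //=; rewrite in_itv/=; have := hN N (leqnn N).
    by rewrite lt_min => /andP[h1 h2]; apply/andP; split; lra.
  move=> [n _] /=; rewrite in_itv/= => /andP[h1 h2]; have := @invS_gt0 R n.
  by move=> h; apply/andP; split; lra.
apply: sp_bigcup0 => [n|n]; first exact: measurable_itv.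
by have := @invS_gt0 R n => h; apply: null; lra.
Qed.

Lemma sp_res_gap (c r : R) z y : resolvent_set A z -> 0 < r ->
  E `]c - r, c + r[%classic y = 0 -> (r - nrm (z - c%:C)) * nrm (res A z y) <= nrm y.
Proof.
move=> rz r0 Iy; have [Av vy] := res_spec y rz; set v := res A z y in Av vy *.
have Iv : E `]c - r, c + r[%classic v = 0.
  rewrite /v -sp_res// Iy.
  by apply: res_eq => //; [exact: dom0|rewrite /opshift (op0 linA) scaler0 subr0].
have := sp_gap r0 Av Iv; rewrite (shift_shift A c%:C z) vy => h.
by have := ler_nrmD y ((z - c%:C) *: v); rewrite nrmZ; lra.
Qed.

(** Here c may be an eigenvalue. On the kernel of E(I) the range of A - c is closed by [sp_gap], and
    it is dense there since (A - c) R(c + i eta) y = y + i eta R(c + i eta) y, whose last term tends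
    to 0 as the resolvent stays bounded off the gap. *)
Lemma sp_gap_inverse (c r : R) y : 0 < r -> E `]c - r, c + r[%classic y = 0 ->
  exists x, [/\ dom A x, E `]c - r, c + r[%classic x = 0, opshift A c%:C x = y &
    r * nrm x <= nrm y].
Proof.
move=> r0 Iy; set I := `]c - r, c + r[%classic in Iy *.
have mI : measurable I by exact: measurable_itv.
have I0 x : closure (dom A `&` [set v | E I v = 0]) x -> E I x = 0.
  move=> /closure_nrmP cx; apply/eqP; rewrite -nrm_eq0 eq_le nrm_ge0 andbT.
  apply/ler_addgt0Pl => e /cx[v [_ /= Iv] vx]; rewrite addr0.
  have -> : E I x = - E I (v - x) by rewrite spB// Iv sub0r opprK.
  by rewrite nrmN (le_trans (sp_contract _ mI))// ltW.
have [| |u [Au /= Iu]| |x [Ax cx xy]] := @closed_range _ _ _ hil A linA saA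
  (dom A `&` [set v | E I v = 0]) r c%:C y r0.
- split; first by split; [exact: dom0|exact: sp0].
  move=> k u v [Au /= Iu] [Av /= Iv]; split; first exact: linA.1.2.
  by rewrite /= spD// spZ// Iu Iv scaler0 addr0.
- by move=> u [].
- exact: sp_gap.
- apply/closure_nrmP => e e0; have y1 : 0 < nrm y + 1 by rewrite ltr_wpDl ?nrm_ge0.
  (* The first entry gives r - eta >= r / 2, hence |R y| <= 2 |y| / r; the second then makes eta |R
     y| < e. *)
  pose eta := Num.min (r / 2) (e * r / 2 / (nrm y + 1)).
  have eta0 : 0 < eta by rewrite lt_min !divr_gt0// mulr_gt0.
  pose z : C := c +i* eta; have z0 : complex.Im z != 0 by rewrite gt_eqF.
  have rz := nonreal_resolvent hil linA saA z0.
  have nz : nrm (z - c%:C) = eta.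
    have -> : z - c%:C = 0 +i* eta :> C.
      by apply/eqP; rewrite eq_complex/= subrr subr0 !eqxx.
    by rewrite /nrm normc_def/= expr0n/= add0r sqrtr_sqr gtr0_norm.
  exists (opshift A c%:C (res A z y)).
    exists (res A z y) => //; split; first exact: res_dom.
    rewrite /= -sp_res// Iy.
    by apply: res_eq => //; [exact: dom0|rewrite /opshift (op0 linA) scaler0 subr0].
  rewrite (shift_shift A c%:C z) shift_res// addrC addKr nrmZ nz.
  have := sp_res_gap rz r0 Iy; rewrite nz.
  have : eta <= r / 2 by rewrite ge_min lexx.
  have : eta <= e * r / 2 / (nrm y + 1) by rewrite ge_min lexx orbT.
  rewrite ler_pdivlMr// => h1 h2 h3; have n0 := nrm_ge0 (res A z y).
  rewrite -(ltr_pM2l r0); apply: (@le_lt_trans _ _ (eta * (2 * nrm y))).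
    by rewrite mulrCA ler_wpM2l ?(ltW eta0)//; nra.
  by nra.
have Ix := I0 x cx; exists x; split => //.
by rewrite -xy; exact: sp_gap.
Qed.

Lemma sp_gap_chain (c r : R) x : 0 < r -> E `]c - r, c + r[%classic x = 0 ->
  exists y : nat -> H, y 0%N = x /\ forall n, [/\ dom A (y n.+1),
    E `]c - r, c + r[%classic (y n) = 0, opshift A c%:C (y n.+1) = y n &
    r ^+ n * nrm (y n) <= nrm x].
Proof.
move=> r0 Ix; have /choice[F hF] : forall y, exists y',
    E `]c - r, c + r[%classic y = 0 -> [/\ dom A y', E `]c - r, c + r[%classic y' = 0,
      opshift A c%:C y' = y & r * nrm y' <= nrm y].
  move=> y; have [Iy|Iy] := pselect (E `]c - r, c + r[%classic y = 0).
    by have [y' hy'] := sp_gap_inverse r0 Iy; exists y'.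
  (* A default value making F total; the iterates of x never leave the kernel of E(I). *)
  by exists y.
exists (fun n => iter n F x); split=> // n.
have [Iy ny] : E `]c - r, c + r[%classic (iter n F x) = 0 /\
    r ^+ n * nrm (iter n F x) <= nrm x.
  elim: n => [|n [Iy ny]] /=; first by rewrite expr0 mul1r.
  have [_ Iy' _ ny'] := hF _ Iy; split => //.
  rewrite exprSr -mulrA; apply: le_trans ny.
  by rewrite ler_wpM2l// exprn_ge0// ltW.
by have [Ay _ yy _] := hF _ Iy.
Qed.

Lemma sp_gap_resolvent (c r : R) : 0 < r -> (forall x, E `]c - r, c + r[%classic x = 0) ->
  resolvent_set A c%:C.
Proof.
move=> r0 hI; split; last first.
  exists r^-1 => u Au; rewrite !nrmE -rmorphM/= lecR mulrC ler_pdivlMr// mulrC.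
  exact: sp_gap.
split=> // [u v|y _].
  rewrite !inE => Au Av uv; apply/eqP; rewrite -subr_eq0 -nrm_eq0.
  have := sp_gap r0 (domB linA Au Av) (hI _); rewrite (shiftB linA)//.
  rewrite /opshift uv subrr nrm0 pmulr_rle0// => h.
  by rewrite eq_le h nrm_ge0.
by have [x [Ax _ xy _]] := sp_gap_inverse r0 (hI y); exists x.
Qed.

End SpectralMeasure.

(** * Dense subspaces of finite-dimensional spaces *)

Section FiniteDimension.
Context {R : realType}.
Local Notation C := R[i].
Context {H : completeNormedModType C} (ip : {dot H for @Num.conj C}).
Hypothesis hil : hilbert ip.
Implicit Types (x v w : H).

Lemma subspace_sum (V : set H) (I : Type) (s : seq I) (P : pred I) (F : I -> H) :
  subspace_closed V -> (forall i, V (F i)) -> V (\sum_(i <- s | P i) F i).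
Proof.
move=> hV hF; elim/big_ind : _ => //; first exact: hV.1.
by move=> ? ?; exact: subspaceD.
Qed.

Lemma lspan_range n (e : 'I_n -> H) x : lspan (range e) x ->
  exists a : 'I_n -> C, x = \sum_(k < n) a k *: e k.
Proof.
move=> [m [c [v [hv ->]]]].
have /choice[s hs] : forall i, exists k, e k = v i by move=> i; have [k _ kv] := hv i; exists k.
exists (fun k => \sum_(i < m | s i == k) c i).
rewrite (partition_big s xpredT)//=; apply: eq_bigr => k _.
by rewrite scaler_suml; apply: eq_bigr => i /eqP <-; rewrite hs.
Qed.

Definition ortho_family (L : set H) m (f : 'I_m -> H) :=
  (forall i, L (f i)) /\ forall i j, ip (f i) (f j) = (i == j)%:R.

Lemma ip_suml I (s : seq I) (P : pred I) (F : I -> H) v :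
  ip (\sum_(i <- s | P i) F i) v = \sum_(i <- s | P i) ip (F i) v.
Proof. by elim/big_rec2 : _ => [|i a b _ <-]; rewrite ?ip0l ?ipDl. Qed.

(** The Gram matrix of f is the identity of size m and factors through n coordinates, so the rank
    gives m <= n. *)
Lemma ortho_family_size n (e : 'I_n -> H) m (f : 'I_m -> H) :
  ortho_family (lspan (range e)) f -> (m <= n)%N.
Proof.
move=> [fK ff]; have /choice[a ha] := fun i => lspan_range (fK i).
pose A : 'M[C]_(m, n) := \matrix_(i, k) a i k.
pose B : 'M[C]_(n, m) := \matrix_(k, j) ip (e k) (f j).
have AB : A *m B = 1%:M.
  apply/matrixP => i j; rewrite !mxE -ff [in RHS](ha i) ip_suml.
  by apply: eq_bigr => k _; rewrite !mxE ipZl.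
rewrite -(mxrank1 C m) -AB (leq_trans (mxrankM_maxl _ _))//.
exact: rank_leq_col.
Qed.

Lemma ip_proj m (f : 'I_m -> H) L x j : ortho_family L f ->
  ip (x - \sum_(i < m) ip x (f i) *: f i) (f j) = 0.
Proof.
move=> [_ ff]; rewrite ipBl ip_suml (bigD1 j)//= ipZl ff eqxx mulr1 big1 ?addr0 ?subrr//.
by move=> i /negPf ij; rewrite ipZl ff ij mulr0.
Qed.

(** A largest orthonormal family in L spans L, so the finite sum [pr] maps K into L with x - pr x
    orthogonal to L, and hence x = pr x. *)
Lemma finite_dimensional_dense (K L : set H) : finite_dimensional K ->
  subspace_closed K -> subspace_closed L -> L `<=` K ->
  (forall x, K x -> (forall v, L v -> ip x v = 0) -> x = 0) -> K `<=` L.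
Proof.
move=> [n [e Ke]] hK hL LK dL.
pose P m := exists f : 'I_m -> H, ortho_family L f.
(* A largest size exists because the empty family is orthonormal while size n + 1 is impossible. *)
have [m [[f fL] nP]] : exists m, P m /\ ~ P m.+1.
  apply: contrapT => h; have : P n.+1.
    have PS k : P k -> P k.+1.
      by move=> Pk; apply: contrapT => nPk; apply: h; exists k.
    elim: n.+1 => [|k ih]; last exact: PS.
    by exists (fun=> 0); split => [[]|[]].
  move=> [f [fL ff]].
  suff : (n.+1 <= n)%N by rewrite ltnn.
  by apply: (@ortho_family_size n e n.+1 f); split => // i; rewrite -Ke; exact/LK/fL.
pose pr x := \sum_(i < m) ip x (f i) *: f i.
have Lpr x : L (pr x).
  by apply: subspace_sum => // i; apply: subspaceZ => //; exact: fL.1.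
have Lid v : L v -> v = pr v.
  move=> Lv; apply: contrapT => /eqP; rewrite -subr_eq0 => w0; apply: nP.
  set w := v - pr v in w0; have nw : 0 < nrm w by rewrite nrm_gt0.
  pose w' := (nrm w)^-1%:C *: w.
  have wf j : ip w' (f j) = 0 by rewrite ipZl (ip_proj _ _ fL) mulr0.
  have w1 : ip w' w' = 1.
    by rewrite (ip_nrm hil) nrmZ nrm_real ger0_norm ?invr_ge0 ?nrm_ge0//
      mulVf ?gt_eqF// expr1n.
  exists (fun i => if unlift ord_max i is Some j then f j else w'); split=> [i|i j].
    case: unliftP => [j _|_]; first exact: fL.1.
    by apply: subspaceZ => //; exact: subspaceB.
  case: unliftP => [i' ->|->]; case: unliftP => [j' ->|->].
  - by rewrite fL.2 (inj_eq lift_inj).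
  - by rewrite (ip_eq0C (wf _)) eq_sym (negPf (neq_lift _ _)).
  - by rewrite wf (negPf (neq_lift _ _)).
  - by rewrite w1 eqxx.
move=> x Kx; have := dL (x - pr x) (subspaceB hK Kx (LK _ (Lpr x))).
move=> h; rewrite (_ : x = pr x)//; apply/eqP; rewrite -subr_eq0; apply/eqP/h.
move=> v /Lid ->; apply: ip_eq0C; rewrite ip_suml big1// => i _.
by rewrite ipZl (ip_eq0C (ip_proj _ _ fL)) mulr0.
Qed.
End FiniteDimension.

(** * Contour integrals *)

Section CircleIntegral.
Context {R : realType}.
Local Notation C := R[i].

Lemma mvt_le (phi psi : R -> R) (x y : R) :
  (forall u : R, is_derive u 1 phi (psi u)) -> x <= y ->
  exists2 c, x <= c <= y & phi y - phi x = psi c * (y - x).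
Proof.
move=> d xy; have [|c] := @MVT_segment R phi psi x y xy (fun u _ => d u).
  apply: derivable_within_continuous => s _; by have [] := d s.
by rewrite in_itv/=; exists c.
Qed.

Lemma lipschitz_of_deriv (phi psi : R -> R) (K : R) :
  (forall u : R, is_derive u 1 phi (psi u)) -> (forall u, `|psi u| <= K) ->
  forall x y, `|phi x - phi y| <= K * `|x - y|.
Proof.
move=> d hK; have h x y : x <= y -> `|phi x - phi y| <= K * `|x - y|.
  move=> xy; have [c _ e] := mvt_le d xy.
  by rewrite distrC e normrM (distrC y) ler_wpM2r.
move=> x y; have [xy|/ltW yx] := leP x y; first exact: h.
by rewrite distrC (distrC x) h.
Qed.

Lemma partition_telescope (V : zmodType) (a b : R) (s : seq R) (F : R -> V) :
  itv_partition a b s ->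
  \sum_(i < size s) (F (nth b (a :: s) i.+1) - F (nth b (a :: s) i)) = F b - F a.
Proof.
move=> [_ /eqP sb].
rewrite -(big_mkord xpredT (fun i => F (nth b (a :: s) i.+1) - F (nth b (a :: s) i))).
rewrite telescope_sumr//=; congr (F _ - _).
by rewrite -[size s]/(size (a :: s)).-1 nth_last.
Qed.

(** On each subinterval the increment of phi is its length times psi at a mean value point, at
    distance at most delta from the tag; the Lipschitz bound on psi compares the two. *)
Lemma riemann_sum_deriv (phi psi : R -> R) (K delta a b : R) (s : seq R) (t : nat -> R) :
  (forall u : R, is_derive u 1 phi (psi u)) ->
  (forall x y, `|psi x - psi y| <= K * `|x - y|) -> 0 <= K ->
  itv_partition a b s ->
  (forall i, (i < size s)%N ->
     [/\ nth b (a :: s) i <= t i, t i <= nth b (a :: s) i.+1 &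
         nth b (a :: s) i.+1 - nth b (a :: s) i < delta]) ->
  `|\sum_(i < size s) (nth b (a :: s) i.+1 - nth b (a :: s) i) * psi (t i)
    - (phi b - phi a)| <= K * delta * (b - a).
Proof.
move=> d hK K0 ps ht; rewrite -(partition_telescope phi ps) -sumrB.
apply: le_trans (ler_norm_sum _ _ _) _.
rewrite -(partition_telescope id ps) mulr_sumr; apply: ler_sum => -[i /= hi] _.
have [h1 h2 h3] := ht i hi; move: h1 h2 h3.
rewrite /=; move: (nth b (a :: s) i) (nth b s i) => x y h1 h2 h3.
have xy : x <= y by lra.
have [c /andP[c1 c2] ->] := mvt_le d xy.
have y0 : 0 <= y - x by lra.
rewrite mulrC -mulrBl normrM (ger0_norm y0) ler_wpM2r//.
apply: le_trans (hK _ _) _; rewrite ler_wpM2l// ler_norml.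
by apply/andP; split; lra.
Qed.

Lemma exp_circle_pow (k : nat) (x : R) :
  (cos x +i* sin x : C) ^+ k = cos (k%:R * x) +i* sin (k%:R * x).
Proof.
elim: k => [|k ih]; first by rewrite expr0 mul0r cos0 sin0.
rewrite exprS ih -addn1 natrD mulrDl mul1r addrC cosD sinD.
by apply/eqP; rewrite eq_complex/=; apply/andP; split; apply/eqP; ring.
Qed.

Lemma nrm_exp_circle (x : R) : nrm (cos x +i* sin x : C) = 1.
Proof. by rewrite /nrm normc_def/= cos2Dsin2 sqrtr1. Qed.

(** The primitives sin (k x) / k and - cos (k x) / k agree at 0 and 2 pi, so only the Riemann error
    remains. The integrands have Lipschitz constant k, which costs 2 pi k delta for each of the real
    and imaginary parts. *)
Lemma riemann_sum_exp (k : nat) (delta : R) (s : seq R) (t : nat -> R) :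
  (0 < k)%N -> itv_partition 0 (2 * pi) s ->
  (forall i, (i < size s)%N ->
     [/\ nth (2 * pi) (0 :: s) i <= t i, t i <= nth (2 * pi) (0 :: s) i.+1 &
         nth (2 * pi) (0 :: s) i.+1 - nth (2 * pi) (0 :: s) i < delta]) ->
  nrm (\sum_(i < size s) (nth (2 * pi) (0 :: s) i.+1 - nth (2 * pi) (0 :: s) i)%:C *
    (cos (t i) +i* sin (t i) : C) ^+ k) <= 4 * pi * k%:R * delta.
Proof.
move=> k0 ps ht; have kR : 0 < k%:R :> R by rewrite ltr0n.
have dm (u : R) : is_derive u 1 (fun x => k%:R * x) k%:R.
  have h : is_derive u 1 (k%:R *: (id : R -> R)) (k%:R *: (1 : R)) by exact: is_deriveZ.
  by move: h; rewrite /GRing.scale/= mulr1.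
have dsin (u : R) : is_derive u 1 (fun x => sin (k%:R * x)) (k%:R * cos (k%:R * u)).
  by have := is_derive1_comp (is_derive_sin (k%:R * u)) (dm u); rewrite mulrC.
have dcos (u : R) : is_derive u 1 (fun x => cos (k%:R * x)) (- (k%:R * sin (k%:R * u))).
  by have := is_derive1_comp (is_derive_cos (k%:R * u)) (dm u); rewrite mulNr mulrC.
have dS (u : R) : is_derive u 1 (fun x => k%:R^-1 * sin (k%:R * x)) (cos (k%:R * u)).
  have := @is_deriveZ _ _ _ _ (k%:R^-1) _ _ _ (dsin u); rewrite /GRing.scale/= mulrA mulVf ?gt_eqF// mul1r.
  by [].
have dC (u : R) : is_derive u 1 (fun x => - k%:R^-1 * cos (k%:R * x)) (sin (k%:R * u)).
  have := @is_deriveZ _ _ _ _ (- k%:R^-1) _ _ _ (dcos u).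
  by rewrite /GRing.scale/= mulrNN mulrA mulVf ?gt_eqF// mul1r.
have lc := lipschitz_of_deriv dcos (K := k%:R).
have ls := lipschitz_of_deriv dsin (K := k%:R).
have k2pi : cos (k%:R * (2 * pi)) = 1 :> R /\ sin (k%:R * (2 * pi)) = 0 :> R.
  elim: k {k0 kR dm dsin dcos dS dC lc ls} => [|k [ih1 ih2]]; first by rewrite mul0r cos0 sin0.
  rewrite -addn1 natrD mulrDl mul1r cosD sinD ih1 ih2.
  by rewrite (_ : 2 * pi = pi *+ 2) ?cos2pi ?sin2pi ?mulr_natl//; split; ring.
have h1 := riemann_sum_deriv dS _ (ltW kR) ps ht.
have h2 := riemann_sum_deriv dC _ (ltW kR) ps ht.
have {}h1 : `|\sum_(i < size s) (nth (2 * pi) (0 :: s) i.+1 - nth (2 * pi) (0 :: s) i)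
    * cos (k%:R * t i)| <= k%:R * delta * (2 * pi).
  move: h1; rewrite k2pi.2 [k%:R * 0]mulr0 sin0 !mulr0 !subr0; apply=> x y; apply: lc => u.
  by rewrite normrN normrM gtr0_norm// ler_piMr ?(ltW kR)// ler_norml sin_geN1 sin_le1.
have {}h2 : `|\sum_(i < size s) (nth (2 * pi) (0 :: s) i.+1 - nth (2 * pi) (0 :: s) i)
    * sin (k%:R * t i)| <= k%:R * delta * (2 * pi).
  move: h2; rewrite k2pi.1 [k%:R * 0]mulr0 cos0 subrr !subr0; apply=> x y; apply: ls => u.
  by rewrite normrM gtr0_norm// ler_piMr ?(ltW kR)// ler_norml cos_geN1 cos_le1.
apply: le_trans (ler_nrm_ReIm _) _.
have ReS (F : nat -> C) n : complex.Re (\sum_(i < n) F i) = \sum_(i < n) complex.Re (F i).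
  by elim/big_rec2 : _ => // i a b _ <-; rewrite ReD.
have ImS (F : nat -> C) n : complex.Im (\sum_(i < n) F i) = \sum_(i < n) complex.Im (F i).
  by elim/big_rec2 : _ => // i a b _ <-; rewrite ImD.
rewrite (ReS (fun i => (nth (2 * pi) (0 :: s) i.+1 - nth (2 * pi) (0 :: s) i)%:C *
    (cos (t i) +i* sin (t i) : C) ^+ k)).
rewrite (ImS (fun i => (nth (2 * pi) (0 :: s) i.+1 - nth (2 * pi) (0 :: s) i)%:C *
    (cos (t i) +i* sin (t i) : C) ^+ k)).
rewrite (eq_bigr (fun i : 'I__ => (nth (2 * pi) (0 :: s) i.+1 - nth (2 * pi) (0 :: s) i)
    * cos (k%:R * t i))); last by move=> i _; rewrite exp_circle_pow ReM mul0r subr0.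
rewrite [X in _ + `|X|](eq_bigr (fun i : 'I__ => (nth (2 * pi) (0 :: s) i.+1 -
  nth (2 * pi) (0 :: s) i) * sin (k%:R * t i))); last first.
  by move=> i _; rewrite exp_circle_pow ImM mul0r addr0.
by lra.
Qed.

(** On the circle f dz is i (zeta f) d theta. In the Riemann sums the constant a yields 2 pi i a,
    positive powers of zeta vanish with the mesh, and the remainder is uniformly small; a uniform
    approximation of zeta f on the circle therefore suffices. *)
Lemma circle_integral_of_expansion {G : completeNormedModType C} (z0 : C) (r : R)
    (f : C -> G) (a : G) : 0 < r ->
  (forall e : R, 0 < e -> exists (n : nat) (c : nat -> G), forall zeta : C, nrm zeta = r ->
     nrm (zeta *: f (z0 + zeta) - a - \sum_(k < n) zeta ^+ k.+1 *: c k) <= e) ->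
  is_circle_integral z0 r f ((2 * pi%:C * 'i%C) *: a).
Proof.
move=> r0 hf ex eps eps0; have pi0 : 0 < pi :> R := pi_gt0 R.
(* Half of eps pays for the remainder over the length 2 pi; the other half pays for the n powers,
   whose Riemann sums are at most K times the mesh. *)
have [|n [c hc]] := hf (eps / 2 / (2 * pi)); first by rewrite !divr_gt0// mulr_gt0.
pose K := \sum_(k < n) 4 * pi * k.+1%:R * r ^+ k.+1 * nrm (c k).
have K0 : 0 <= K.
  by apply: sumr_ge0 => k _; rewrite !mulr_ge0 ?nrm_ge0 ?exprn_ge0 ?ltW.
exists (eps / 2 / (K + 1)); first by rewrite !divr_gt0// ltr_wpDl.
set delta := eps / 2 / (K + 1) => s t ps ht.
set D := fun i => (nth (2 * pi) (0 :: s) i.+1 - nth (2 * pi) (0 :: s) i)%:C : C.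
have sD : \sum_(i < size s) D i = (2 * pi)%:C.
  have h (x y : R) : (x - y)%:C = x%:C - y%:C :> C by rewrite rmorphB.
  rewrite /D; under eq_bigr do rewrite h.
  by rewrite (partition_telescope (fun x => x%:C : C) ps) subr0.
pose z i : C := r%:C * ex (t i).
have nz i : nrm (z i) = r by rewrite nrmM nrm_real nrm_exp_circle mulr1 gtr0_norm.
pose rem i := z i *: f (z0 + z i) - a - \sum_(k < n) z i ^+ k.+1 *: c k.
have -> : \sum_(i < size s) D i *: (('i%C * r%:C * ex (t i)) *: f (z0 + r%:C * ex (t i)))
    - (2 * pi%:C * 'i%C) *: a =
    'i%C *: (\sum_(i < size s) D i *: rem i +
             \sum_(k < n) (\sum_(i < size s) D i * z i ^+ k.+1) *: c k).
  have -> : \sum_(k < n) (\sum_(i < size s) D i * z i ^+ k.+1) *: c k =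
      \sum_(i < size s) D i *: (\sum_(k < n) z i ^+ k.+1 *: c k).
    under eq_bigr do rewrite scaler_suml.
    rewrite exchange_big; apply: eq_bigr => i _; rewrite scaler_sumr.
    by apply: eq_bigr => k _; rewrite scalerA.
  rewrite -big_split/= scaler_sumr.
  have -> : (2 * pi%:C * 'i%C) *: a = \sum_(i < size s) 'i%C *: (D i *: a).
    rewrite -scaler_sumr -scaler_suml sD scalerA; congr (_ *: _).
    by rewrite rmorphM/= mulrC (_ : (2 : R)%:C = 2)//; rewrite rmorph_nat.
  rewrite -sumrB; apply: eq_bigr => i _; rewrite /rem /z.
  move: (\sum_(k < n) _) (D i) (f _) => S d F; rewrite -scalerDr subrK.
  by lmod_ring.
rewrite nrmE ltcR nrmZ.
have -> : nrm 'i%C = 1 :> R by rewrite /nrm normc_def/= expr0n/= expr1n add0r sqrtr1.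
rewrite mul1r; apply: le_lt_trans (ler_nrmD _ _) _.
have h1 : nrm (\sum_(i < size s) D i *: rem i) <= eps / 2.
  apply: le_trans (ler_nrm_sum _ _ _) _.
  apply: (@le_trans _ _ (\sum_(i < size s)
      (nth (2 * pi) (0 :: s) i.+1 - nth (2 * pi) (0 :: s) i) * (eps / 2 / (2 * pi)))).
    apply: ler_sum => -[i /= hi] _; have [t1 t2 _] := ht i hi; move: t1 t2 => /= t1 t2.
    have d0 : 0 <= nth (2 * pi) s i - nth (2 * pi) (0 :: s) i by lra.
    by rewrite nrmZ nrm_real (ger0_norm d0) ler_wpM2l// hc.
  rewrite -mulr_suml (partition_telescope id ps) subr0 mulrC divfK// gt_eqF//.
  by rewrite mulr_gt0.
have h2 : nrm (\sum_(k < n) (\sum_(i < size s) D i * z i ^+ k.+1) *: c k) <= K * delta.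
  apply: le_trans (ler_nrm_sum _ _ _) _; rewrite /K mulr_suml; apply: ler_sum => k _.
  rewrite nrmZ mulrAC ler_wpM2r ?nrm_ge0//.
  have -> : \sum_(i < size s) D i * z i ^+ k.+1 =
      r%:C ^+ k.+1 * \sum_(i < size s) D i * ex (t i) ^+ k.+1.
    by rewrite mulr_sumr; apply: eq_bigr => i _; rewrite exprMn mulrCA.
  rewrite nrmM nrmX nrm_real (gtr0_norm r0) [leRHS]mulrAC [leRHS]mulrC.
  rewrite ler_wpM2l ?exprn_ge0 ?(ltW r0)//.
  exact: riemann_sum_exp.
apply: le_lt_trans (lerD h1 h2) _.
have h3 : delta * (K + 1) = eps / 2 by rewrite /delta divfK// gt_eqF// ltr_wpDl.
have h4 : 0 < delta by rewrite !divr_gt0// ltr_wpDl.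
by lra.
Qed.

End CircleIntegral.

(** * Complex differentiability and continuity *)

Section Holomorphy.
Context {R : realType}.
Local Notation C := R[i].
Context {G : completeNormedModType C}.

Lemma derivable_of_quadratic (f : C -> G) (z0 : C) (a0 a1 : G) (c d : R) : 0 < d ->
  (forall z, nrm (z - z0) < d ->
     nrm (f z - a0 - (z - z0) *: a1) <= c * nrm (z - z0) ^+ 2) ->
  derivable (f : C^o -> G) z0 1.
Proof.
move=> d0 hf; have fz0 : f z0 = a0.
  have := hf z0; rewrite subrr nrm0 scale0r subr0 expr0n/= mulr0 => /(_ d0) h.
  by apply/eqP; rewrite -subr_eq0 -nrm_eq0 eq_le h nrm_ge0.
apply/cvg_ex; exists a1; apply/cvg_nrmP => e e0.
have dn (k : R) : 0 < k -> \forall h \near (0 : C^o)^', nrm (h : C) < k.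
  move=> k0; apply: nbhs_dnbhs; apply/(@nbhs_nrmP R C^o); exists k => // y.
  by rewrite subr0.
near=> h; have h0 : (h : C) != 0 by near: h; exact: nbhs_dnbhs_neq.
have hd : nrm (h : C) < d by near: h; exact: dn.
have he : nrm (h : C) < e / (`|c| + 1).
  by near: h; apply: dn; rewrite divr_gt0// ltr_wpDl.
have hn : 0 < nrm (h : C) by rewrite nrm_gt0.
have := hf ((h : C) + z0); rewrite addrK => /(_ hd) hq.
rewrite /= -[_%:A]/((h : C) * 1) mulr1; have -> : (h : C)^-1 *: (f ((h : C) + z0) - f z0) - a1 =
    (h : C)^-1 *: (f ((h : C) + z0) - a0 - (h : C) *: a1).
  by rewrite fz0 [RHS]scalerBr scalerA mulVf// scale1r.
rewrite nrmZ nrmV mulrC ltr_pdivrMr//; apply: le_lt_trans hq _.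
rewrite expr2 mulrA ltr_pM2r//; move: he; rewrite ltr_pdivlMr ?ltr_wpDl// => he.
have := ler_norm c; nra.
Unshelve. all: by end_near.
Qed.

Lemma derivable_continuous (f : C -> G) (z0 : C) : derivable (f : C^o -> G) z0 1 ->
  forall e : R, 0 < e -> exists2 d : R, 0 < d &
    forall z, nrm (z - z0) < d -> nrm (f z - f z0) < e.
Proof.
move=> df e e0; have /cvg_ex[l /cvg_nrmP/(_ 1 ltr01)] := df.
rewrite /dnbhs /within/= => /(@nbhs_nrmP R C^o)[d d0 hd].
have l0 : 0 < nrm l + 1 by rewrite ltr_wpDl ?nrm_ge0.
exists (Num.min d (e / (nrm l + 1))); first by rewrite lt_min d0 divr_gt0.
move=> z; rewrite lt_min ltr_pdivlMr// => /andP[zd ze].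
have [->|zz] := eqVneq z z0; first by rewrite subrr nrm0.
have zn : z - z0 != 0 by rewrite subr_eq0.
have := hd (z - z0); rewrite subr0 => /(_ zd zn).
rewrite -[_%:A]/((z - z0) * 1) mulr1 subrK => hl.
have -> : f z - f z0 = (z - z0) *: ((z - z0)^-1 *: (f z - f z0)).
  by rewrite scalerA mulfV// scale1r.
rewrite nrmZ; apply: le_lt_trans ze; rewrite ler_wpM2l ?nrm_ge0//.
by have := ler_nrmD ((z - z0)^-1 *: (f z - f z0) - l) l; rewrite subrK; lra.
Qed.

Lemma open_setD1 (U : set C^o) (z : C) : open U -> open (U `\ z : set C^o).
Proof.
move=> oU; rewrite openE => w [Uw /eqP wz].
have [/= d d0 hd] := (@nbhs_nrmP R C^o _ _).1 (open_nbhs_nbhs (conj oU Uw)).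
have wz0 : 0 < nrm ((w : C) - z) by rewrite nrm_gt0 subr_eq0.
apply/(@nbhs_nrmP R C^o); exists (Num.min d (nrm ((w : C) - z))); first by rewrite lt_min d0.
move=> v; rewrite lt_min => /andP[/hd Uv vw]; split=> //= vz.
by move: vw; rewrite vz nrm_dist ltxx.
Qed.

(** Nonreal points are dense. This carries estimates proved for M off the real axis to the real
    points where only a continuation of M is available. *)
Lemma continuous_nonreal_bound (F : C^o -> G) (z : C^o) (b d : R) :
  {for z, continuous F} -> 0 < d ->
  (forall w, nrm (w - z) < d -> complex.Im w != 0 -> nrm (F w) <= b) -> nrm (F z) <= b.
Proof.
move=> cF d0 hF; apply/ler_addgt0Pl => e e0.
have /cvg_nrmP/(_ e e0)/(@nbhs_nrmP R C^o)[/= d' d'0 hd'] := cF.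
have [w [wd wd' w0]] : exists w, [/\ nrm (w - z) < d, nrm (w - z) < d' & complex.Im w != 0].
  have m0 : 0 < Num.min d d' / 2 by rewrite divr_gt0// lt_min d0.
  have sub (t : R) : nrm (z + (0 +i* t) - z) = `|t|.
    by rewrite addrC addKr /nrm normc_def/= expr0n/= add0r sqrtr_sqr.
  have lt2 : Num.min d d' / 2 < d /\ Num.min d d' / 2 < d'.
    have : Num.min d d' <= d /\ Num.min d d' <= d' by rewrite !ge_min !lexx orbT.
    by case; move: (Num.min d d') m0 => m *; split; lra.
  have [z0|z0] := eqVneq (complex.Im z) 0; last first.
    by exists z; rewrite subrr nrm0.
  exists (z + (0 +i* (Num.min d d' / 2))); rewrite sub gtr0_norm// ImD z0 add0r/= gt_eqF//.
  by case: lt2.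
have := hd' w wd'; have := hF w wd w0; rewrite -nrm_dist => h1 h2.
by have := ler_nrmD (F z - F w) (F w); rewrite subrK nrm_dist; rewrite nrm_dist in h2; lra.
Qed.

Lemma continuous_shift_scale (f : C^o -> G) (w0 : C) (z : C^o) :
  {for z, continuous f} -> {for z, continuous (fun w : C^o => ((w : C) - w0) *: f w)}.
Proof.
have h : (fun w : C^o => w - (w0 : C^o)) @ z --> z - (w0 : C^o).
  exact: (cvgB (@cvg_id _ _) (cvg_cst _)).
by move=> cf; exact: (cvgZ h cf).
Qed.

Lemma continuous_polynomial (c : nat -> G) (w0 : C) (z : C^o) n :
  {for z, continuous (fun w : C^o => \sum_(k < n) ((w : C) - w0) ^+ k.+1 *: c k)}.
Proof.
elim: n c => [|n ih] c.
  rewrite (_ : (fun _ => _) = cst 0); first exact: cst_continuous.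
  by apply/funext => w; rewrite big_ord0.
rewrite (_ : (fun _ => _) = fun w : C^o => ((w : C) - w0) *:
    (c 0%N + \sum_(k < n) ((w : C) - w0) ^+ k.+1 *: c k.+1)).
  apply: (@continuous_shift_scale (fun w => c 0%N + \sum_(k < n) ((w : C) - w0) ^+ k.+1 *: c k.+1)).
  exact: (cvgD (cvg_cst _) (ih (fun k => c k.+1))).
apply/funext => w; rewrite big_ord_recl/= expr1 scalerDr scaler_sumr; congr (_ + _).
by apply: eq_bigr => k _; rewrite scalerA -exprS.
Qed.

End Holomorphy.

(** * Laurent expansion of the Weyl function *)

Section Expansion.
Context {R : realType}.
Local Notation C := R[i].
Context {H G : completeNormedModType C}.
Context (ipH : {dot H for @Num.conj C}) (ipG : {dot G for @Num.conj C}).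
Hypothesis (hilH : hilbert ipH) (hilG : hilbert ipG).
Context (S T : operator H) (Gamma0 Gamma1 : H -> G).
Hypothesis qbt : quasi_boundary_triple ipH ipG S T Gamma0 Gamma1.

Local Notation A0 := (A_zero T Gamma0).
Local Notation gam := (gamma_field T Gamma0).
Local Notation M := (weyl T Gamma0 Gamma1).
Local Notation D := (ran0 T Gamma0).
Let lA := linA0 qbt.
Let sA := saA0 qbt.

Context (z0 mu : C) (g : G) (p : H) (y : nat -> H).
Hypothesis (rmu : resolvent_set A0 mu) (Dg : D g).
Hypothesis (pe : op_eigenspace A0 z0 p) (xpy : gam mu g = p + y 0%N).
Hypothesis (hy : forall n, dom A0 (y n.+1) /\ opshift A0 z0 (y n.+1) = y n).

(* Coefficients [laurent n] and remainders [laurent_rem n] of the expansion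
   (z - z0) M(z) g = (mu - z0) Gamma1 p + \sum_k (z - z0)^(k+1) laurent k. *)
Definition laurent_base n : G :=
  if n is m.+1 then Gamma1 (y m.+1) else M mu g - Gamma1 p.
Definition laurent n : G := laurent_base n + (z0 - mu) *: Gamma1 (y n.+1).
Definition laurent_rem n z : G := laurent_base n + (z - mu) *: Gamma1 (res A0 z (y n)).

(** By [res_chain], R(z) y_n = y_(n+1) + (z - z0) R(z) y_(n+1). Writing z - mu = (z0 - mu) + (z -
    z0) in front of Gamma1 y_(n+1) yields the coefficient and the next base term at once. *)
Lemma laurent_step n z : resolvent_set A0 z ->
  laurent_rem n z = laurent n + (z - z0) *: laurent_rem n.+1 z.
Proof.
move=> rz; have [dy sy] := hy n; have [Ty _] := dy.
have [Tv _] := res_dom (y n.+1) rz.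
rewrite /laurent_rem /laurent (res_chain lA rz dy sy) (G1D qbt)//; last exact: (dTZ qbt).
by rewrite (G1Z qbt)//=; lmod_ring.
Qed.

Lemma laurent_sum n z : resolvent_set A0 z ->
  laurent_rem 0 z = \sum_(k < n) (z - z0) ^+ k *: laurent k + (z - z0) ^+ n *: laurent_rem n z.
Proof.
move=> rz; elim: n => [|n ih]; first by rewrite big_ord0 add0r expr0 scale1r.
by rewrite ih big_ord_recr/= {1}(laurent_step n rz) exprS; lmod_ring.
Qed.

Lemma weyl_laurent z : resolvent_set A0 z -> z != z0 ->
  (z - z0) *: M z g = (mu - z0) *: Gamma1 p + (z - z0) *: laurent_rem 0 z.
Proof.
move=> rz zz0; have [Tp _] := pe.1; have [Tv _] := res_dom (y 0%N) rz.
rewrite (weyl_res qbt rz rmu Dg) xpy (resD lA)// (res_eigen qbt rz pe zz0).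
rewrite (G1D qbt)// ?(G1Z qbt)//; last exact: (dTZ qbt).
rewrite /laurent_rem /= -[z0 - z]opprB invrN scaleNr.
have -> : z - mu = (z - z0) + (z0 - mu) by ring.
have -> : mu - z0 = - (z0 - mu) by ring.
have : (z - z0) * (z - z0)^-1 = 1 by rewrite mulfV// subr_eq0.
move: (z - z0) (z0 - mu) ((z - z0)^-1) => j k j' e.
apply: sqz_inj; rewrite ?(sqzD, sqzN, sqzZ, sqz0).
have e1 : sqz_scal G j * sqz_scal G j' = 1 by rewrite -rmorphM/= e rmorph1.
ring: e1.
Qed.

(** Only R(z) on the vector [y n] enters, through the lower bound [d]; so the estimate stays uniform
    near an eigenvalue z0, where d comes from the spectral gap. *)
Lemma laurent_rem_bound (c : R) : 0 <= c ->
  (forall f, nrm (Gamma1 (res A0 'i%C f)) <= c * nrm f) ->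
  forall n z (b d e : R), resolvent_set A0 z -> 0 < d -> nrm (z - z0) <= e ->
  d * nrm (res A0 z (y n)) <= nrm (y n) -> nrm (y n) <= b ->
  nrm (laurent_rem n z) <= nrm (laurent_base n) +
    (e + nrm (z0 - mu)) * (c * (1 + (e + nrm (z0 - 'i%C)) / d)) * b.
Proof.
move=> c0 hc n z b d e rz d0 ze hR yb.
have dist (w : C) : nrm (z - w) <= e + nrm (z0 - w).
  by apply: le_trans (ler_nrm_dist z0 _ _) _; rewrite lerD2r.
have e0 : 0 <= e := le_trans (nrm_ge0 _) ze.
rewrite /laurent_rem (le_trans (ler_nrmD _ _))// lerD2l nrmZ -mulrA.
apply: ler_pM; [exact: nrm_ge0|exact: nrm_ge0|exact: dist|].
apply: le_trans (Gamma1_res hilH qbt c0 hc (y n) rz) _.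
rewrite -mulrA ler_wpM2l// mulrDl mul1r lerD// mulrAC -mulrA.
apply: ler_pM; [exact: nrm_ge0|exact: nrm_ge0|exact: dist|].
rewrite ler_pdivlMr// mulrC; exact: le_trans hR yb.
Qed.

End Expansion.

(** * First-order expansions with quadratic error *)

Section Quadratic.
Context {R : realType}.
Local Notation C := R[i].
Context {G : completeNormedModType C}.

(** This is what finitely many steps of the Laurent recursion deliver. It implies differentiability
    and is stable under multiplication by z - w and under local modification. *)
Definition quadratic_approx (f : C -> G) (z0 : C) := exists (a0 a1 : G) (c d : R),
  0 < d /\ forall z, nrm (z - z0) < d ->
    nrm (f z - a0 - (z - z0) *: a1) <= c * nrm (z - z0) ^+ 2.

Lemma quadratic_approx_derivable f (z0 : C) : quadratic_approx f z0 ->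
  derivable (f : C^o -> G) z0 1.
Proof. by move=> [a0 [a1 [c [d [d0 h]]]]]; exact: derivable_of_quadratic h. Qed.

Lemma quadratic_approxM (w : C) f (z0 : C) : quadratic_approx f z0 ->
  quadratic_approx (fun z => (z - w) *: f z) z0.
Proof.
move=> [a0 [a1 [c [d [d0 h]]]]]; exists ((z0 - w) *: a0), (a0 + (z0 - w) *: a1).
exists ((nrm (z0 - w) + d) * c + nrm a1), d; split => // z zd.
have -> : (z - w) *: f z - (z0 - w) *: a0 - (z - z0) *: (a0 + (z0 - w) *: a1) =
    (z - w) *: (f z - a0 - (z - z0) *: a1) + (z - z0) *: ((z - z0) *: a1) by lmod_ring.
apply: le_trans (ler_nrmD _ _) _; rewrite !nrmZ mulrDl lerD//; last first.
  by rewrite mulrA -expr2 mulrC.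
rewrite -mulrA ler_pM ?nrm_ge0//; last exact: h.
apply: le_trans (ler_nrm_dist z0 _ _) _.
by rewrite addrC lerD2l ltW.
Qed.

Lemma quadratic_approx_ext f h (z0 : C) (d : R) : 0 < d ->
  (forall z, nrm (z - z0) < d -> f z = h z) -> quadratic_approx f z0 -> quadratic_approx h z0.
Proof.
move=> d0 fh [a0 [a1 [c [d' [d'0 hf]]]]]; exists a0, a1, c, (Num.min d d').
by rewrite lt_min d0 d'0; split => // z; rewrite lt_min => /andP[/fh <-]; exact: hf.
Qed.

End Quadratic.

(** * Holomorphy of the Weyl function on the resolvent set *)

Section WeylHolomorphy.
Context {R : realType}.
Local Notation C := R[i].
Context {H G : completeNormedModType C}.
Context (ipH : {dot H for @Num.conj C}) (ipG : {dot G for @Num.conj C}).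
Hypothesis (hilH : hilbert ipH) (hilG : hilbert ipG).
Context (S T : operator H) (Gamma0 Gamma1 : H -> G).
Hypothesis qbt : quasi_boundary_triple ipH ipG S T Gamma0 Gamma1.
Local Notation A0 := (A_zero T Gamma0).
Local Notation gam := (gamma_field T Gamma0).
Local Notation M := (weyl T Gamma0 Gamma1).
Local Notation D := (ran0 T Gamma0).
Let lA := linA0 qbt.
Let sA := saA0 qbt.
Let ri : resolvent_set A0 'i%C.
Proof. by apply: (nonreal_resolvent hilH lA sA); rewrite /= oner_eq0. Qed.

Let bound : exists2 c : R, 0 <= c & forall f, nrm (Gamma1 (res A0 'i%C f)) <= c * nrm f.
Proof. by apply: (Gamma1_res_bounded hilH hilG qbt); rewrite /= oner_eq0. Qed.

(** The Laurent recursion with eigenvector 0 and y_n = R(z0)^n gamma(i) g is the Taylor expansion;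
    two steps leave (z - z0)^2 times a bounded remainder. *)
Lemma weyl_quadratic (z0 : C) g (d : R) : D g -> 0 < d ->
  (forall z, nrm (z - z0) < d -> resolvent_set A0 z) -> quadratic_approx (M^~ g) z0.
Proof.
move=> Dg d0 hd; have rz0 : resolvent_set A0 z0 by apply: hd; rewrite subrr nrm0.
pose y n := iter n (res A0 z0) (gam 'i%C g).
have hy n : dom A0 (y n.+1) /\ opshift A0 z0 (y n.+1) = y n by exact: res_spec.
have pe : op_eigenspace A0 z0 0.
  by split; [exact: (dom0 lA)|rewrite (op0 lA) scaler0].
have xpy : gam 'i%C g = 0 + y 0%N by rewrite add0r.
have [d' d'0 hd'] := resolvent_lower rz0; have [c c0 hc] := bound.
pose L := laurent T Gamma0 Gamma1 z0 'i%C g 0 y.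
pose r := Num.min d d'; have r0 : 0 < r by rewrite lt_min d0.
exists (L 0%N), (L 1%N); eexists; exists r; split => // z; rewrite lt_min => /andP[zd zd'].
have rz := hd z zd; have -> : M z g = laurent_rem T Gamma0 Gamma1 'i%C g 0 y 0 z.
  by rewrite /laurent_rem /= (G10 qbt) subr0 (weyl_res qbt rz ri Dg).
rewrite (laurent_step qbt 'i%C g 0 hy 0 rz) (laurent_step qbt 'i%C g 0 hy 1 rz).
rewrite -/(L 0%N) -/(L 1%N).
have -> : L 0%N + (z - z0) *: (L 1%N + (z - z0) *: laurent_rem T Gamma0 Gamma1 'i%C g 0 y 2 z)
   - L 0%N - (z - z0) *: L 1%N =
   (z - z0) *: ((z - z0) *: laurent_rem T Gamma0 Gamma1 'i%C g 0 y 2 z) by lmod_ring.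
rewrite !nrmZ mulrA -expr2 mulrC ler_wpM2r ?exprn_ge0 ?nrm_ge0//.
apply: (laurent_rem_bound hilH qbt 'i%C g 0 c0 hc rz d'0 (ltW zd') _ (lexx _)).
by apply: (nrm_res _ rz) => u Au; exact: hd'.
Qed.

Lemma weyl_derivable (z0 : C) g (d : R) : D g -> 0 < d ->
  (forall z, nrm (z - z0) < d -> resolvent_set A0 z) -> derivable (M^~ g : C^o -> G) z0 1.
Proof. by move=> Dg d0 hd; exact/quadratic_approx_derivable/(weyl_quadratic Dg d0 hd). Qed.

End WeylHolomorphy.

(** * Eigenvalues and poles *)

Section SpectralWeyl.
Context {R : realType}.
Local Notation C := R[i].
Context {H G : completeNormedModType C}.
Context (ipH : {dot H for @Num.conj C}) (ipG : {dot G for @Num.conj C}).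
Hypothesis (hilH : hilbert ipH) (hilG : hilbert ipG).
Context (S T : operator H) (Gamma0 Gamma1 : H -> G).
Hypothesis qbt : quasi_boundary_triple ipH ipG S T Gamma0 Gamma1.
Local Notation A0 := (A_zero T Gamma0).
Local Notation gam := (gamma_field T Gamma0).
Local Notation M := (weyl T Gamma0 Gamma1).
Local Notation D := (ran0 T Gamma0).
Context (E : set R -> H -> H).
Hypothesis spE : spectral_measure ipH A0 E.
Implicit Types (l s : R) (g : G) (x u : H).

Let lA := linA0 qbt.
Let sA := saA0 qbt.
Let rho_nonreal z : complex.Im z != 0 -> resolvent_set A0 z.
Proof. exact: (nonreal_resolvent hilH lA sA). Qed.
Let i0 : complex.Im ('i%C : C) != 0. Proof. by rewrite /= oner_eq0. Qed.
Let ri := rho_nonreal i0.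
Let sp_eigenP' := sp_eigenP hilH lA sA spE.

Lemma eigenproj_eigen l x : op_eigenspace A0 l%:C (E [set l] x).
Proof. by apply/sp_eigenP'; exact: (sm_idem spE). Qed.

(** The decomposition of [RM_net_cvg] is the one given by E {l}: this projection fixes q and kills
    p, a limit of vectors (A_0 - l) v. *)
Lemma RM_cvg l (mu : C) g : complex.Im mu != 0 -> D g ->
  RM_net T Gamma0 Gamma1 l g @ 0^'+ --> (mu - l%:C) *: Gamma1 (E [set l] (gam mu g)).
Proof.
move=> mu0 Dg; have [p [q [-> qe pcl]]] := RM_net_cvg hilH hilG qbt l mu0 Dg.
have ml : measurable [set l] by exact: measurable_set1.
rewrite (spD spE)// (sp_eigenP' l q).1// [E _ p](_ : _ = 0) ?add0r//.
apply/eqP; rewrite -nrm_eq0 eq_le nrm_ge0 andbT; apply/ler_addgt0Pl => e e0.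
move/closure_nrmP : pcl => /(_ e e0)[_ [v Av <-] vp]; rewrite addr0.
have -> : E [set l] p = E [set l] (p - opshift A0 l%:C v).
  rewrite (spB spE)// -(sp_shift hilH lA sA spE)//.
  by have [_ h] := eigenproj_eigen l v; rewrite /opshift h subrr subr0.
by rewrite (le_trans (sp_contract hilH spE _ ml))// nrm_dist ltW.
Qed.

Lemma RM_eq l (mu : C) g : complex.Im mu != 0 -> D g ->
  RM T Gamma0 Gamma1 l g = (mu - l%:C) *: Gamma1 (E [set l] (gam mu g)).
Proof. by move=> mu0 Dg; apply: cvg_lim => //; exact: RM_cvg. Qed.

Lemma Gamma1_eigen l (mu : C) u g : complex.Im mu != 0 -> D g -> op_eigenspace A0 l%:C u ->
  ipG (Gamma1 u) g = (l%:C - mu^*%C) * ipH u (gam mu g).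
Proof.
move=> mu0 Dg [Au ul]; rewrite -(gamma_adjoint qbt Au (rho_nonreal mu0) Dg).
by rewrite /opshift ul -scalerBl ipZl.
Qed.

Lemma real_subC_neq0 l (mu : C) : complex.Im mu != 0 -> mu - l%:C != 0.
Proof. by rewrite subr_eq0; apply: contraNneq => ->. Qed.

Lemma eigen_subspace (l : C) : subspace_closed (op_eigenspace A0 l).
Proof.
split; first by split; [exact: (dom0 lA)|rewrite (op0 lA) scaler0].
move=> a u v [Au ul] [Av vl]; split; first exact: lA.1.2.
by rewrite lA.2// ul vl; lmod_ring.
Qed.

(** At a real resolvent point s the vectors R(s + i eta) x stay bounded, so eta |R(s + i eta) x|^2
    tends to 0. *)
Lemma sp_null_of_resolvent (a b : R) :
  (forall s, a < s < b -> resolvent_set A0 s%:C) -> forall x, E `]a, b[%classic x = 0.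
Proof.
move=> hr x; apply: (sp_null_itv hilH lA sA spE) => s sab e e0.
have [d d0 hd] := resolvent_lower (hr s sab).
have x1 : 0 < nrm x ^+ 2 + 1 by rewrite ltr_wpDl ?sqr_ge0.
exists (Num.min d (e * d ^+ 2 / (nrm x ^+ 2 + 1))).
  by rewrite lt_min d0 divr_gt0// mulr_gt0// exprn_gt0.
move=> eta; rewrite lt_min => /and3P[eta0 etad etae].
set z := s +i* eta; have rz : resolvent_set A0 z by apply: rho_nonreal; rewrite gt_eqF.
have zs : nrm (z - s%:C) < d.
  have -> : z - s%:C = 0 +i* eta :> C.
    by apply/eqP; rewrite eq_complex/= subrr subr0 !eqxx.
  by rewrite /nrm normc_def/= expr0n/= add0r sqrtr_sqr gtr0_norm.
have := nrm_res x rz (fun u Au => hd z u zs Au).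
rewrite -(@ler_pXn2r _ 2)// ?nnegrE ?mulr_ge0 ?nrm_ge0 ?(ltW d0)// exprMn => h.
have d2 : 0 < d ^+ 2 by rewrite exprn_gt0.
move: etae; rewrite ltr_pdivlMr// => etae; rewrite -(ltr_pM2r d2).
by move: h etae; move: (d ^+ 2) (nrm x ^+ 2) (nrm (res _ _ _) ^+ 2) => a' b' c' h etae; nra.
Qed.

(* eta * |gamma(s + i eta) g|^2 = Im (M(s + i eta) g, g) has the sign of eta, so continuity
   of the extension at s forces it to tend to 0. *)
Lemma extension_form_real (U : set C) (N : C -> G -> G) s g : D g ->
  open (U : set C^o) -> U s%:C ->
  (forall z g, U z -> resolvent_set A0 z -> D g -> N z g = M z g) ->
  derivable (N^~ g : C^o -> G) s%:C 1 ->
  forall e : R, 0 < e -> exists2 d : R, 0 < d & forall eta, 0 < eta < d ->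
    eta * nrm (gam (s +i* eta) g) ^+ 2 < e.
Proof.
move=> Dg oU Us NM dN e e0.
have g1 : 0 < nrm g + 1 by rewrite ltr_wpDl ?nrm_ge0.
have [/= dU dU0 hU] := (@nbhs_nrmP R C^o _ _).1 (open_nbhs_nbhs (conj oU Us)).
have near (eps : R) : 0 < eps -> exists2 d : R, 0 < d & forall eta, `|eta| < d -> eta != 0 ->
    `|eta * nrm (gam (s +i* eta) g) ^+ 2 - complex.Im (ipG (N s%:C g) g)| < eps.
  move=> eps0; have [d d0 hd] := derivable_continuous dN (divr_gt0 eps0 g1).
  exists (Num.min dU d); first by rewrite lt_min dU0.
  move=> eta; rewrite lt_min => /andP[etaU etad] eta0.
  have zs : nrm ((s +i* eta) - s%:C : C) = `|eta|.
    have -> : (s +i* eta) - s%:C = 0 +i* eta :> C.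
      by apply/eqP; rewrite eq_complex/= subrr subr0 !eqxx.
    by rewrite /nrm normc_def/= expr0n/= add0r sqrtr_sqr.
  have rz : resolvent_set A0 (s +i* eta) by apply: rho_nonreal.
  have Uz : U (s +i* eta) by apply: hU; rewrite zs.
  have := weyl_Im hilH qbt rz Dg; rewrite /= => <-.
  rewrite -(NM _ _ Uz rz Dg) -ImN -ImD -ipBl; apply: le_lt_trans (ler_Im_nrm _) _.
  apply: le_lt_trans (cauchy_schwarz hilG _ _) _.
  have := hd (s +i* eta); rewrite zs => /(_ etad); rewrite ltr_pdivlMr//; apply: le_lt_trans.
  by rewrite ler_wpM2l ?nrm_ge0// lerDl.
have I0 : complex.Im (ipG (N s%:C g) g) = 0.
  apply/eqP; rewrite -normr_le0; apply/ler_addgt0Pl => eps eps0; rewrite addr0.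
  have [d d0 hd] := near eps eps0; have d2 : 0 < d / 2 by lra.
  have := hd (d / 2); rewrite gtr0_norm// (gt_eqF d2) => /(_ ltac:(lra) isT).
  have := hd (- (d / 2)); rewrite normrN gtr0_norm// oppr_eq0 (gt_eqF d2) => /(_ ltac:(lra) isT).
  have p1 : 0 <= d / 2 * nrm (gam (s +i* (d / 2)) g) ^+ 2 by rewrite mulr_ge0 ?sqr_ge0// ltW.
  have p2 : 0 <= d / 2 * nrm (gam (s +i* (- (d / 2))) g) ^+ 2.
    by rewrite mulr_ge0 ?sqr_ge0// ltW.
  rewrite mulNr !ltr_norml => /andP[h1 h2] /andP[h3 h4]; rewrite ler_norml.
  by apply/andP; split; lra.
have [d d0 hd] := near e e0; exists d => // eta /andP[eta0 etad].
have := hd eta; rewrite gtr0_norm// (gt_eqF eta0) => /(_ etad isT).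
by rewrite I0 subr0 => h; apply: le_lt_trans h; exact: ler_norm.
Qed.

(** For x = gamma(mu) g one has (z - mu) R(z) x = gamma(z) g - x. Since z - mu stays away from 0,
    the decay of eta |gamma(s + i eta) g|^2 is inherited by eta |R(s + i eta) x|^2. *)
Lemma sp_null_of_extension (U : set C) (N : C -> G -> G) (a b : R) (mu : C) g :
  complex.Im mu != 0 -> D g -> open (U : set C^o) ->
  strongly_holomorphic_weyl T Gamma0 Gamma1 U N ->
  (forall s, a < s < b -> U s%:C) -> E `]a, b[%classic (gam mu g) = 0.
Proof.
move=> mu0 Dg oU [NM dN] Uab; apply: (sp_null_itv hilH lA sA spE) => s sab e e0.
have rmu := rho_nonreal mu0; have Us := Uab s sab.
(* For eta < k the distance from s + i eta to mu is at least |Im mu| - eta >= k. *)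
set x := gam mu g; pose k := `|complex.Im mu| / 2.
have k0 : 0 < k by rewrite divr_gt0// normr_gt0.
have k20 : 0 < k ^+ 2 / 4 by rewrite divr_gt0// exprn_gt0.
(* From k^2 |R x|^2 <= 2 |gamma(z) g|^2 + 2 |x|^2, each of the two terms, times eta, may use e k^2 /
   2. *)
have [d d0 hd] := extension_form_real Dg oU Us NM (dN g Dg _ Us) (mulr_gt0 e0 k20).
have x1 : 0 < nrm x ^+ 2 + 1 by rewrite ltr_wpDl ?sqr_ge0.
exists (Num.min (Num.min d k) (e * (k ^+ 2 / 4) / (nrm x ^+ 2 + 1))).
  by rewrite !lt_min d0 k0 divr_gt0// mulr_gt0.
move=> eta; rewrite !lt_min => /andP[eta0 /andP[/andP[etad etak] etae]].
set z := s +i* eta; have rz : resolvent_set A0 z by apply: rho_nonreal; rewrite gt_eqF.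
have := hd eta; rewrite eta0 etad => /(_ isT); rewrite -/z => hg.
have E1 : (z - mu) *: res A0 z x = gam z g - x.
  by rewrite (gamma_res qbt rz rmu Dg) -/x; lmod_ring.
have zmu : k <= nrm (z - mu).
  apply: le_trans (ler_Im_nrm _); rewrite ImD ImN /=.
  have := ler_normB eta (eta - complex.Im mu); rewrite opprB addrCA subrr addr0.
  by rewrite (gtr0_norm eta0) /k in etak *; move: (`|complex.Im mu|) (`|eta - _|) etak => *; lra.
have h : k * nrm (res A0 z x) <= nrm (gam z g) + nrm x.
  apply: le_trans (ler_nrmB _ _); rewrite -E1 nrmZ.
  by rewrite ler_wpM2r ?nrm_ge0.
have h2 : k ^+ 2 * nrm (res A0 z x) ^+ 2 <= 2 * nrm (gam z g) ^+ 2 + 2 * nrm x ^+ 2.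
  rewrite -exprMn; apply: (@le_trans _ _ ((nrm (gam z g) + nrm x) ^+ 2)).
    by rewrite ler_pXn2r ?nnegrE ?addr_ge0 ?mulr_ge0 ?nrm_ge0// ltW.
  by have := sqr_ge0 (nrm (gam z g) - nrm x); rewrite sqrrB sqrrD mulr2n; lra.
move: etae; rewrite ltr_pdivlMr// => etae.
have k2 : 0 < k ^+ 2 by rewrite exprn_gt0.
rewrite -(ltr_pM2r k2).
have : eta * (k ^+ 2 * nrm (res A0 z x) ^+ 2) <=
    eta * (2 * nrm (gam z g) ^+ 2 + 2 * nrm x ^+ 2) by rewrite ler_wpM2l// ltW.
have -> : eta * (k ^+ 2 * nrm (res A0 z x) ^+ 2) = eta * nrm (res A0 z x) ^+ 2 * k ^+ 2 by ring.
have -> : eta * (2 * nrm (gam z g) ^+ 2 + 2 * nrm x ^+ 2) =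
    2 * (eta * nrm (gam z g) ^+ 2) + 2 * (eta * nrm x ^+ 2) by ring.
move: hg etae; rewrite mulrDr mulr1 [e * (_ / 4)]mulrA.
by move: (eta * nrm (gam z g) ^+ 2) (eta * nrm x ^+ 2) (_ * k ^+ 2) (e * k ^+ 2) => *; lra.
Qed.

Lemma sp_gap_union l (r : R) x : 0 < r ->
  E `]l - r, l[%classic x = 0 -> E `]l, l + r[%classic x = 0 ->
  E `]l - r, l + r[%classic (x - E [set l] x) = 0.
Proof.
move=> r0 h1 h2; have ml : measurable [set l] by exact: measurable_set1.
have mI := @measurable_itv R `]l - r, l + r[.
have m1 := @measurable_itv R `]l - r, l[; have m2 := @measurable_itv R `]l, l + r[.
have -> : E `]l - r, l + r[%classic (x - E [set l] x) = E `]l - r, l + r[%classic x - E [set l] x.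
  rewrite (spB spE)//; congr (_ - _); apply: (sp_sub_id hilH spE ml mI); last exact: (sm_idem spE).
  by move=> _ ->; rewrite /= in_itv/=; apply/andP; split; lra.
have {1}-> : `]l - r, l + r[%classic = `]l - r, l[%classic `|` ([set l] `|` `]l, l + r[%classic).
  apply/seteqP; split => t /=; rewrite !in_itv/=.
    by move=> /andP[t1 t2]; have [tl|tl|->] := ltgtP t l; [left; rewrite t1|right; right|right; left].
  case=> [/andP[t1 t2]|[->|/andP[t1 t2]]]; apply/andP; split; lra.
rewrite (sp_additive spE)//; last 2 first.
- exact: measurableU.
- by apply/seteqP; split => t //=; rewrite !in_itv/= => -[/andP[t1 t2] [t3|/andP[t3 t4]]]; lra.
rewrite h1 add0r (sp_additive spE)//; first by rewrite h2 addr0 subrr.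
by apply/seteqP; split => t //=; rewrite !in_itv/= => -[t3 /andP[t1 t2]]; lra.
Qed.

Lemma eigen_not_resolvent (z : C) : is_eigenvalue A0 z -> ~ resolvent_set A0 z.
Proof.
move=> [u [Au uz] /eqP u0] rz; apply: u0; apply: (shift_inj rz Au (dom0 lA)).
by rewrite /opshift uz (op0 lA) scaler0 !subrr.
Qed.

(** * Consequences of the simplicity condition on [Delta] *)

Section Interval.
Context (Delta : set R) (oD : open Delta).
Hypothesis simple : range (E Delta) =
  clsp [set x | exists (nu : C) (g : G),
    [/\ complex.Im nu != 0, D g & x = E Delta (gam nu g)]].
Let mD : measurable Delta. Proof. exact: open_measurable. Qed.

Lemma Gamma1_eigen_inj l u : Delta l -> op_eigenspace A0 l%:C u -> Gamma1 u = 0 -> u = 0.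
Proof.
move=> Dl ue G1u; have Eu : E Delta u = u by exact: (sp_eigen_sub hilH lA sA spE mD Dl ue).
have : range (E Delta) u by exists u.
rewrite simple => ucl; apply: (ip_eq0 hilH); apply: (closure_orth hilH) _ ucl.
move=> _ [n [c [v [hv ->]]]]; apply: ip_eq0C; rewrite ip_suml big1// => i _.
rewrite ipZl; have [nu [g [nu0 Dg ->]]] := hv i.
have : ipH u (gam nu g) = 0.
  have := Gamma1_eigen nu0 Dg ue; rewrite G1u ip0l => /esym/eqP.
  rewrite mulf_eq0 => /orP[|/eqP//].
  rewrite -oppr_eq0 opprB => /negPn; rewrite (real_subC_neq0 l)//.
  by rewrite ImJ oppr_eq0.
rewrite -{1}Eu (sm_sym spE)// => h.
by rewrite (ip_eq0C h) mulr0.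
Qed.

Let L l : set H := [set E [set l] (gam 'i%C g) | g in D].

(** The nonzero scalar i - l of [RM_eq] is absorbed into g, as ran Gamma0 is a subspace. Part (a)
    thereby becomes a statement about [L l] inside the eigenspace. *)
Lemma RM_image l : RM T Gamma0 Gamma1 l @` D = Gamma1 @` L l.
Proof.
have ml : measurable [set l] by exact: measurable_set1.
have ZE (a : C) g : D g -> E [set l] (gam 'i%C (a *: g)) = a *: E [set l] (gam 'i%C g).
  move=> Dg; rewrite -[a *: g]addr0 (gamma_linear qbt a ri Dg (ran00 qbt)).
  have -> : gam 'i%C 0 = 0.
    have [Tu uz ug] := gamma_spec qbt ri (ran00 qbt).
    have := gamma_eq qbt ri (dT0 qbt).
    have T0 : T 0 = 0.
      have := (op0 lA). by [].
    by rewrite T0 scaler0 (G00 qbt) => /(_ erefl).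
  by rewrite addr0 (spZ spE).
have DZ (a : C) g : D g -> D (a *: g).
  by move=> Dg; rewrite -[_ *: _]addr0; exact: (ran0D qbt) (ran00 qbt).
have ne := real_subC_neq0 l i0.
have G1Z' (a : C) g : D g ->
    Gamma1 (a *: E [set l] (gam 'i%C g)) = a *: Gamma1 (E [set l] (gam 'i%C g)).
  by move=> Dg; have [[Tu _] _] := eigenproj_eigen l (gam 'i%C g); rewrite (G1Z qbt).
apply/seteqP; split => [_ [g Dg <-]|_ [_ [g Dg <-] <-]].
  rewrite (RM_eq l i0 Dg); exists (E [set l] (gam 'i%C (('i%C - l%:C) *: g))).
    by exists (('i%C - l%:C) *: g) => //; exact: DZ.
  by rewrite ZE// G1Z'.
exists (('i%C - l%:C)^-1 *: g); first exact: DZ.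
by rewrite (RM_eq l i0)//; [rewrite ZE// G1Z'// scalerA mulfV// scale1r|exact: DZ].
Qed.

Lemma L_eigen l : L l `<=` op_eigenspace A0 l%:C.
Proof. by move=> _ [g Dg <-]; exact: eigenproj_eigen. Qed.

Lemma L_subspace l : subspace_closed (L l).
Proof.
have ml : measurable [set l] by exact: measurable_set1.
have cl (a : C) u v : L l u -> L l v -> L l (a *: u + v).
  move=> [g Dg <-] [h Dh <-]; exists (a *: g + h); first exact: (ran0D qbt).
  by rewrite (gamma_linear qbt a ri Dg Dh) (spD spE)// (spZ spE).
split=> //; have L0 : L l (E [set l] (gam 'i%C 0)) by exists 0; [exact: (ran00 qbt)|].
by have := cl (-1) _ _ L0 L0; rewrite scaleN1r addNr.
Qed.

(** Orthogonality to [L l] means (Gamma1 x, g) = 0 for all g in the dense set ran Gamma0, so Gamma1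
    x = 0, and Gamma1 is injective on the eigenspace. *)
Lemma L_orth l x : Delta l -> op_eigenspace A0 l%:C x ->
  (forall v, L l v -> ipH x v = 0) -> x = 0.
Proof.
move=> Dl xe xL; apply: (Gamma1_eigen_inj Dl xe); apply: (ran0_orth hilG qbt) => g Dg.
rewrite (Gamma1_eigen i0 Dg xe).
have ml : measurable [set l] by exact: measurable_set1.
have -> : ipH x (gam 'i%C g) = ipH x (E [set l] (gam 'i%C g)).
  by rewrite -(sm_sym spE)// (sp_eigenP' l x).1.
by rewrite xL ?mulr0//; exists g.
Qed.

(** The projection p of x onto the closure of [L l] is still an eigenvector, because the eigenspace
    is the range of the bounded projection E {l}. So [L_orth] applies to x - p. *)
Lemma L_dense l x : Delta l -> op_eigenspace A0 l%:C x -> closure (L l) x.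
Proof.
move=> Dl xe; have [p pcl ph] := orthogonal_projection hilH x (L_subspace l).
suff : x - p = 0 by move/eqP; rewrite subr_eq0 => /eqP ->.
apply: (L_orth Dl) => //; apply: (subspaceB (eigen_subspace _)) => //.
apply/sp_eigenP'; have ml : measurable [set l] by exact: measurable_set1.
apply/eqP; rewrite -subr_eq0 -nrm_eq0 eq_le nrm_ge0 andbT.
apply/ler_addgt0Pl => e e0; rewrite addr0.
move/closure_nrmP : pcl => /(_ (e / 2) ltac:(lra))[v Lv vp].
have -> : E [set l] p - p = (v - p) - E [set l] (v - p).
  by rewrite (spB spE)// (sp_eigenP' l v).1; [lmod_ring|exact: L_eigen].
have := sp_contract hilH spE (v - p) ml.
by have := ler_nrmB (v - p) (E [set l] (v - p)); lra.
Qed.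

Lemma eigenvalue_iff_RM l : Delta l ->
  is_eigenvalue A0 l%:C <-> exists2 g, D g & RM T Gamma0 Gamma1 l g != 0.
Proof.
move=> Dl; split=> [[u ue u0]|[g Dg]].
  apply: contrapT => h; move/eqP : u0; apply; apply: (L_orth Dl ue) => _ [g Dg <-].
  have RM0 : RM T Gamma0 Gamma1 l g = 0.
    by apply: contrapT => /eqP r0; apply: h; exists g.
  have : Gamma1 (E [set l] (gam 'i%C g)) = 0.
    move: RM0; rewrite (RM_eq l i0 Dg) => /eqP; rewrite scaler_eq0.
    by rewrite (negPf (real_subC_neq0 l i0)) => /eqP.
  by move/(Gamma1_eigen_inj Dl (eigenproj_eigen l _)) => ->; rewrite ip0r.
rewrite (RM_eq l i0 Dg) => h; exists (E [set l] (gam 'i%C g)); first exact: eigenproj_eigen.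
by apply: contraNneq h => ->; rewrite (G10 qbt) scaler0.
Qed.

Lemma Gamma1_inj_in l : Delta l ->
  set_inj (op_eigenspace A0 l%:C) Gamma1.
Proof.
move=> Dl u v; rewrite !inE => ue ve uv; apply/eqP; rewrite -subr_eq0; apply/eqP.
apply: (Gamma1_eigen_inj Dl); first exact: (subspaceB (eigen_subspace _)).
have [[Tu _] _] := ue; have [[Tv _] _] := ve.
by rewrite (G1B qbt)// uv subrr.
Qed.

(** In finite dimension, [L l] having trivial orthogonal complement in the eigenspace forces it to
    be the whole eigenspace. *)
Lemma eigen_bij_finite l : Delta l -> finite_dimensional (op_eigenspace A0 l%:C) ->
  set_bij (op_eigenspace A0 l%:C) (RM T Gamma0 Gamma1 l @` D) Gamma1.
Proof.
move=> Dl fd; have KL : op_eigenspace A0 l%:C `<=` L l.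
  apply: (finite_dimensional_dense hilH fd (eigen_subspace _) (L_subspace l) (@L_eigen l)).
  by move=> x xe; exact: L_orth.
rewrite RM_image; split; [|exact: Gamma1_inj_in|].
  by move=> u /KL Lu; exists u.
by move=> _ [u /L_eigen ue <-]; exists u.
Qed.

Lemma Gamma1_eigen_bounded l : exists2 c : R, 0 <= c &
  forall u, op_eigenspace A0 l%:C u -> nrm (Gamma1 u) <= c * nrm u.
Proof.
have [c c0 hc] := Gamma1_res_bounded hilH hilG qbt i0.
exists (c * nrm (l%:C - 'i%C : C)); first by rewrite mulr_ge0 ?nrm_ge0.
move=> u [Au ul]; rewrite -{1}(res_shift ri Au) -mulrA -nrmZ.
by rewrite scalerBl -ul; exact: hc.
Qed.

(** Gamma1 is bounded on the eigenspace, so the density of [L l] passes to the images; injectivity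
    is as in the finite case. *)
Lemma eigen_bij_infinite l : Delta l ->
  set_bij (op_eigenspace A0 l%:C)
    (closure_in (Gamma1 @` op_eigenspace A0 l%:C) (RM T Gamma0 Gamma1 l @` D)) Gamma1.
Proof.
move=> Dl; rewrite RM_image; set K := op_eigenspace A0 l%:C; set Y := Gamma1 @` K.
have LY : Gamma1 @` L l `<=` Y by apply: image_subset; exact: L_eigen.
split; [|exact: Gamma1_inj_in|].
  move=> u Ku B Bn; have : within Y (nbhs (Gamma1 u)) B.
    by rewrite nbhs_subspace_in//; exists u.
  move=> /nbhs_nrmP[e e0 eB].
  have [c c0 hc] := Gamma1_eigen_bounded l; have c1 : 0 < c + 1 by rewrite ltr_wpDl.
  move/closure_nrmP : (L_dense Dl Ku) => /(_ _ (divr_gt0 e0 c1))[v Lv vu].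
  exists (Gamma1 v); split; first by exists v.
  have Kv := L_eigen Lv; apply: eB; last by exists v.
  have [[Tu _] _] := Ku; have [[Tv _] _] := Kv; rewrite -(G1B qbt)//.
  apply: le_lt_trans (hc _ (subspaceB (eigen_subspace _) Kv Ku)) _.
  move: vu; rewrite ltr_pdivlMr// => vu.
  by have := nrm_ge0 (v - u); lra.
(* Points outside Y are isolated in the topology of [subspace Y], so one of them lies in the closure
   of a set only if it belongs to the set; here that set is contained in Y. *)
move=> y yc; have [//|nY] := pselect (Y y).
have [|z [zA zy]] := yc [set y]; first by rewrite /nbhs/= -nbhs_subspace_out.
by exfalso; apply: nY; apply: LY; rewrite -[y]zy.
Qed.

(** On the vertical ray z = l + j, h(z) = j^(n-1) (j M(z) g) with |j| < 1, so h(z) tends to 0 with j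
    M(z) g. Thus a pole, of whatever order, forces R_l M g to be nonzero. *)
Lemma RM_pole_eq0 (h : C -> G) (V : set C) (N : C -> G -> G) (O : set C) (n : nat) l g :
  D g -> RM T Gamma0 Gamma1 l g = 0 -> (0 < n)%N ->
  open_nbhs (l%:C : C^o) V -> open_nbhs (l%:C : C^o) O ->
  (forall z g, (O `\ l%:C) z -> resolvent_set A0 z -> D g -> N z g = M z g) ->
  holomorphic_on V h -> (forall z, V z -> z != l%:C -> N z g = (z - l%:C) ^- n *: h z) ->
  h l%:C = 0.
Proof.
move=> Dg R0 n0 nV nO NM hh Nh; have [oV Vl] := nV.
have [/= dV dV0 hV] := (@nbhs_nrmP R C^o _ _).1 (open_nbhs_nbhs nV).
have [/= dO dO0 hO] := (@nbhs_nrmP R C^o _ _).1 (open_nbhs_nbhs nO).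
have Rc : RM_net T Gamma0 Gamma1 l g @ 0^'+ --> (0 : G).
  by rewrite -R0 (RM_eq l i0 Dg); exact: RM_cvg.
apply/eqP; rewrite -nrm_eq0 eq_le nrm_ge0 andbT; apply/ler_addgt0Pl => e e0; rewrite addr0.
have e2 : 0 < e / 2 by lra.
have [d d0 hd] := derivable_continuous (hh _ Vl) e2.
have := Rc; move/cvg_nrmP => /(_ (e / 2) e2) Re.
have : \forall eta \near (0 : R)^'+, nrm (h l%:C) <= e.
  near=> eta; have eta0 : 0 < eta by near: eta; exact: nbhs_right_gt.
  have eta1 : eta < 1 by near: eta; exact: nbhs_right_lt.
  have etaV : eta < dV by near: eta; exact: nbhs_right_lt.
  have etaO : eta < dO by near: eta; exact: nbhs_right_lt.
  have etad : eta < d by near: eta; exact: nbhs_right_lt.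
  have : nrm (RM_net T Gamma0 Gamma1 l g eta - 0) < e / 2 by near: eta.
  rewrite subr0 /RM_net; set z := l +i* eta; set j : C := 0 +i* eta => Rj.
  have rz : resolvent_set A0 z by apply: rho_nonreal; rewrite gt_eqF.
  have zl : z - l%:C = j by apply/eqP; rewrite eq_complex/= subrr subr0 !eqxx.
  have nj : nrm j = eta by rewrite /nrm normc_def/= expr0n/= add0r sqrtr_sqr gtr0_norm.
  have j0 : j != 0 by rewrite -nrm_eq0 nj gt_eqF.
  have zl0 : z != l%:C by rewrite -subr_eq0 zl.
  have Vz : V z by apply: hV; rewrite zl nj.
  have Oz : (O `\ l%:C) z by split; [apply: hO; rewrite zl nj|exact/eqP].
  have hz : h z = j ^+ n.-1 *: (j *: M z g).
    rewrite scalerA -exprSr prednK// -(NM _ _ Oz rz Dg) (Nh _ Vz zl0) zl scalerA.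
    by rewrite mulfV ?scale1r// expf_neq0.
  have hze : nrm (h z) < e / 2.
    rewrite hz nrmZ nrmX nj; apply: le_lt_trans Rj.
    by rewrite ler_piMl ?nrm_ge0// exprn_ile1// ltW.
  have := hd z; rewrite zl nj => /(_ etad).
  by have := ler_nrm_dist (h z) (h l%:C) 0; rewrite !subr0 (nrm_dist _ (h z)); lra.
by move/filter_ex => -[].
Unshelve. all: by end_near.
Qed.

Lemma sp_null_simple (a b : R) : `]a, b[%classic `<=` Delta ->
  (forall nu g, complex.Im nu != 0 -> D g -> E `]a, b[%classic (gam nu g) = 0) ->
  forall x, E `]a, b[%classic x = 0.
Proof.
move=> IDelta hI x; have mI := @measurable_itv R `]a, b[.
have -> : E `]a, b[%classic x = E `]a, b[%classic (E Delta x).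
  by rewrite (sp_setI hilH spE)// (setIidl IDelta).
have : range (E Delta) (E Delta x) by exists x.
rewrite simple; move: (E Delta x) => w /closure_nrmP wcl.
apply/eqP; rewrite -nrm_eq0 eq_le nrm_ge0 andbT; apply/ler_addgt0Pl => e e0; rewrite addr0.
have [_ [n [c [v [hv ->]]]] vw] := wcl e e0.
have s0 : E `]a, b[%classic (\sum_(i < n) c i *: v i) = 0.
  elim/big_rec : _ => [|i u _ ih]; first exact: (sp0 spE).
  have [nu [g [nu0 Dg ->]]] := hv i.
  rewrite (spD spE)// (spZ spE)// ih addr0 (sp_setI hilH spE)// (setIidl IDelta).
  by rewrite hI// scaler0.
have -> : E `]a, b[%classic w = E `]a, b[%classic (w - \sum_(i < n) c i *: v i).
  by rewrite (spB spE)// s0 subr0.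
by rewrite (le_trans (sp_contract hilH spE _ mI))// nrm_dist ltW.
Qed.

Lemma isolated_of_pole l : Delta l -> strong_pole T Gamma0 Gamma1 l%:C ->
  is_isolated_eigenvalue A0 l%:C.
Proof.
move=> Dl [W [N [nO hN [g Dg [n [V [h [n0 nV hh hl Nh]]]]]]]].
have ev : is_eigenvalue A0 l%:C.
  apply/(eigenvalue_iff_RM Dl); exists g => //; apply: contraNneq hl => R0.
  exact/eqP/(RM_pole_eq0 Dg R0 n0 nV nO hN.1 hh Nh).
split=> //; have [/= dO dO0 hO] := (@nbhs_nrmP R C^o _ _).1 (open_nbhs_nbhs nO).
have [/= dD dD0 hD] : exists2 d : R, 0 < d & forall s, `|s - l| < d -> Delta s.
  have /nbhs_ballP[d /= d0 hd] : nbhs l Delta by apply: open_nbhs_nbhs.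
  by exists d => // s sl; apply: hd; rewrite -ball_normE/= distrC.
pose r := Num.min dO dD; have r0 : 0 < r by rewrite lt_min dO0.
have oO : open (W `\ l%:C : set C^o).
  exact: open_setD1 nO.1.
have nrmR s : nrm (s%:C - l%:C : C) = `|s - l| by rewrite -rmorphB nrm_real.
have sub (a b : R) : (forall s, a < s < b -> `|s - l| < r /\ s != l) ->
    forall x, E `]a, b[%classic x = 0.
  move=> hs; apply: sp_null_simple.
    move=> s /=; rewrite in_itv/= => /hs[+ _]; rewrite lt_min => /andP[_].
    exact: hD.
  move=> nu k nu0 Dk; apply: (sp_null_of_extension nu0 Dk oO hN) => s /hs[+ sl].
  rewrite lt_min => /andP[sO _]; split; first by apply: hO; rewrite nrmR.
  by move/complexI => sl'; rewrite sl' eqxx in sl.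
split; first by rewrite inE; exact: eigen_not_resolvent.
exists [set z | nrm (z - l%:C) < r].
  by apply/(@nbhs_nrmP R C^o); exists r.
apply/seteqP; split => [z [/= zr zs]|_ ->]; last first.
  by split; [rewrite /= subrr nrm0|exact: eigen_not_resolvent].
apply: contrapT => zl; apply: zs.
have [z0|z0] := eqVneq (complex.Im z) 0; last exact: rho_nonreal.
have ze : z = (complex.Re z)%:C by case: z z0 {zr zl} => a b /= ->.
rewrite ze; rewrite ze nrmR in zr; set s := complex.Re z in zr *.
have sl : 0 < `|s - l|.
  rewrite normr_gt0 subr_eq0; apply/eqP => sl; apply: zl.
  by rewrite /= ze -/s sl.
(* The interval of radius q around s avoids l and stays within distance r of l. *)
pose q := Num.min `|s - l| (r - `|s - l|).
have q0 : 0 < q by rewrite lt_min sl subr_gt0.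
apply: (sp_gap_resolvent hilH lA sA spE q0); apply: sub => t /andP[t1 t2].
have tq : `|t - s| < q by rewrite ltr_norml; apply/andP; split; lra.
move: tq; rewrite lt_min => /andP[t3 t4]; split.
  by have := ler_normD (t - s) (s - l); rewrite addrA subrK; lra.
by apply: contraTneq t3 => ->; rewrite distrC ltxx.
Qed.

Lemma isolated_radius (z0 : C) : is_isolated_eigenvalue A0 z0 ->
  exists2 r : R, 0 < r & forall z, nrm (z - z0) < r -> z != z0 -> resolvent_set A0 z.
Proof.
move=> [_ [_ [V /(@nbhs_nrmP R C^o)[r r0 hr] VE]]]; exists r => // z zr zz0.
apply: contrapT => nz; have : (V `&` spectrum A0) z by split; [exact: hr|].
by rewrite VE => /= zz; rewrite zz eqxx in zz0.
Qed.

(** The pole is simple: h(z) = (z - l) M(z) g, completed by the value R_l M g at l, is holomorphic.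
    Away from l this is holomorphy of M on the resolvent set; at l it is the Laurent expansion, as x
    - p is annihilated by E of the gap. *)
Lemma pole_of_isolated l : Delta l -> is_isolated_eigenvalue A0 l%:C ->
  strong_pole T Gamma0 Gamma1 l%:C.
Proof.
move=> Dl il; have [r r0 hr] := isolated_radius il.
have /(eigenvalue_iff_RM Dl)[g Dg Rg] := il.1.
pose O : set C^o := [set z | nrm (z - l%:C : C) < r].
have nO : open_nbhs (l%:C : C^o) O.
  split; last by rewrite /O /= subrr nrm0.
  rewrite openE => z /= zr; apply/(@nbhs_nrmP R C^o).
  exists (r - nrm (z - l%:C)); first by rewrite subr_gt0.
  by move=> w wz; rewrite /O /=; have := ler_nrm_dist (z : C) w l%:C; lra.
have away (z : C) : nrm (z - l%:C) < r -> z != l%:C -> exists2 d : R, 0 < d &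
    forall w, nrm (w - z) < d -> resolvent_set A0 w /\ w != l%:C.
  move=> zr zl; have zl0 : 0 < nrm (z - l%:C) by rewrite nrm_gt0 subr_eq0.
  exists (Num.min (nrm (z - l%:C)) (r - nrm (z - l%:C))).
    by rewrite lt_min zl0 subr_gt0.
  move=> w; rewrite lt_min => /andP[w1 w2].
  have wl : w != l%:C by apply: contraTneq w1 => ->; rewrite nrm_dist ltxx.
  by split=> //; apply: hr => //; have := ler_nrm_dist z w l%:C; lra.
have nrmR s : nrm (s%:C - l%:C : C) = `|s - l| by rewrite -rmorphB nrm_real.
have rs s : `|s - l| < r -> s != l -> resolvent_set A0 s%:C.
  by move=> sr sl; apply: hr; rewrite ?nrmR// (inj_eq (@complexI _)).
exists O, M; split => //.
  split => // k Dk z [zr /eqP zl]; have [d d0 hd] := away z zr zl.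
  by apply: (weyl_derivable hilH hilG qbt Dk d0) => w /hd[].
exists g => //; pose h z := if z == l%:C then RM T Gamma0 Gamma1 l g else (z - l%:C) *: M z g.
exists 1%N, O, h; split => //; last 2 first.
- by rewrite /h eqxx.
- by move=> z _ zl; rewrite /h (negPf zl) expr1 scalerA mulVf ?scale1r// subr_eq0.
move=> z zr; apply: quadratic_approx_derivable; have [->|zl] := eqVneq z l%:C; last first.
  have [d d0 hd] := away z zr zl.
  apply: (@quadratic_approx_ext _ _ (fun z => (z - l%:C) *: M z g) _ _ d d0).
    by move=> w /hd[_ wl]; rewrite /h (negPf wl).
  apply: quadratic_approxM; apply: (weyl_quadratic hilH hilG qbt Dg d0).
  by move=> w /hd[].
pose x := gam 'i%C g; pose p := E [set l] x.
have Ix : E `]l - r, l + r[%classic (x - p) = 0.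
  apply: sp_gap_union => //; apply: sp_null_of_resolvent => s /andP[s1 s2].
    by apply: rs; [rewrite ltr_norml; apply/andP; split; lra|rewrite lt_eqF].
  by apply: rs; [rewrite ltr_norml; apply/andP; split; lra|rewrite gt_eqF].
have [y [y0 hy]] := sp_gap_chain hilH lA sA spE r0 Ix.
have hy' n : dom A0 (y n.+1) /\ opshift A0 l%:C (y n.+1) = y n by have [] := hy n.
have xpy : x = p + y 0%N by rewrite y0 addrC subrK.
have pe : op_eigenspace A0 l%:C p by exact: eigenproj_eigen.
have [c c0 hc] := Gamma1_res_bounded hilH hilG qbt i0.
pose Lr := laurent_rem T Gamma0 Gamma1 'i%C g p y.
pose La := laurent T Gamma0 Gamma1 l%:C 'i%C g p y.
exists (RM T Gamma0 Gamma1 l g), (La 0%N).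
have r2 : 0 < r / 2 by lra.
eexists; exists (r / 2); split=> // w wr; rewrite /h.
have [->|wl] := eqVneq w l%:C.
  rewrite !subrr nrm0 scale0r subr0 nrm0 expr0n/= mulr0.
  exact: lexx.
have rw : resolvent_set A0 w by apply: hr => //; lra.
rewrite (weyl_laurent qbt ri Dg pe xpy rw wl) (RM_eq l i0 Dg) -/x -/p.
rewrite (laurent_step qbt 'i%C g p hy' 0 rw) -/(La 0%N) -/(Lr 1%N w).
have -> : ('i%C - l%:C) *: Gamma1 p + (w - l%:C) *: (La 0%N + (w - l%:C) *: Lr 1%N w) -
    ('i%C - l%:C) *: Gamma1 p - (w - l%:C) *: La 0%N =
    (w - l%:C) *: ((w - l%:C) *: Lr 1%N w) by lmod_ring.
rewrite !nrmZ mulrA -expr2 mulrC ler_wpM2r ?exprn_ge0 ?nrm_ge0//.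
apply: (laurent_rem_bound hilH qbt 'i%C g p c0 hc rw r2 (ltW wr) _ (lexx _)).
have [_ Iy _ _] := hy 1%N.
apply: le_trans (sp_res_gap hilH lA sA spE rw r0 Iy).
by rewrite ler_wpM2r ?nrm_ge0//; lra.
Qed.

End Interval.

(** * The residue in the strong sense *)

(** Only real points of a larger disc are required, so openness of U at the two points l - r and l +
    r does the work of a compactness argument. *)
Lemma closed_ball_margin (U : set C^o) l (r : R) : 0 < r -> open U ->
  [set z : C | `|z - l%:C| <= r%:C] `<=` U ->
  exists2 rho : R, r < rho & forall s, `|s - l| < rho -> U s%:C.
Proof.
move=> r0 oU rU; have nrmR s t : nrm (s%:C - t%:C : C) = `|s - t| by rewrite -rmorphB nrm_real.
have Uin s : `|s - l| <= r -> U s%:C by move=> sr; apply: rU; rewrite /= nrmE lecR nrmR.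
have edge t : `|t - l| <= r -> exists2 d : R, 0 < d & forall s, `|s - t| < d -> U s%:C.
  move=> /Uin Ut; have [/= d d0 hd] := (@nbhs_nrmP R C^o _ _).1 (open_nbhs_nbhs (conj oU Ut)).
  by exists d => // s st; apply: hd; rewrite nrmR.
have [|d1 d10 h1] := edge (l + r); first by rewrite addrC addKr gtr0_norm.
have [|d2 d20 h2] := edge (l - r); first by rewrite addrC addKr normrN gtr0_norm.
exists (r + Num.min d1 d2); first by rewrite ltrDl lt_min d10.
move=> s; have : Num.min d1 d2 <= d1 /\ Num.min d1 d2 <= d2 by rewrite !ge_min !lexx orbT.
case; move: (Num.min d1 d2) => m m1 m2; rewrite ltr_norml => /andP[s1 s2].
have [sr|rs] := ltP (r + l) s.
  by apply: h1; rewrite ltr_norml; apply/andP; split; lra.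
have [sr|rs'] := ltP s (l - r).
  by apply: h2; rewrite ltr_norml; apply/andP; split; lra.
by apply: Uin; rewrite ler_norml; apply/andP; split; lra.
Qed.

(** The chain y_n decays like rho^(-n) while |z - l| <= r, which gives the ratio r / rho. The points
    z are nonreal because the gap hypothesis concerns only the vector gamma(i) g and puts no real
    point into the resolvent set. *)
Lemma weyl_expansion l (r rho : R) g : 0 < r -> r < rho -> D g ->
  E `]l - rho, l + rho[%classic (gam 'i%C g - E [set l] (gam 'i%C g)) = 0 ->
  exists (c : nat -> G) (K : R), forall n z, complex.Im z != 0 -> nrm (z - l%:C) <= r ->
    nrm ((z - l%:C) *: M z g - RM T Gamma0 Gamma1 l g -
      \sum_(k < n) (z - l%:C) ^+ k.+1 *: c k) <= K * (r / rho) ^+ n.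
Proof.
move=> r0 rr Dg; set x := gam 'i%C g; set p := E [set l] x => Ix.
have rho0 : 0 < rho by lra.
have [y [y0 hy]] := sp_gap_chain hilH lA sA spE rho0 Ix.
have hy' n : dom A0 (y n.+1) /\ opshift A0 l%:C (y n.+1) = y n by have [] := hy n.
have xpy : x = p + y 0%N by rewrite y0 addrC subrK.
have pe : op_eigenspace A0 l%:C p by exact: eigenproj_eigen.
have [c c0 hc] := Gamma1_res_bounded hilH hilG qbt i0.
pose Lb := laurent_base T Gamma0 Gamma1 'i%C g p y.
pose Lr := laurent_rem T Gamma0 Gamma1 'i%C g p y.
pose X := nrm (x - p); pose k := nrm (l%:C - 'i%C : C).
have k0 : 0 <= k := nrm_ge0 _; have X0 : 0 <= X := nrm_ge0 _.
have hX n : rho ^+ n * nrm (y n) <= X by have [] := hy n.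
pose B := nrm (M 'i%C g - Gamma1 p) + c * (rho * X + k * X).
have hB n : rho ^+ n * nrm (Lb n) <= B.
  have B0 : 0 <= c * (rho * X + k * X) by rewrite mulr_ge0// addr_ge0 ?mulr_ge0// ltW.
  case: n => [|n]; first by rewrite expr0 mul1r /Lb/= lerDl.
  (* Gamma1 y_(n+1) is bounded by writing y_(n+1) = R(i) f with f = y_n + (l - i) y_(n+1). *)
  have [Ay Sy] := hy' n; rewrite /Lb/= -(res_shift ri Ay); set f := opshift _ _ _.
  have fe : f = y n + (l%:C - 'i%C) *: y n.+1 by rewrite /f (shift_shift A0 'i%C l%:C) Sy.
  have rn : 0 <= rho ^+ n.+1 by rewrite exprn_ge0// ltW.
  apply: le_trans (ler_wpM2l rn (hc f)) _; rewrite mulrCA ler_wpDl ?nrm_ge0//.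
  rewrite ler_wpM2l//; apply: (@le_trans _ _ (rho ^+ n.+1 * (nrm (y n) + k * nrm (y n.+1)))).
    by rewrite ler_wpM2l// fe (le_trans (ler_nrmD _ _))// nrmZ.
  rewrite mulrDr lerD//; last by rewrite mulrCA ler_wpM2l.
  by rewrite exprS -mulrA ler_wpM2l// ltW.
pose K := B + (r + k) * (c * (1 + (r + k) / (rho - r))) * X.
have hK n z : complex.Im z != 0 -> nrm (z - l%:C) <= r -> rho ^+ n * nrm (Lr n z) <= K.
  move=> z0 zr; have rz := rho_nonreal z0; have rn : 0 <= rho ^+ n by rewrite exprn_ge0// ltW.
  have d0 : 0 < rho - r by lra.
  have hR : (rho - r) * nrm (res A0 z (y n)) <= nrm (y n).
    have [_ Iy _ _] := hy n; apply: le_trans (sp_res_gap hilH lA sA spE rz rho0 Iy).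
    by rewrite ler_wpM2r ?nrm_ge0//; lra.
  have := laurent_rem_bound hilH qbt 'i%C g p c0 hc rz d0 zr hR (lexx _).
  move/(ler_wpM2l rn)/le_trans; apply; rewrite mulrDr lerD//.
  have rk : 0 <= r + k by rewrite addr_ge0// ltW.
  rewrite mulrCA ler_wpM2l// mulr_ge0// mulr_ge0// addr_ge0// divr_ge0//.
  exact: ltW.
exists (laurent T Gamma0 Gamma1 l%:C 'i%C g p y), (r * K); move=> n z z0 zr.
have rz := rho_nonreal z0; have zl : z != l%:C by apply: contraNneq z0 => ->.
rewrite (weyl_laurent qbt ri Dg pe xpy rz zl) (RM_eq l i0 Dg) -/x -/p.
rewrite [_ + _ - ('i%C - l%:C) *: _]addrAC subrr add0r (laurent_sum qbt 'i%C g p hy' n rz) scalerDr scaler_sumr.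
rewrite (eq_bigr (fun i : 'I_n => (z - l%:C) ^+ i.+1 *: laurent T Gamma0 Gamma1 l%:C 'i%C g p y i)).
  rewrite addrAC subrr add0r scalerA -exprS nrmZ nrmX expr_div_n.
  have rn : 0 < rho ^+ n by rewrite exprn_gt0.
  rewrite mulrA ler_pdivlMr// -/(Lr n z) -[leLHS]mulrA [_ * rho ^+ n]mulrC.
  apply: (@le_trans _ _ (r ^+ n.+1 * K)); last by rewrite exprS mulrAC.
  apply: ler_pM; [by rewrite exprn_ge0 ?nrm_ge0|by rewrite mulr_ge0 ?nrm_ge0 ?(ltW rn)| |exact: hK].
  by rewrite ler_pXn2r ?nnegrE ?nrm_ge0// ltW.
by move=> i _; rewrite scalerA -exprS.
Qed.

(** The continuation N makes E vanish on gamma(i) g over an interval slightly larger than the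
    diameter of the circle, apart from l. The resulting expansion of (z - l) N(z) g is uniform on
    the circle, with constant term R_l M g. *)
Lemma RM_strong_residue l : is_strong_residue T Gamma0 Gamma1 l%:C (RM T Gamma0 Gamma1 l).
Proof.
move=> r U N r0 oU rU hN g Dg; pose a := RM T Gamma0 Gamma1 l g.
exists ((2 * pi%:C * 'i%C) *: a); last first.
  rewrite scalerA mulVf ?scale1r// !mulf_neq0 ?pnatr_eq0 ?neq0Ci//.
  by rewrite eq_complex/= eqxx andbT gt_eqF// pi_gt0.
have [rho rr hU] := closed_ball_margin r0 oU rU.
(* An intermediate radius: the expansion is used on the disc of radius r1, so that points of the
   circle can be perturbed off the real axis. *)
pose r1 := (r + rho) / 2; have r10 : 0 < r1 by rewrite /r1; lra.
have r1r : r1 < rho by rewrite /r1; lra.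
have rr1 : r < r1 by rewrite /r1; lra.
have rho0 : 0 < rho by lra.
have oU' := open_setD1 (z := l%:C) oU.
have Ix : E `]l - rho, l + rho[%classic (gam 'i%C g - E [set l] (gam 'i%C g)) = 0.
  apply: (sp_gap_union rho0); apply: (sp_null_of_extension i0 Dg oU' hN) => s /andP[s1 s2].
    split; first by apply: hU; rewrite ltr_norml; apply/andP; split; lra.
    by move/complexI => sl; move: s2; rewrite sl ltxx.
  split; first by apply: hU; rewrite ltr_norml; apply/andP; split; lra.
  by move/complexI => sl; move: s1; rewrite sl ltxx.
have [c [K hK]] := weyl_expansion r10 r1r Dg Ix.
apply: circle_integral_of_expansion => // e e0.
have [n hn] : exists n, K * (r1 / rho) ^+ n <= e.
  have q0 : 0 < r1 / rho by rewrite divr_gt0.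
  have q1 : `|r1 / rho| < 1 by rewrite gtr0_norm// ltr_pdivrMr// mul1r.
  have /cvgrPdist_le/(_ e e0)/filter_ex[n] := cvg_geometric K q1.
  by rewrite sub0r normrN => h; exists n; apply: le_trans h; exact: ler_norm.
exists n, c => zeta zr; set z := l%:C + zeta.
have zl : z - l%:C = zeta by rewrite /z addrC addKr.
pose F (w : C^o) : G := ((w : C) - l%:C) *: N w g - a - \sum_(k < n) ((w : C) - l%:C) ^+ k.+1 *: c k.
suff : nrm (F z) <= e by rewrite /F zl.
have Uz : (U `\ l%:C) z.
  split; first by apply: rU; rewrite /= zl nrmE lecR zr.
  by move=> /= zl'; move: zl zr; rewrite zl' subrr => <-; rewrite nrm0 => h; move: r0; rewrite h ltxx.
have [/= d d0 hd] := (@nbhs_nrmP R C^o _ _).1 (open_nbhs_nbhs (conj oU' Uz)).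
have cN : {for z, continuous (N^~ g : C^o -> G)}.
  apply/(cvg_nrmP (FF := @nbhs_filter C^o z)) => e' e'0; have [d' d'0 hd'] := derivable_continuous (hN.2 g Dg z Uz) e'0.
  by apply/(@nbhs_nrmP R C^o); exists d'.
(* The circle meets the real axis at two points, where N need not be given by M; there the bound
   follows from nearby nonreal points by continuity of N. *)
apply: (@continuous_nonreal_bound _ _ F z e (Num.min d (r1 - r))).
- have cS := continuous_shift_scale (w0 := l%:C) cN.
  exact: (cvgB (cvgB cS (cvg_cst _)) (@continuous_polynomial _ _ c l%:C z n)).
- by rewrite lt_min d0 subr_gt0.
move=> w; rewrite lt_min => /andP[/hd Uw wz] w0.
rewrite /F (hN.1 w g Uw (rho_nonreal w0) Dg); apply: le_trans hn; apply: hK => //.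
by have := ler_nrmD (w - z) (z - l%:C); rewrite addrA subrK zl zr; lra.
Qed.

End SpectralWeyl.

Theorem proposition3p6 (R : realType)
    (H : completeNormedModType R[i]) (ipH : {dot H for @Num.conj R[i]})
    (G : completeNormedModType R[i]) (ipG : {dot G for @Num.conj R[i]})
    (hilbertH : hilbert ipH) (separableH : separable_space H)
    (hilbertG : hilbert ipG)
    (S T : operator H) (Gamma0 Gamma1 : H -> G)
    (linearS : linear_operator S) (closedS : closed (graph S))
    (denseS : dense (dom S)) (symmetricS : symmetric_operator ipH S)
    (qbt : quasi_boundary_triple ipH ipG S T Gamma0 Gamma1)
    (E : set R -> H -> H)
    (spectralE : spectral_measure ipH (A_zero T Gamma0) E)
    (Delta : set R) (openDelta : open Delta) (itvDelta : is_interval Delta)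
    (simpleDelta : range (E Delta) =
       clsp [set x | exists (nu : R[i]) (g : G),
         [/\ complex.Im nu != 0, ran0 T Gamma0 g &
             x = E Delta (gamma_field T Gamma0 nu g)]])
    (lambda : R) (Delta_lambda : Delta lambda) :
  let A0 := A_zero T Gamma0 in
  let D := ran0 T Gamma0 in
  let RlM := RM T Gamma0 Gamma1 lambda in
  let ker := op_eigenspace A0 lambda%:C in
  (* (a) *)
  ((forall g, D g -> cvg (RM_net T Gamma0 Gamma1 lambda g @ 0^'+)) /\
   (is_eigenvalue A0 lambda%:C <-> exists2 g, D g & RlM g != 0) /\
   (is_eigenvalue A0 lambda%:C -> finite_dimensional ker ->
      set_bij ker (RlM @` D) Gamma1) /\
   (is_eigenvalue A0 lambda%:C -> ~ finite_dimensional ker ->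
      set_bij ker (closure_in (Gamma1 @` ker) (RlM @` D)) Gamma1)) /\
  (* (b) *)
  ((is_isolated_eigenvalue A0 lambda%:C <->
      strong_pole T Gamma0 Gamma1 lambda%:C) /\
   (is_isolated_eigenvalue A0 lambda%:C ->
      is_strong_residue T Gamma0 Gamma1 lambda%:C RlM)).

Proof.
move=> A0 D RlM ker; have i0 : complex.Im ('i%C : R[i]) != 0 by rewrite /= oner_eq0.
split; [split; [|split; [|split]]|split; [split|]].
- by move=> g Dg; apply: cvgP; exact: (RM_cvg hilbertH hilbertG qbt spectralE i0 Dg).
- exact: (eigenvalue_iff_RM hilbertH hilbertG qbt spectralE openDelta simpleDelta Delta_lambda).
- by move=> _; exact: (eigen_bij_finite hilbertH hilbertG qbt spectralE openDelta simpleDelta Delta_lambda).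
- by move=> _ _; exact: (eigen_bij_infinite hilbertH hilbertG qbt spectralE openDelta simpleDelta Delta_lambda).
- exact: (pole_of_isolated hilbertH hilbertG qbt spectralE openDelta simpleDelta Delta_lambda).
- exact: (isolated_of_pole hilbertH hilbertG qbt spectralE openDelta simpleDelta Delta_lambda).
- by move=> _; exact: (RM_strong_residue hilbertH hilbertG qbt spectralE).
Qed.
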